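(* Let the problem data and the meshes satisfy the assumptions listed in the context, let $\ell+1\ge m$, and let the penalty parameters $\alpha_1,\alpha_2,\alpha_3,\alpha_4$ be large enough. Assume that at least two of the following four requirements hold: (i) $b_0\ge b_m>0$; (ii) $a_0-b_0\ge a_m>0$; (iii) $c_0-b_0\ge c_m>0$; (iv) $\lambda<\lambda_M<\infty$ (with $a_m,b_m,c_m,\lambda_M$ constants). Let $a_1,b_1,c_1>0$ be the constants described in the context. Then there exist $\delta>0$, independent of $\mathbf K$ and $\boldsymbol\Theta$, and $C>0$, independent of $\boldsymbol\Theta$, $\mathbf K$ and the mesh size $h$, such that the following holds. If the transport velocity $\boldsymbol\eta\in\mathbf V_h^\ell$ satisfies $$|\boldsymbol\eta|_{dG,\infty}\le \delta\, a_1,$$ then the solution $(\mathbf u_h,p_h,T_h,\varphi_h)\in\mathbf V_h^\ell\times V_h^\ell\times V_h^\ell\times Q_h^m$ of the linearized discrete problem (P$_{\boldsymbol\eta}$) satisfies $$a_1\|T_h\|^2+b_1\|\varphi_h\|^2+c_1\|p_h\|^2+\|\mathbf u_h\|_{dG,e}^2+\|T_h\|_{dG,T}^2+\|p_h\|_{dG,p}^2\le C\left(\|H\|^2+\|g\|^2+\|\mathbf f\|^2\right).$$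
   Context: **Domain and data.** $\Omega\subset\mathbb R^d$, $d\in\{2,3\}$, is an open bounded Lipschitz polygonal/polyhedral domain; $(\cdot,\cdot)$ and $\|\cdot\|$ are the $L^2(\Omega)$ inner product and norm (scalar, vector or tensor), and $\|\cdot\|_F$ is the $L^2(F)$ norm. Assumptions on the data: $\mathbf K,\boldsymbol\Theta$ are symmetric $d\times d$ tensor fields with $k_m|\zeta|^2\le\zeta^T\mathbf K\zeta\le k_M|\zeta|^2$ and $\theta_m|\zeta|^2\le\zeta^T\boldsymbol\Theta\zeta\le\theta_M|\zeta|^2$ for all $\zeta\in\mathbb R^d$, a.e. in $\Omega$, with $k_M>k_m>0$, $\theta_M>\theta_m>0$; $\mu:\Omega\to[\mu_m,\mu_M]$, $c_f:\Omega\to[0,c_{fM}]$ with $0<\mu_m\le\mu_M$, $0\le c_{fM}$; $\alpha:\Omega\to(\phi,1]$ and $\beta:\Omega\to(0,\beta_M]$ are strictly positive ($\phi$ is the porosity); $\lambda,c_0,b_0,a_0$ are scalar fields with $\lambda\ge0$ and $a_0,c_0\ge b_0\ge0$ (the form $\mathcal M$ below presupposes that $\lambda^{-1}$ is defined); $g,H\in L^2(\Omega)$, $\mathbf f\in\mathbf L^2(\Omega)=[L^2(\Omega)]^d$. The fields $\boldsymbol\Theta,\mathbf K,\mu,c_f$ are constant on each mesh element. **Meshes.** $\{\mathcal T_h\}_h$ is a family of polytopic meshes of $\Omega$; $h_\kappa$ is the diameter of $\kappa\in\mathcal T_h$; $\mathcal F,\mathcal F_I,\mathcal F_B$ are the sets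 of all, interior and boundary faces (an interface is a planar simplicial subset of the intersection of the boundaries of two neighbouring elements). Uniformly in $h$: (A1) the mesh is polytopic regular: for every $\kappa$ there is a set of non-overlapping $d$-dimensional simplices $\{S_\kappa^F\}_{F\subset\partial\kappa}$ contained in $\kappa$ with $h_\kappa\lesssim d\,|S_\kappa^F|\,|F|^{-1}$ for every face $F\subset\partial\kappa$; (A2) $h_{\kappa^+}\lesssim h_{\kappa^-}\lesssim h_{\kappa^+}$ for neighbouring elements $\kappa^\pm$ (with the analogous property for polynomial degrees). Here $x\lesssim y$ means $x\le Cy$ with $C>0$ independent of the discretization parameters. Under (A1) the trace-inverse inequality $\|v\|_{L^2(\partial\kappa)}\le C_{\rm tr}h_\kappa^{-1/2}\ell\|v\|_{L^2(\kappa)}$ holds for $v\in\mathbb P^\ell(\kappa)$. **Spaces.** For $\ell,m\ge1$: $Q_h^m=\{\psi\in L^2(\Omega):\psi|_\kappa\in\mathbb P^m(\kappa)\ \forall\kappa\}$, $V_h^\ell=\{v\in L^2(\Omega):v|_\kappa\in\mathbb P^\ell(\kappa)\ \forall\kappa\}$, $\mathbf V_h^\ell=[V_h^\ell]^d$. $\nabla_h$, $\nabla_h\cdot$ and $\boldsymbol\epsilon_h(\mathbf u)=(\nabla_h\mathbf u+\nabla_h\mathbf u^T)/2$ are the element-wise operators. **Jumps and averages.** On an interior face shared by $\kappa^\pm$ with outward normals $\mathbf n^\pm$: $[\![a]\!]=a^+\mathbf n^++a^-\mathbf n^-$, $[\![\mathbf a]\!]=\mathbf a^+(\mathbf n^+)^T+\mathbf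 a^-(\mathbf n^-)^T$, $[\![\mathbf a]\!]_n=\mathbf a^+\cdot\mathbf n^++\mathbf a^-\cdot\mathbf n^-$, $\{\!\{a\}\!\}_\omega=\omega^+a^++\omega^-a^-$ (same for vectors and tensors) with $\omega^\pm\in[0,1]$, $\omega^++\omega^-=1$; no subscript means $\omega^\pm=1/2$. On a boundary face: $[\![a]\!]=a\mathbf n$, $[\![\mathbf a]\!]=\mathbf a\mathbf n^T$, $[\![\mathbf a]\!]_n=\mathbf a\cdot\mathbf n$, and averages are the single trace. Put $\delta_{\boldsymbol\Theta}^\pm=(\mathbf n^\pm)^T\boldsymbol\Theta^\pm\mathbf n^\pm$, $\delta_{\mathbf K}^\pm=(\mathbf n^\pm)^T\mathbf K^\pm\mathbf n^\pm$, $\omega_{\boldsymbol\Theta}^\pm=\delta_{\boldsymbol\Theta}^\mp/(\delta_{\boldsymbol\Theta}^++\delta_{\boldsymbol\Theta}^-)$, $\omega_{\mathbf K}^\pm=\delta_{\mathbf K}^\mp/(\delta_{\mathbf K}^++\delta_{\mathbf K}^-)$, $\omega_\mu^\pm=\mu^\mp/(\mu^++\mu^-)$; $\gamma_{\boldsymbol\Theta}=\delta_{\boldsymbol\Theta}^+\delta_{\boldsymbol\Theta}^-/(\delta_{\boldsymbol\Theta}^++\delta_{\boldsymbol\Theta}^-)$, $\gamma_{\mathbf K}=\delta_{\mathbf K}^+\delta_{\mathbf K}^-/(\delta_{\mathbf K}^++\delta_{\mathbf K}^-)$, $\gamma_\mu=\mu^+\mu^-/(\mu^++\mu^-)$; $\Theta_\kappa=|\sqrt{\boldsymbol\Theta|_\kappa}|_2^2$,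 $K_\kappa=|\sqrt{\mathbf K|_\kappa}|_2^2$, $\mu_\kappa=\mu|_\kappa$, with $|\cdot|_2$ the $\ell^2$-norm on $\mathbb R^{d\times d}$. Penalty functions, with constants $\alpha_1,\dots,\alpha_4>0$: on $F\in\mathcal F_I$, $\sigma=\alpha_1\gamma_{\boldsymbol\Theta}\max_{\kappa^\pm}(\ell^2/h_\kappa)$, $\xi=\alpha_2\gamma_{\mathbf K}\max_{\kappa^\pm}(\ell^2/h_\kappa)$, $\zeta=\alpha_3\gamma_\mu\max_{\kappa^\pm}(\ell^2/h_\kappa)$, $\varrho=\alpha_4\min_{\kappa^\pm}(h_\kappa/m)$; on $F\in\mathcal F_B$, $\sigma=\alpha_1\Theta_\kappa\ell^2/h_\kappa$, $\xi=\alpha_2K_\kappa\ell^2/h_\kappa$, $\zeta=\alpha_3\mu_\kappa\ell^2/h_\kappa$, $\varrho=\alpha_4h_\kappa/m$. **Forms.** $\mathcal M((p,T,\varphi),(q,S,\psi))=(b_0(p-T),q-S)+((a_0-b_0)T,S)+((c_0-b_0)p,q)+(\lambda^{-1}(\varphi+\alpha p+\beta T),\psi+\alpha q+\beta S)$; $\mathcal A_h^T(T,S)=(\boldsymbol\Theta\nabla_hT,\nabla_hS)-\sum_{F\in\mathcal F}\int_F(\{\!\{\boldsymbol\Theta\nabla_hT\}\!\}_{\omega_{\boldsymbol\Theta}}\cdot[\![S]\!]+[\![T]\!]\cdot\{\!\{\boldsymbol\Theta\nabla_hS\}\!\}_{\omega_{\boldsymbol\Theta}}-\sigma[\![T]\!]\cdot[\![S]\!])$;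 $\mathcal A_h^p(p,q)=(\mathbf K\nabla_hp,\nabla_hq)-\sum_{F\in\mathcal F}\int_F(\{\!\{\mathbf K\nabla_hp\}\!\}_{\omega_{\mathbf K}}\cdot[\![q]\!]+[\![p]\!]\cdot\{\!\{\mathbf K\nabla_hq\}\!\}_{\omega_{\mathbf K}}-\xi[\![p]\!]\cdot[\![q]\!])$; $\mathcal A_h^e(\mathbf u,\mathbf v)=(2\mu\boldsymbol\epsilon_h(\mathbf u),\boldsymbol\epsilon_h(\mathbf v))-\sum_{F\in\mathcal F}\int_F(\{\!\{2\mu\boldsymbol\epsilon_h(\mathbf u)\}\!\}_{\omega_\mu}:[\![\mathbf v]\!]+[\![\mathbf u]\!]:\{\!\{2\mu\boldsymbol\epsilon_h(\mathbf v)\}\!\}_{\omega_\mu}-\zeta[\![\mathbf u]\!]:[\![\mathbf v]\!])$; $\mathcal B_h(\varphi,\mathbf v)=-(\varphi,\nabla_h\cdot\mathbf v)+\sum_{F\in\mathcal F}\int_F\{\!\{\varphi\}\!\}[\![\mathbf v]\!]_n$; $\quad\mathcal D_h(\varphi,\psi)=\sum_{F\in\mathcal F_I}\int_F\varrho[\![\varphi]\!]\cdot[\![\psi]\!]$; $\mathcal C_h^{\rm stab}(T,S)=(\boldsymbol\eta\cdot\nabla_hT,S)-\sum_{F\in\mathcal F_I}\int_F(\{\!\{\boldsymbol\eta\}\!\}\cdot[\![T]\!])\{\!\{S\}\!\}+\sum_{F\in\mathcal F_I}\int_F\tfrac{|\{\!\{\boldsymbol\eta\}\!\}\cdot\mathbf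 n|}{2}[\![T]\!]\cdot[\![S]\!]+\sum_{F\in\mathcal F_B}\int_F(\boldsymbol\eta\cdot\mathbf n)^\ominus TS$, where $(x)^\ominus=\frac12(|x|-x)$. **Linearized discrete problem (P$_{\boldsymbol\eta}$).** Given $\boldsymbol\eta$, find $(\mathbf u_h,p_h,T_h,\varphi_h)\in\mathbf V_h^\ell\times V_h^\ell\times V_h^\ell\times Q_h^m$ such that for all $(\mathbf v_h,q_h,S_h,\psi_h)$ in the same space $$\mathcal M((p_h,T_h,\varphi_h),(q_h,S_h,\psi_h))+\mathcal A_h^T(T_h,S_h)+\mathcal C_h^{\rm stab}(T_h,S_h)+\mathcal A_h^p(p_h,q_h)+\mathcal A_h^e(\mathbf u_h,\mathbf v_h)-\mathcal B_h(\varphi_h,\mathbf v_h)+\mathcal B_h(\psi_h,\mathbf u_h)+\mathcal D_h(\varphi_h,\psi_h)=(H,S_h)+(g,q_h)+(\mathbf f,\mathbf v_h).$$ **Norms.** $\|S\|_{dG,T}^2=\|\sqrt{\boldsymbol\Theta}\nabla_hS\|^2+\sum_{F\in\mathcal F}\|\sigma^{1/2}[\![S]\!]\|_F^2$; $\|q\|_{dG,p}^2=\|\sqrt{\mathbf K}\nabla_hq\|^2+\sum_{F\in\mathcal F}\|\xi^{1/2}[\![q]\!]\|_F^2$; $\|\mathbf v\|_{dG,e}^2=\|\sqrt{2\mu}\boldsymbol\epsilon_h(\mathbf v)\|^2+\sum_{F\in\mathcal F}\|\zeta^{1/2}[\![\mathbf v]\!]\|_F^2$; $|\mathbf v|_{dG,\infty}=\|\nabla_h\cdot\mathbf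 v\|_{L^\infty(\Omega)}+\max_{F\in\mathcal F}\max_{\kappa\in\{\kappa^+,\kappa^-\}}(\ell^2h_\kappa^{-1})\|[\![\mathbf v]\!]_n\|_{L^\infty(F)}$ (on boundary faces only the single adjacent element is considered). **Constants $a_1,b_1,c_1$.** These are fixed strictly positive constants for which every solution of (P$_{\boldsymbol\eta}$) (for any $\boldsymbol\eta$ and any data $H,g,\mathbf f$) satisfies $a_1\|T_h\|^2+b_1\|\varphi_h\|^2+c_1\|p_h\|^2\lesssim\mathcal M((p_h,T_h,\varphi_h),(p_h,T_h,\varphi_h))+\mathcal D_h(\varphi_h,\varphi_h)+\|\mathbf u_h\|_{dG,e}^2+\|\mathbf f\|^2$, with $a_1,b_1,c_1$ and the hidden constant independent of $h,\mathbf K,\boldsymbol\Theta$. *)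

(* Defs.v *)
From HB Require Import structures.
From mathcomp Require Import all_boot all_order all_algebra.
From mathcomp Require Import all_classical all_reals all_analysis.
From mathcomp Require mpoly.

Set Implicit Arguments.
Unset Strict Implicit.
Unset Printing Implicit Defensive.

Import Order.TTheory GRing.Theory Num.Theory.
Import numFieldNormedType.Exports.

Local Open Scope classical_set_scope.
Local Open Scope ring_scope.

Definition measure_row_display : measure_display. Proof. exact. Qed.

Section measurable_row.
Context {R : realType} (n : nat).

Let coor : 'I_n -> 'rV[R]_n -> measurableTypeR R := fun i x => x ord0 i.

Let row_set0 : g_sigma_preimage coor set0.
Proof. exact: sigma_algebra0. Qed.

Let row_setC A : g_sigma_preimage coor A -> g_sigma_preimage coor (~` A).
Proof. exact: sigma_algebraC. Qed.

Let row_bigcup (F : _^nat) : (forall i, g_sigma_preimage coor (F i)) ->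
  g_sigma_preimage coor (\bigcup_i (F i)).
Proof. exact: sigma_algebra_bigcup. Qed.

HB.instance Definition _ := @isMeasurable.Build measure_row_display
  'rV[R]_n (g_sigma_preimage coor) row_set0 row_setC row_bigcup.

End measurable_row.

Section lebesgue_row.
Context {R : realType}.

Definition row_cons n (xv : measurableTypeR R * 'rV[R]_n) : 'rV[R]_n.+1 :=
  \row_i (if unlift ord0 i is Some j then xv.2 ord0 j else xv.1).

Lemma measurable_coor n (i : 'I_n) :
  measurable_fun [set: 'rV[R]_n]
    (fun x : 'rV[R]_n => (x ord0 i : measurableTypeR R)).
Proof.
move=> _ Y mY; rewrite setTI; apply: sub_sigma_algebra => /=.
rewrite -bigcup_seq/=; exists i => /=; first by rewrite mem_index_enum.
by exists Y => //; rewrite setTI.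
Qed.

Lemma measurable_fun_row d (T : measurableType d) n (f : T -> 'rV[R]_n) :
  (forall i, measurable_fun setT (fun t => f t ord0 i : measurableTypeR R)) ->
  measurable_fun setT f.
Proof.
move=> mf.
suff : g_sigma_preimage (fun (i : 'I_n) =>
    (fun x : 'rV[R]_n => (x ord0 i : measurableTypeR R)) \o f) `<=` measurable.
  by rewrite g_sigma_preimage_comp => H _ A mA; apply: H; exists A.
apply: smallest_sub; first exact: sigma_algebra_measurable.
case: n f mf => [|n] f mf; first by rewrite big_ord0.
rewrite -bigcup_mkord_ord; apply: bigcup_sub => i Ii A [B mB <-].
exact: mf.
Qed.

Definition row_uncons n (x : 'rV[R]_n.+1) : measurableTypeR R * 'rV[R]_n :=
  (x ord0 ord0, \row_j x ord0 (lift ord0 j)).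

Lemma row_consK n : cancel (@row_cons n) (@row_uncons n).
Proof.
move=> [a b]; rewrite /row_uncons !mxE unlift_none; congr pair.
by apply/rowP => j; rewrite !mxE liftK.
Qed.

Lemma measurable_row_cons n : measurable_fun setT (@row_cons n).
Proof.
apply: measurable_fun_row => i.
case: (unliftP ord0 i) => [j|] ->.
- apply: (eq_measurable_fun ((fun x : 'rV[R]_n => x ord0 j) \o snd)).
    by move=> -[a b] _ /=; rewrite mxE liftK.
  exact: (measurableT_comp (@measurable_coor n j)).
- apply: (eq_measurable_fun fst) => //.
  by move=> -[a b] _ /=; rewrite mxE unlift_none.
Qed.

Lemma measurable_row_uncons n : measurable_fun setT (@row_uncons n).
Proof.
apply: measurable_fun_pair; first exact: measurable_coor.
apply: measurable_fun_row => j.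
apply: (eq_measurable_fun
  (fun x : 'rV[R]_n.+1 => x ord0 (lift ord0 j) : measurableTypeR R)).
  by move=> x _; rewrite mxE.
exact: measurable_coor.
Qed.

Section step.
Variables (n : nat) (m : {sigma_finite_measure set 'rV[R]_n -> \bar R}).

Definition leb_step : set 'rV[R]_n.+1 -> \bar R :=
  pushforward (@lebesgue_measure R \x m)%E (@row_cons n).

Let leb_step0 : leb_step set0 = 0%E.
Proof. by rewrite /leb_step /pushforward preimage_set0 measure0. Qed.

Let leb_step_ge0 A : (0 <= leb_step A)%E.
Proof. by rewrite /leb_step /pushforward measure_ge0. Qed.

Let leb_step_sigma_additive : semi_sigma_additive leb_step.
Proof.
pose m' : {measure set _ -> \bar R} :=
  measure_function_pushforward__canonical__measure_function_Measure
    (lebesgue_measure \x m)%E (@measurable_row_cons n).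
exact: (@measure_semi_sigma_additive _ _ _ m').
Qed.

HB.instance Definition _ := isMeasure.Build _ _ _ leb_step
  leb_step0 leb_step_ge0 leb_step_sigma_additive.

Let leb_step_sigma_finite : sigma_finite setT leb_step.
Proof.
have /sigma_finiteP[F [TF ndF Foo]] := sigma_finiteT (@lebesgue_measure R).
have /sigma_finiteP[G [TG ndG Goo]] := sigma_finiteT m.
exists (fun k => @row_uncons n @^-1` (F k `*` G k)).
  rewrite -preimage_bigcup; apply/esym; rewrite -subTset => x _ /=.
  have [k _ Fk] : (\bigcup_i F i) (row_uncons x).1 by rewrite -TF.
  have [k' _ Gk'] : (\bigcup_i G i) (row_uncons x).2 by rewrite -TG.
  exists (maxn k k') => //; split => /=.
  - by move: Fk; exact/subsetPset/ndF/leq_maxl.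
  - by move: Gk'; exact/subsetPset/ndG/leq_maxr.
move=> k; have [mF Fk] := Foo k; have [mG Gk] := Goo k; split.
  rewrite -[X in measurable X]setTI; apply: measurable_row_uncons => //.
  exact: measurableX.
rewrite /leb_step /pushforward -comp_preimage (_ : _ \o _ = id); last first.
  by apply/funext => x /=; rewrite row_consK.
by rewrite preimage_id product_measure1E// lte_mul_pinfty// ge0_fin_numE.
Qed.

HB.instance Definition _ := Measure_isSigmaFinite.Build _ _ _ leb_step
  leb_step_sigma_finite.

End step.

(* The n-fold product of the one-dimensional Lebesgue measure. *)
Fixpoint leb n : {sigma_finite_measure set 'rV[R]_n -> \bar R} :=
  if n is n'.+1 then leb_step (leb n') else \d_(0 : 'rV[R]_0).

End lebesgue_row.

Section geometry.
Context {R : realType}.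

(* Euclidean product of vectors and Frobenius product [A : B] of tensors. *)
Definition mxdot p q (A B : 'M[R]_(p, q)) : R :=
  \sum_(i < p) \sum_(j < q) A i j * B i j.

Definition enorm q (x : 'rV[R]_q) : R := Num.sqrt (mxdot x x).

(* Points are row vectors: [mxapp A x] is the row vector of the product of
   [A] with the column vector of [x]. *)
Definition mxapp q (A : 'M[R]_q) (x : 'rV[R]_q) : 'rV[R]_q := x *m A^T.

(* The nonnegative symmetric square root; it exists and is unique as soon as
   [A] is symmetric and nonnegative. *)
Definition mxsqrt q (A : 'M[R]_q) : 'M[R]_q :=
  get [set B : 'M[R]_q | [/\ B^T = B, forall x, 0 <= mxdot x (mxapp B x)
                           & B *m B = A]].

Definition mxnorm2 q (A : 'M[R]_q) : R :=
  sup [set enorm (mxapp A x) | x in [set x | enorm x <= 1]].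

Definition frontier q (A : set 'rV[R]_q) : set 'rV[R]_q :=
  closure A `\` interior A.

Definition diam q (A : set 'rV[R]_q) : R :=
  sup [set enorm (xy.1 - xy.2) | xy in A `*` A].

(* A k-dimensional simplex is the matrix of its k+1 vertices (its rows). *)
Definition simplex k q (V : 'M[R]_(k.+1, q)) : set 'rV[R]_q :=
  [set x | exists t : 'rV[R]_k.+1, [/\ forall i, 0 <= t ord0 i,
     \sum_i t ord0 i = 1 & x = t *m V]].

Definition open_simplex k q (V : 'M[R]_(k.+1, q)) : set 'rV[R]_q :=
  [set x | exists t : 'rV[R]_k.+1, [/\ forall i, 0 < t ord0 i,
     \sum_i t ord0 i = 1 & x = t *m V]].

Definition edges k q (V : 'M[R]_(k.+1, q)) : 'M[R]_(k, q) :=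
  \matrix_(i, j) (V (lift ord0 i) j - V ord0 j).

Definition nondegenerate k q (V : 'M[R]_(k.+1, q)) : Prop :=
  row_free (edges V).

(* The square root of the Gram determinant is the k-dimensional volume of the
   parallelotope spanned by the edges. *)
Definition gram k q (V : 'M[R]_(k.+1, q)) : R :=
  Num.sqrt (\det (edges V *m (edges V)^T)).

Definition simplex_vol k q (V : 'M[R]_(k.+1, q)) : R := gram V / k`!%:R.

Definition refsimplex k : set 'rV[R]_k :=
  [set t | (forall i, 0 <= t ord0 i) /\ \sum_i t ord0 i <= 1].

Definition simplex_param k q (V : 'M[R]_(k.+1, q)) (t : 'rV[R]_k) : 'rV[R]_q :=
  row ord0 V + t *m edges V.

(* Integral with respect to the k-dimensional surface measure. *)
Definition simplex_integral k q (V : 'M[R]_(k.+1, q)) (f : 'rV[R]_q -> R) : R :=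
  gram V * \int[leb k]_(t in @refsimplex k) f (simplex_param V t).

Definition Linfty q (D : set 'rV[R]_q) (f : 'rV[R]_q -> R) : \bar R :=
  Lnorm (leb q) +oo%E (fun x => (f x * \1_D x)%:E).

Definition simplex_Linfty k q (V : 'M[R]_(k.+1, q)) (f : 'rV[R]_q -> R) :
    \bar R :=
  Linfty (@refsimplex k) (fun t => f (simplex_param V t)).

(* Lipschitz boundary: near each boundary point, and in suitable orthonormal
   coordinates, the set lies below the graph of a Lipschitz function. *)
Definition lipschitz_boundary q (A : set 'rV[R]_q.+1) : Prop :=
  forall x, frontier A x ->
  exists (Q : 'M[R]_q.+1) (r : R) (g : 'rV[R]_q -> R),
    [/\ Q *m Q^T = 1%:M, 0 < r, lipschitz g &
      forall y, enorm (y - x) < r ->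
        (A y <-> (y *m Q) ord0 ord0 < g (\row_j (y *m Q) ord0 (lift ord0 j)))].

Definition polyhedral q (A : set 'rV[R]_q.+1) : Prop :=
  exists2 s : seq 'M[R]_(q.+1, q.+1), (forall V, V \in s -> nondegenerate V) &
    frontier A = [set x | exists2 V, V \in s & simplex V x].

Record polyhedral_domain q (A : set 'rV[R]_q.+1) : Prop := {
  pd_open : open A;
  pd_nonempty : A !=set0;
  pd_connected : connected A;
  pd_bounded : bounded_set A;
  pd_polyhedral : polyhedral A;
  pd_lipschitz : lipschitz_boundary A
}.

End geometry.

(* The space dimension is n.+1. A face is a simplex of dimension n;
   [kplus F] is the element kappa^+, [kminus F] is the element kappa^- (None
   on a boundary face), and [normal F] is n^+, the unit normal pointing out of
   kappa^+ (so that n^- = - n^+). *)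
Record polymesh (R : realType) (n : nat) (Om : set 'rV[R]_n.+1) := Polymesh {
  elt : finType;
  dom : elt -> set 'rV[R]_n.+1;
  face : finType;
  fvert : face -> 'M[R]_(n.+1, n.+1);
  normal : face -> 'rV[R]_n.+1;
  kplus : face -> elt;
  kminus : face -> option elt;
  adj := fun F k => (k == kplus F) || (Some k == kminus F);
  dom_open : forall k, open (dom k);
  dom_nonempty : forall k, dom k !=set0;
  dom_connected : forall k, connected (dom k);
  dom_disjoint : forall k k', k != k' -> dom k `&` dom k' = set0;
  dom_sub : forall k, dom k `<=` Om;
  dom_cover : closure Om = \bigcup_k closure (dom k);
  face_nondegenerate : forall F, nondegenerate (fvert F);
  face_disjoint : forall F G, F != G ->
    open_simplex (fvert F) `&` open_simplex (fvert G) = set0;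
  face_two_elements : forall F, kminus F != Some (kplus F);
  dom_frontier : forall k,
    frontier (dom k) = \bigcup_(F in [set F | adj F k]) simplex (fvert F);
  normal_unit : forall F, enorm (normal F) = 1;
  normal_orthogonal : forall F, edges (fvert F) *m (normal F)^T = 0;
  (* points of F lying on another face (e.g. on its relative boundary) are
     irrelevant for the orientation of F *)
  normal_outward : forall F x, simplex (fvert F) x ->
    (forall G, G != F -> ~ simplex (fvert G) x) ->
    exists2 e : R, 0 < e & forall s, 0 < s < e ->
      dom (kplus F) (x - s *: normal F) /\
      (if kminus F is Some k then dom k (x + s *: normal F)
       else ~ closure Om (x + s *: normal F))
}.

Section regularity.
Context {R : realType} {n : nat} {Om : set 'rV[R]_n.+1}.

Definition hdiam (M : polymesh Om) (k : elt M) : R := diam (dom k).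

(* S_kappa^F is the simplex of base F; its vertices are listed with the one
   opposite to F first. The ratio d |S| / |F| is its height above F. *)
Definition polytopic_regular (C : R) (M : polymesh Om) : Prop :=
  forall k : elt M, exists S : face M -> 'M[R]_(n.+2, n.+1),
    (forall F, adj F k -> [/\ row' ord0 (S F) = fvert F, nondegenerate (S F),
       simplex (S F) `<=` closure (dom k) &
       hdiam k <= C * (n.+1%:R * simplex_vol (S F) / simplex_vol (fvert F))]) /\
    (forall F G, adj F k -> adj G k -> F != G ->
       open_simplex (S F) `&` open_simplex (S G) = set0).

Definition local_bounded_variation (C : R) (M : polymesh Om) : Prop :=
  forall (F : face M) k, kminus F = Some k ->
    hdiam k <= C * hdiam (kplus F) /\ hdiam (kplus F) <= C * hdiam k.

Definition regular_family (I : Type) (M : I -> polymesh Om) : Prop :=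
  exists2 C : R, 0 < C & forall i,
    polytopic_regular C (M i) /\ local_bounded_variation C (M i).

End regularity.

Record coefficients (R : realType) (n : nat) := Coefficients {
  mu : 'rV[R]_n.+1 -> R;
  c_f : 'rV[R]_n.+1 -> R;
  alpha : 'rV[R]_n.+1 -> R;
  beta : 'rV[R]_n.+1 -> R;
  porosity : 'rV[R]_n.+1 -> R;
  lam : 'rV[R]_n.+1 -> R;
  a0 : 'rV[R]_n.+1 -> R;
  b0 : 'rV[R]_n.+1 -> R;
  c0 : 'rV[R]_n.+1 -> R
}.

(* alpha_1, ..., alpha_4 *)
Record penalties (R : realType) := Penalties { al1 : R; al2 : R; al3 : R; al4 : R }.

Section data.
Context {R : realType} {n : nat} (Om : set 'rV[R]_n.+1).
Notation E := 'rV[R]_n.+1.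

Definition ae_on (P : E -> Prop) : Prop :=
  {ae leb n.+1, forall x, Om x -> P x}.

Definition elementwise_constant (T : Type) (M : polymesh Om) (f : E -> T) :=
  forall k : elt M, exists c, forall x, dom k x -> f x = c.

Definition L1_field (f : E -> R) : Prop :=
  (leb n.+1).-integrable Om (EFin \o f).

Definition L2_field (f : E -> R) : Prop :=
  measurable_fun Om f /\ L1_field (fun x => f x ^+ 2).

Definition L2_vfield (f : E -> E) : Prop :=
  forall i, L2_field (fun x => f x ord0 i).

Definition sqnormL2 (f : E -> R) : R := \int[leb n.+1]_(x in Om) (f x ^+ 2).

Definition vsqnormL2 (f : E -> E) : R :=
  \int[leb n.+1]_(x in Om) mxdot (f x) (f x).

(* Standing assumptions on the scalar coefficients. The integrability of a0,
   b0, c0 and 1/lambda (with lambda > 0 a.e.) is what makes the form M defined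
   on bounded functions. *)
Record admissible_coefficients (cs : coefficients R n)
    (mu_m mu_M cf_M beta_M : R) : Prop := {
  adm_const : [/\ 0 < mu_m, mu_m <= mu_M & 0 <= cf_M];
  adm_mu : ae_on (fun x => mu_m <= mu cs x <= mu_M);
  adm_cf : ae_on (fun x => 0 <= c_f cs x <= cf_M);
  adm_porosity : ae_on (fun x => 0 <= porosity cs x);
  adm_alpha : ae_on (fun x => porosity cs x < alpha cs x <= 1);
  adm_beta : ae_on (fun x => 0 < beta cs x <= beta_M);
  adm_lam : ae_on (fun x => 0 < lam cs x);
  adm_a0 : ae_on (fun x => b0 cs x <= a0 cs x);
  adm_c0 : ae_on (fun x => b0 cs x <= c0 cs x);
  adm_b0 : ae_on (fun x => 0 <= b0 cs x);
  adm_meas : [/\ measurable_fun Om (alpha cs), measurable_fun Om (beta cs)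
               & measurable_fun Om (lam cs)];
  adm_int : [/\ L1_field (a0 cs), L1_field (b0 cs), L1_field (c0 cs)
              & L1_field (fun x => (lam cs x)^-1)]
}.

Definition admissible_tensor (M : polymesh Om) (K : E -> 'M[R]_n.+1) : Prop :=
  [/\ elementwise_constant M K, ae_on (fun x => (K x)^T = K x) &
    exists k_m k_M : R, [/\ 0 < k_m, k_m < k_M &
      ae_on (fun x => forall z : E,
        k_m * mxdot z z <= mxdot z (mxapp (K x) z) <= k_M * mxdot z z)]].

Definition at_least_two (P1 P2 P3 P4 : Prop) : Prop :=
  (P1 /\ P2) \/ (P1 /\ P3) \/ (P1 /\ P4) \/ (P2 /\ P3) \/ (P2 /\ P4) \/
  (P3 /\ P4).

Definition bounded_below (f : E -> R) : Prop :=
  exists2 c : R, 0 < c & ae_on (fun x => c <= f x).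

Definition two_of_four (cs : coefficients R n) : Prop :=
  at_least_two (bounded_below (b0 cs))
    (bounded_below (fun x => a0 cs x - b0 cs x))
    (bounded_below (fun x => c0 cs x - b0 cs x))
    (exists lam_M : R, ae_on (fun x => lam cs x < lam_M)).

End data.

(* The notations of mpoly are incompatible with those of MathComp-Analysis. *)
Import -(notations) mpoly.

Section broken.
Context {R : realType} {n : nat} {Om : set 'rV[R]_n.+1} (M : polymesh Om).
Notation E := 'rV[R]_n.+1.

(* A function that is polynomial on each element is the family of its
   polynomials: this gives at once its traces from both sides of a face and
   its element-wise derivatives. *)
Definition bpoly := elt M -> mpoly n.+1 R.
Definition bvpoly := 'I_n.+1 -> bpoly.

Definition in_P (l : nat) (v : bpoly) : Prop :=
  forall k, (msize (v k) <= l.+1)%N.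
Definition in_Pv (l : nat) (v : bvpoly) : Prop := forall i, in_P l (v i).

Definition peval (p : mpoly n.+1 R) (x : E) : R :=
  meval (fun i => x ord0 i) p.

Definition bval (v : bpoly) (k : elt M) (x : E) : R := peval (v k) x.
Definition bvval (v : bvpoly) (k : elt M) (x : E) : E := \row_i peval (v i k) x.
Definition grad (v : bpoly) (k : elt M) (x : E) : E :=
  \row_j peval (mderiv j (v k)) x.
Definition vgrad (v : bvpoly) (k : elt M) (x : E) : 'M[R]_n.+1 :=
  \matrix_(i, j) peval (mderiv j (v i k)) x.
Definition eps (v : bvpoly) (k : elt M) (x : E) : 'M[R]_n.+1 :=
  2^-1 *: (vgrad v k x + (vgrad v k x)^T).
Definition divg (v : bvpoly) (k : elt M) (x : E) : R :=
  \sum_i peval (mderiv i (v i k)) x.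

Definition intE (f : elt M -> E -> R) : R :=
  \sum_k \int[leb n.+1]_(x in dom k) f k x.
Definition intF (F : face M) (f : E -> R) : R := simplex_integral (fvert F) f.

Definition sumF (f : face M -> R) : R := \sum_F f F.
Definition sumFI (f : face M -> R) : R := \sum_(F | isSome (kminus F)) f F.
Definition sumFB (f : face M -> R) : R := \sum_(F | ~~ isSome (kminus F)) f F.

(* The value on the element k of a field that is constant there. *)
Definition onelt (T : Type) (f : E -> T) (k : elt M) : T := f (get (dom k)).

Definition jump (a : elt M -> E -> R) (F : face M) (x : E) : E :=
  let k := kplus F in
  if kminus F is Some k' then a k x *: normal F + a k' x *: (- normal F)
  else a k x *: normal F.

Definition vjump (a : elt M -> E -> E) (F : face M) (x : E) : 'M[R]_n.+1 :=
  let k := kplus F in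
  if kminus F is Some k'
  then (a k x)^T *m normal F + (a k' x)^T *m (- normal F)
  else (a k x)^T *m normal F.

Definition njump (a : elt M -> E -> E) (F : face M) (x : E) : R :=
  let k := kplus F in
  if kminus F is Some k'
  then mxdot (a k x) (normal F) + mxdot (a k' x) (- normal F)
  else mxdot (a k x) (normal F).

(* [w F k k'] is the weight of the trace from k, k' being the other element. *)
Definition wavg (V : lmodType R) (w : face M -> elt M -> elt M -> R)
    (a : elt M -> E -> V) (F : face M) (x : E) : V :=
  let k := kplus F in
  if kminus F is Some k' then w F k k' *: a k x + w F k' k *: a k' x
  else a k x.

Definition avg (V : lmodType R) : (elt M -> E -> V) -> face M -> E -> V :=
  wavg (fun _ _ _ => 2^-1).

Definition savg (a : elt M -> E -> R) : face M -> E -> R := @avg R^o a.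

(* (n^{+-})^T A n^{+-} does not depend on the sign of the normal. *)
Definition delta (A : E -> 'M[R]_n.+1) (F : face M) (k : elt M) : R :=
  mxdot (normal F) (mxapp (onelt A k) (normal F)).

Definition omega_t (A : E -> 'M[R]_n.+1) (F : face M) (k k' : elt M) : R :=
  delta A F k' / (delta A F k + delta A F k').
Definition omega_s (a : E -> R) (F : face M) (k k' : elt M) : R :=
  onelt a k' / (onelt a k + onelt a k').

Definition gamma_t (A : E -> 'M[R]_n.+1) (F : face M) (k k' : elt M) : R :=
  delta A F k * delta A F k' / (delta A F k + delta A F k').
Definition gamma_s (a : E -> R) (k k' : elt M) : R :=
  onelt a k * onelt a k' / (onelt a k + onelt a k').

(* The maximum of l^2 / h over the elements adjacent to F. *)
Definition l2h (l : nat) (F : face M) : R :=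
  let r k := l%:R ^+ 2 / hdiam k in
  if kminus F is Some k' then Num.max (r (kplus F)) (r k') else r (kplus F).

(* sigma and xi; the factor is Theta_kappa (resp. K_kappa) on the boundary *)
Definition pen_t (al : R) (l : nat) (A : E -> 'M[R]_n.+1) (F : face M) : R :=
  if kminus F is Some k' then al * gamma_t A F (kplus F) k' * l2h l F
  else al * mxnorm2 (mxsqrt (onelt A (kplus F))) ^+ 2 * l2h l F.

Definition pen_s (al : R) (l : nat) (a : E -> R) (F : face M) : R :=
  if kminus F is Some k' then al * gamma_s a (kplus F) k' * l2h l F
  else al * onelt a (kplus F) * l2h l F.

(* varrho *)
Definition pen_D (al : R) (m : nat) (F : face M) : R :=
  let r k := hdiam k / m%:R in
  if kminus F is Some k' then al * Num.min (r (kplus F)) (r k')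
  else al * r (kplus F).

End broken.

Record dstate (R : realType) (n : nat) (Om : set 'rV[R]_n.+1)
    (M : polymesh Om) := Dstate {
  du : bvpoly M;
  dp : bpoly M;
  dT : bpoly M;
  dphi : bpoly M
}.

Section forms.
Context {R : realType} {n : nat} {Om : set 'rV[R]_n.+1} {M : polymesh Om}.
Notation E := 'rV[R]_n.+1.
Variables (l m : nat) (cs : coefficients R n) (al : penalties R).
Variables (K Theta : E -> 'M[R]_n.+1).

Definition in_space (w : dstate M) : Prop :=
  [/\ in_Pv l (du w), in_P l (dp w), in_P l (dT w) & in_P m (dphi w)].

Definition form_M (w w' : dstate M) : R :=
  intE (fun k x =>
    let p := bval (dp w) k x in let q := bval (dp w') k x in
    let T := bval (dT w) k x in let S := bval (dT w') k x in
    let phi := bval (dphi w) k x in let psi := bval (dphi w') k x in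
    b0 cs x * (p - T) * (q - S) + (a0 cs x - b0 cs x) * T * S
    + (c0 cs x - b0 cs x) * p * q
    + (lam cs x)^-1 * (phi + alpha cs x * p + beta cs x * T)
                    * (psi + alpha cs x * q + beta cs x * S)).

Definition form_diff (A : E -> 'M[R]_n.+1) (pen : face M -> R)
    (T S : bpoly M) : R :=
  let flux (v : bpoly M) k x := mxapp (A x) (grad v k x) in
  let trace_flux (v : bpoly M) k x := mxapp (onelt A k) (grad v k x) in
  intE (fun k x => mxdot (flux T k x) (grad S k x))
  - sumF (fun F => intF F (fun x =>
      mxdot (wavg (omega_t A) (trace_flux T) F x) (jump (bval S) F x)
      + mxdot (jump (bval T) F x) (wavg (omega_t A) (trace_flux S) F x)
      - pen F * mxdot (jump (bval T) F x) (jump (bval S) F x))).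

Definition form_AT : bpoly M -> bpoly M -> R :=
  form_diff Theta (pen_t (al1 al) l Theta).

Definition form_Ap : bpoly M -> bpoly M -> R :=
  form_diff K (pen_t (al2 al) l K).

Definition zeta : face M -> R := pen_s (al3 al) l (mu cs).

Definition form_Ae (u v : bvpoly M) : R :=
  let trace_flux (w : bvpoly M) k x := (2 * onelt (mu cs) k) *: eps w k x in
  intE (fun k x => mxdot ((2 * mu cs x) *: eps u k x) (eps v k x))
  - sumF (fun F => intF F (fun x =>
      mxdot (wavg (omega_s (mu cs)) (trace_flux u) F x)
        (vjump (bvval v) F x)
      + mxdot (vjump (bvval u) F x)
          (wavg (omega_s (mu cs)) (trace_flux v) F x)
      - zeta F * mxdot (vjump (bvval u) F x) (vjump (bvval v) F x))).

Definition form_B (phi : bpoly M) (v : bvpoly M) : R :=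
  - intE (fun k x => bval phi k x * divg v k x)
  + sumF (fun F => intF F (fun x => savg (bval phi) F x * njump (bvval v) F x)).

Definition form_D (phi psi : bpoly M) : R :=
  sumFI (fun F => intF F (fun x =>
    pen_D (al4 al) m F * mxdot (jump (bval phi) F x) (jump (bval psi) F x))).

Definition form_C (eta : bvpoly M) (T S : bpoly M) : R :=
  intE (fun k x => mxdot (bvval eta k x) (grad T k x) * bval S k x)
  - sumFI (fun F => intF F (fun x =>
      mxdot (avg (bvval eta) F x) (jump (bval T) F x) * savg (bval S) F x))
  + sumFI (fun F => intF F (fun x =>
      `|mxdot (avg (bvval eta) F x) (normal F)| / 2
      * mxdot (jump (bval T) F x) (jump (bval S) F x)))
  + sumFB (fun F => intF F (fun x =>
      let e := mxdot (bvval eta (kplus F) x) (normal F) in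
      2^-1 * (`|e| - e) * bval T (kplus F) x * bval S (kplus F) x)).

Definition form_rhs (H g : E -> R) (f : E -> E) (w : dstate M) : R :=
  intE (fun k x => H x * bval (dT w) k x)
  + intE (fun k x => g x * bval (dp w) k x)
  + intE (fun k x => mxdot (f x) (bvval (du w) k x)).

Definition is_solution (eta : bvpoly M) (H g : E -> R) (f : E -> E)
    (w : dstate M) : Prop :=
  in_space w /\ forall w', in_space w' ->
    form_M w w' + form_AT (dT w) (dT w') + form_C eta (dT w) (dT w')
    + form_Ap (dp w) (dp w') + form_Ae (du w) (du w')
    - form_B (dphi w) (du w') + form_B (dphi w') (du w)
    + form_D (dphi w) (dphi w')
    = form_rhs H g f w'.

Definition sqL2 (v : bpoly M) : R := intE (fun k x => bval v k x ^+ 2).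

Definition sq_dG_diff (A : E -> 'M[R]_n.+1) (pen : face M -> R)
    (v : bpoly M) : R :=
  intE (fun k x => enorm (mxapp (mxsqrt (A x)) (grad v k x)) ^+ 2)
  + sumF (fun F => intF F (fun x =>
      enorm (Num.sqrt (pen F) *: jump (bval v) F x) ^+ 2)).

Definition sq_dGT : bpoly M -> R :=
  sq_dG_diff Theta (pen_t (al1 al) l Theta).

Definition sq_dGp : bpoly M -> R :=
  sq_dG_diff K (pen_t (al2 al) l K).

Definition sq_dGe (v : bvpoly M) : R :=
  intE (fun k x => let t := Num.sqrt (2 * mu cs x) *: eps v k x in mxdot t t)
  + sumF (fun F => intF F (fun x =>
      let t := Num.sqrt (zeta F) *: vjump (bvval v) F x in mxdot t t)).

Definition dG_infty (v : bvpoly M) : \bar R :=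
  (\big[maxe/0]_(k : elt M) Linfty (dom k) (divg v k)
   + \big[maxe/0]_(F : face M)
       ((l2h l F)%:E * simplex_Linfty (fvert F) (njump (bvval v) F)))%E.

End forms.

(* The constant C does not depend on the mesh, on K and Theta, nor on the
   velocity and the right-hand side. *)
Definition stability_constants (R : realType) (n : nat)
    (Om : set 'rV[R]_n.+1) (I : Type) (M : I -> polymesh Om) (l m : nat)
    (cs : coefficients R n) (al : penalties R) (a1 b1 c1 : R) : Prop :=
  exists2 C : R, 0 < C &
  forall (i : I) (K Theta : 'rV[R]_n.+1 -> 'M[R]_n.+1),
    admissible_tensor (M i) K -> admissible_tensor (M i) Theta ->
  forall (eta : bvpoly (M i)) (H g : 'rV[R]_n.+1 -> R)
    (f : 'rV[R]_n.+1 -> 'rV[R]_n.+1),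
    in_Pv l eta -> L2_field Om H -> L2_field Om g -> L2_vfield Om f ->
  forall w : dstate (M i), is_solution l m cs al K Theta eta H g f w ->
    a1 * sqL2 (dT w) + b1 * sqL2 (dphi w) + c1 * sqL2 (dp w)
    <= C * (form_M cs w w + form_D m al (dphi w) (dphi w)
            + sq_dGe l cs al (du w) + vsqnormL2 Om f).

(* Main.v *)
From HB Require Import structures.
Require Import Defs.
From mathcomp Require Import all_boot all_order all_algebra.
From mathcomp Require Import all_classical all_reals all_analysis.
From mathcomp Require Import fingroup perm measurable_realfun ess_sup_inf.
From mathcomp Require mpoly.
From mathcomp Require Import ring lra complex spectral sesquilinear.

Set Implicit Arguments.
Unset Strict Implicit.
Unset Printing Implicit Defensive.

Import Order.TTheory GRing.Theory Num.Theory.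
Import numFieldNormedType.Exports.
Import -(notations) mpoly.
Import Defs.

Local Open Scope classical_set_scope.
Local Open Scope ring_scope.

Section row_measurability.
Context {R : realType}.

Lemma row_ballP n (x y : 'rV[R]_n) (e : R) : 0 < e ->
  ball x e y <-> forall i, `|x ord0 i - y ord0 i| < e.
Proof.
move=> e0; split=> [[_ h] i|h]; first exact: h.
by split=> // i j; rewrite ord1; exact: h.
Qed.

Lemma open_rowP n (A : set 'rV[R]_n) : open A ->
  forall x, A x -> exists2 e : R, 0 < e &
    forall y : 'rV[R]_n, (forall i, `|x ord0 i - y ord0 i| < e) -> A y.
Proof.
rewrite openE => oA x /oA; rewrite /interior -nbhs_ballE => -[e /= e0 h].
by exists e => // y hy; apply: h; apply/row_ballP.
Qed.

Lemma measurable_coor_lt n (i : 'I_n) (c : R) (e : R) :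
  measurable [set x : 'rV[R]_n | `|c - x ord0 i| < e].
Proof.
have := @measurable_coor R n i measurableT (ball c e) (open_measurable (ball_open _ _)).
by rewrite setTI.
Qed.

Lemma measurable_rowball n (c : 'rV[R]_n) (e : R) :
  measurable [set x : 'rV[R]_n | forall i, `|c ord0 i - x ord0 i| < e].
Proof.
have -> : [set x : 'rV[R]_n | forall i, `|c ord0 i - x ord0 i| < e] =
   \bigcap_(i in [set: 'I_n]) [set x : 'rV[R]_n | `|c ord0 i - x ord0 i| < e].
  by apply/seteqP; split=> x h i => [_|]; exact: h.
apply: fin_bigcap_measurable => [|i _]; first exact: finite_finset.
exact: measurable_coor_lt.
Qed.

(** The coordinate sigma-algebra contains the open sets because an open set is
    a countable union of boxes with rational centre and radius. *)
Lemma open_measurable_row n (A : set 'rV[R]_n) : open A -> measurable A.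
Proof.
move=> oA.
pose B (q : 'rV[rat]_n * rat) : set 'rV[R]_n :=
  [set x | forall i, `|ratr (q.1 ord0 i) - x ord0 i| < ratr q.2].
have -> : A = \bigcup_(q : 'rV[rat]_n * rat)
    (if pselect (B q `<=` A) then B q else set0).
  apply/seteqP; split=> x; last first.
    by move=> [q _]; case: pselect => // h; exact: h.
  move=> /(open_rowP oA)[e e0 he].
  have [r] := @rat_in_itvoo R 0 (e / 2) (divr_gt0 e0 (ltr0Sn _ _)).
  rewrite in_itv /= => /andP[r0 re].
  have /choice[q hq] : forall i, exists q : rat, `|ratr q - x ord0 i| < ratr r.
    move=> i; have xr : x ord0 i - ratr r < x ord0 i + ratr r by lra.
    have [q] := rat_in_itvoo xr.
    by rewrite in_itv /= => /andP[h1 h2]; exists q; rewrite ltr_norml; lra.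
  exists (\row_i q i, r) => //; case: pselect => [h|h].
    by move=> i /=; rewrite mxE; exact: hq.
  case: h => y hy; apply: he => i; have := hy i; have := hq i; rewrite /= mxE.
  rewrite !ltr_norml => /andP[h1 h2] /andP[h3 h4]; apply/andP; split; lra.
apply: countable_bigcupT_measurable => // q; case: pselect => h /=; last exact: measurable0.
have := @measurable_rowball n (\row_i ratr (q.1 ord0 i)) (ratr q.2).
by congr (measurable _); apply/seteqP; split=> x hx i; move: (hx i); rewrite mxE.
Qed.

Lemma closed_measurable_row n (A : set 'rV[R]_n) : closed A -> measurable A.
Proof.
by move=> cA; rewrite -[A]setCK; apply: measurableC; apply: open_measurable_row;
  exact: closed_openC.
Qed.

Lemma continuous_measurable_row n (f : 'rV[R]_n -> R) :
  continuous f -> measurable_fun setT (f : _ -> measurableTypeR R).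
Proof.
move=> /continuousP cf; apply: (measurability _ (RGenOpens.measurableE R)).
move=> _ [_ [a [b ->] <-]]; rewrite setTI; apply: open_measurable_row.
exact/cf/interval_open.
Qed.

End row_measurability.

Section row_fubini.
Context {R : realType}.
Local Notation mu1 := (@lebesgue_measure R).

(** Translation and dilation of the line, on measurable nonnegative
    functions. *)
Lemma ge0_integral_lebesgue_affine (a b : R) (f : measurableTypeR R -> \bar R) :
  a != 0 -> measurable_fun setT f -> (forall x, (0 <= f x)%E) ->
  (`|a|%:E * \int[mu1]_x f (a * x + b)%R = \int[mu1]_x f x)%E.
Proof.
move=> a0 mf f0.
pose phi : measurableTypeR R -> measurableTypeR R := fun x => a * x + b.
have mphi : measurable_fun setT phi.
  apply: continuous_measurable_fun => x.
  by apply: cvgD; [apply: cvgM => //; exact: cvg_cst|exact: cvg_cst].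
pose nu : {measure set (measurableTypeR R) -> \bar R} :=
  mscale (NngNum (normr_ge0 a))
   (measure_function_pushforward__canonical__measure_function_Measure mu1 mphi).
have nuE : forall A, measurable A -> mu1 A = nu A.
  apply: lebesgue_measure_unique => _ [[u v] /= _ <-].
  rewrite /nu /= /mscale /= /pushforward.
  have := a0; rewrite neq_lt => /orP[alt|agt].
    have -> : phi @^-1` `]u, v]%classic = `[(v - b) / a, (u - b) / a[%classic.
      apply/seteqP; split=> x /=; rewrite !in_itv /= /phi.
        by rewrite ler_ndivrMr // ltr_ndivlMr // => /andP[h1 h2]; apply/andP; split; lra.
      by rewrite ler_ndivrMr // ltr_ndivlMr // => /andP[h1 h2]; apply/andP; split; lra.
    rewrite !lebesgue_measure_itv /= !lte_fin ltr_nM2r ?invr_lt0 // ltrD2r.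
    case: ifP => uv; last by rewrite mule0.
    rewrite -!EFinB -EFinM ltr0_norm //; congr _%:E; field.
    by rewrite a0.
  have -> : phi @^-1` `]u, v]%classic = `](u - b) / a, (v - b) / a]%classic.
    apply/seteqP; split=> x /=; rewrite !in_itv /= /phi.
      by rewrite ler_pdivlMr // ltr_pdivrMr // => /andP[h1 h2]; apply/andP; split; lra.
    by rewrite ler_pdivlMr // ltr_pdivrMr // => /andP[h1 h2]; apply/andP; split; lra.
  rewrite !lebesgue_measure_itv /= !lte_fin ltr_pM2r ?invr_gt0 // ltrD2r.
  case: ifP => uv; last by rewrite mule0.
  rewrite -!EFinB -EFinM gtr0_norm //; congr _%:E; field.
  by rewrite a0.
transitivity (\int[nu]_x f x)%E; last first.
  by apply: eq_measure_integral => A mA _; exact/esym/nuE.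
rewrite ge0_integral_mscale //=; congr (_ * _)%E.
by rewrite ge0_integral_pushforward.
Qed.

Lemma ge0_integral_lebS n (f : 'rV[R]_n.+1 -> \bar R) :
  measurable_fun setT f -> (forall x, (0 <= f x)%E) ->
  (\int[leb n.+1]_x f x =
   \int[mu1]_t \int[leb n]_y f (row_cons (t, y)))%E.
Proof.
move=> mf f0.
transitivity (\int[mu1 \x leb n]_z f (row_cons z))%E.
  rewrite [LHS](_ : _ =
    \int[pushforward (mu1 \x leb n)%E (@row_cons R n)]_x f x)%E //.
  rewrite ge0_integral_pushforward //; exact: measurable_row_cons.
rewrite fubini_tonelli1 //.
by apply: measurableT_comp => //; exact: measurable_row_cons.
Qed.

Lemma ge0_integral_lebS_swap n (f : 'rV[R]_n.+1 -> \bar R) :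
  measurable_fun setT f -> (forall x, (0 <= f x)%E) ->
  (\int[leb n.+1]_x f x =
   \int[leb n]_y \int[mu1]_t f (row_cons (t, y)))%E.
Proof.
move=> mf f0; rewrite ge0_integral_lebS //.
apply: (@fubini_tonelli _ _ _ _ _ mu1 (leb n) (f \o (@row_cons R n))).
- by apply: measurableT_comp => //; exact: measurable_row_cons.
- by move=> x; exact: f0.
Qed.

Lemma measurable_row_cons1 n (t : R) :
  measurable_fun setT (fun y : 'rV[R]_n => row_cons (t, y)).
Proof.
apply: measurableT_comp; first exact: measurable_row_cons.
exact: measurable_pair1.
Qed.

Lemma measurable_row_cons2 n (y : 'rV[R]_n) :
  measurable_fun setT (fun t : measurableTypeR R => row_cons (t, y)).
Proof.
apply: measurableT_comp; first exact: measurable_row_cons.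
exact: measurable_pair2.
Qed.

End row_fubini.


Section row_linear_change.
Context {R : realType}.
Local Notation mu1 := (@lebesgue_measure R).

Lemma continuous_coor n (i : 'I_n) : continuous (fun x : 'rV[R]_n => x ord0 i).
Proof. by move=> x; exact: coord_continuous. Qed.

Lemma measurable_affine m n (A : 'M[R]_(m, n)) (b : 'rV[R]_n) :
  measurable_fun setT (fun x : 'rV[R]_m => x *m A + b).
Proof.
apply: measurable_fun_row => i.
apply: (eq_measurable_fun (fun x : 'rV[R]_m =>
  (\sum_j (x ord0 j * A j i)) + b ord0 i)).
  by move=> x _; rewrite !mxE.
apply: measurable_funD => //; apply: measurable_sum => j.
apply: measurable_funM => //; exact: measurable_coor.
Qed.

Lemma measurable_linear m n (A : 'M[R]_(m, n)) :
  measurable_fun setT (fun x : 'rV[R]_m => x *m A).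
Proof.
by apply: (eq_measurable_fun (fun x : 'rV[R]_m => x *m A + 0)) => [x _|];
  [rewrite addr0|exact: measurable_affine].
Qed.

Lemma measurable_shift n (b : 'rV[R]_n) : measurable_fun setT (fun x : 'rV[R]_n => x + b).
Proof.
by apply: (eq_measurable_fun (fun x : 'rV[R]_n => x *m 1%:M + b)) => [x _|];
  [rewrite mulmx1|exact: measurable_affine].
Qed.

Lemma ge0_integral_leb_shift n (b : 'rV[R]_n) (f : 'rV[R]_n -> \bar R) :
  measurable_fun setT f -> (forall x, (0 <= f x)%E) ->
  (\int[leb n]_x f (x + b)%R = \int[leb n]_x f x)%E.
Proof.
elim: n b f => [|n IH] b f mf f0.
  by apply: eq_integral => x _; rewrite [x + b]thinmx0 [x]thinmx0.
rewrite !ge0_integral_lebS //; last first.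
  by apply: measurableT_comp => //; exact: measurable_shift.
pose b' : 'rV[R]_n := \row_j b ord0 (lift ord0 j).
have cons_shift t y : row_cons (t, y) + b = row_cons (t + b ord0 ord0, y + b').
  apply/rowP => i; rewrite !mxE; case: (unliftP ord0 i) => [j ->|->] /=.
    by rewrite ?liftK /= !mxE.
  by rewrite ?unlift_none.
transitivity (\int[mu1]_t \int[leb n]_y f (row_cons (t + b ord0 ord0, y))%R)%E.
  apply: eq_integral => t _; rewrite -[RHS](IH b').
  - by apply: eq_integral => y _; rewrite cons_shift.
  - by apply: measurableT_comp => //; exact: measurable_row_cons1.
  - by move=> y; exact: f0.
have mF : measurable_fun setT (fun t => \int[leb n]_y f (row_cons (t, y)))%E.
  apply: (@measurable_fun_fubini_tonelli_F _ _ _ _ _ _ (f \o (@row_cons R n))); last by move=> x; exact: f0.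
  by apply: measurableT_comp => //; exact: measurable_row_cons.
rewrite -[RHS](@ge0_integral_lebesgue_affine _ 1 (b ord0 ord0)) ?oner_eq0 //.
  by rewrite normr1 mul1e; apply: eq_integral => t _; rewrite mul1r.
by move=> t; apply: integral_ge0.
Qed.

Definition linear_change n (A : 'M[R]_n) := forall f : 'rV[R]_n -> \bar R,
  measurable_fun setT f -> (forall x, (0 <= f x)%E) ->
  (`|\det A|%:E * \int[leb n]_x f (x *m A)%R = \int[leb n]_x f x)%E.

Lemma linear_changeM n (A B : 'M[R]_n) :
  linear_change A -> linear_change B -> linear_change (A *m B).
Proof.
move=> hA hB f mf f0.
rewrite det_mulmx normrM mulrC EFinM -muleA -[RHS]hB //; congr (_ * _)%E.
rewrite -[RHS]hA //; last by apply: measurableT_comp => //; exact: measurable_linear.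
by congr (_ * _)%E; apply: eq_integral => x _; rewrite mulmxA.
Qed.

Lemma row_consE n (t : R) (y : 'rV[R]_n) :
  row_cons (t, y) = row_mx (t%:M : 'M[R]_1) y :> 'rV[R]_(1 + n).
Proof.
apply/rowP => i; rewrite mxE; case: (unliftP ord0 i) => [j ->|->] /=.
  have -> : lift ord0 j = rshift 1 j :> 'I_(1 + n) by apply: val_inj.
  by rewrite row_mxEr.
have -> : ord0 = lshift n ord0 :> 'I_(1 + n) by apply: val_inj.
by rewrite row_mxEl mxE.
Qed.

Lemma linear_change_upper n (a : R) (b : 'rV[R]_n) : a != 0 ->
  linear_change (block_mx (a%:M : 'M[R]_1) b 0 1%:M : 'M[R]_(1 + n)).
Proof.
move=> a0 f mf f0.
rewrite det_ublock det1 mulr1 det_scalar1.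
have mfc : measurable_fun setT (f \o (@row_cons R n)).
  by apply: measurableT_comp => //; exact: measurable_row_cons.
have mF := @measurable_fun_fubini_tonelli_F _ _ _ _ _ (leb n) _ mfc
  (fun x => f0 (row_cons x)).
rewrite !ge0_integral_lebS //; last first.
  by apply: measurableT_comp => //; exact: measurable_linear.
rewrite -[RHS](@ge0_integral_lebesgue_affine _ a 0) //; last first.
  by move=> t; apply: integral_ge0.
congr (_ * _)%E; apply: eq_integral => t _.
rewrite -[RHS](@ge0_integral_leb_shift _ (t *: b)) //; first last.
- by apply: measurableT_comp => //; exact: measurable_row_cons1.
apply: eq_integral => y _; congr f.
rewrite !row_consE mul_row_block mulmx0 addr0 mulmx1 addr0.
by rewrite -scalar_mxM mulrC mul_scalar_mx addrC.
Qed.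

Lemma linear_change_lower n (c : 'cV[R]_n) (D : 'M[R]_n) : linear_change D ->
  linear_change (block_mx (1%:M : 'M[R]_1) 0 c D : 'M[R]_(1 + n)).
Proof.
move=> hD f mf f0.
rewrite det_lblock det1 mul1r.
rewrite !ge0_integral_lebS_swap //; last first.
  by apply: measurableT_comp => //; exact: measurable_linear.
have mfc : measurable_fun setT (f \o (@row_cons R n)).
  by apply: measurableT_comp => //; exact: measurable_row_cons.
have mG := @measurable_fun_fubini_tonelli_G _ _ _ _ _ mu1 _ mfc
  (fun x => f0 (row_cons x)).
rewrite -[RHS]hD //; last by move=> y; apply: integral_ge0.
congr (_ * _)%E; apply: eq_integral => y _.
rewrite -[RHS](@ge0_integral_lebesgue_affine _ 1 ((y *m c) ord0 ord0)) ?oner_eq0 //.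
- rewrite normr1 mul1e; apply: eq_integral => t _; congr f.
  rewrite !row_consE mul_row_block mulmx0 add0r mulmx1 mul1r; congr row_mx.
  by rewrite raddfD /= -mx11_scalar.
- by apply: measurableT_comp => //; exact: measurable_row_cons2.
Qed.

(** An invertible matrix is a product of block triangular matrices once its
    upper left entry is nonzero, which a shear achieves; a triangular factor is
    handled by integrating one coordinate at a time. *)
Lemma linear_change_unitmx n (A : 'M[R]_n) : A \in unitmx -> linear_change A.
Proof.
elim: n A => [|n IH] A uA.
  move=> f mf f0; rewrite det_mx00 normr1 mul1e.
  by apply: eq_integral => x _; rewrite [x *m A]thinmx0 [x]thinmx0.
have step (B : 'M[R]_(1 + n)) : B \in unitmx -> B ord0 ord0 != 0 -> linear_change B.
  move=> uB; set a := B ord0 ord0 => a0.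
  pose b := ursubmx B; pose c := dlsubmx B; pose D := drsubmx B.
  have aE : ulsubmx B = a%:M.
    rewrite [LHS]mx11_scalar; congr (_%:M); rewrite !mxE /a.
    by congr (B _ _); apply: val_inj.
  pose D' := D - a^-1 *: (c *m b).
  have BE : B = block_mx (1%:M : 'M[R]_1) 0 (a^-1 *: c) D' *m
                block_mx (a%:M : 'M[R]_1) b 0 1%:M.
    rewrite mulmx_block !mulmx0 !mul1mx !mul0mx !mulmx1 !addr0.
    rewrite mul_mx_scalar scalerA mulfV // scale1r -scalemxAl.
    by rewrite /D' addrC subrK -[LHS]submxK aE.
  rewrite BE; apply: linear_changeM; last exact: linear_change_upper.
  apply: linear_change_lower; apply: IH.
  move: uB; rewrite BE !unitmxE det_mulmx det_lblock det1 mul1r unitrM.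
  by case/andP.
have [A0|A0] := eqVneq (A ord0 ord0) 0; last exact: step.
have [j Aj] : exists j, A j ord0 != 0.
  apply/existsP; rewrite -[X in is_true X]negbK; apply/negP => /existsPn h.
  have := uA; rewrite unitmxE unitfE => /negP; apply; apply/eqP.
  rewrite (expand_det_col A ord0) big1 // => i _.
  by have /negPn/eqP -> := h i; rewrite mul0r.
have [j' jE] : exists j', j = lift ord0 j'.
  case: (unliftP ord0 j) Aj => [j' -> _|->]; first by exists j'.
  by rewrite A0 eqxx.
pose U (s : R) : 'M[R]_(1 + n) := block_mx (1%:M : 'M[R]_1) (s *: delta_mx ord0 j') 0 1%:M.
have UK : U (-1) *m U 1 = 1%:M.
  rewrite mulmx_block !mulmx0 !mul1mx !mul0mx !mulmx1 !addr0 !add0r.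
  by rewrite -scalerDl subrr scale0r -scalar_mx_block.
have -> : A = U (-1) *m (U 1 *m A) by rewrite mulmxA UK mul1mx.
apply: linear_changeM; first by apply: linear_change_upper; rewrite oner_eq0.
apply: step.
  by rewrite unitmx_mul uA andbT; have [] := mulmx1_unit UK.
have -> : (U 1 *m A) ord0 ord0 = A ord0 ord0 + A j ord0; last by rewrite A0 add0r.
have lshift0 : ord0 = lshift n ord0 :> 'I_(1 + n) by apply: val_inj.
have liftE k : lift (lshift n (ord0 : 'I_1)) k = rshift 1 k :> 'I_(1 + n).
  exact: val_inj.
rewrite mxE (bigD1 ord0) //= (bigD1 (lift ord0 j')) //= big1 => [|i].
  rewrite addr0 jE /U lshift0 liftE block_mxEul block_mxEur !mxE !eqxx.
  by rewrite mulr1n mulr1 !mul1r.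
case: (unliftP ord0 i) => [k ->|->]; last by rewrite eqxx.
move=> /andP[_ kj].
have kj' : k != j' by apply: contra kj => /eqP ->.
rewrite /U lshift0 liftE block_mxEur !mxE (negPf kj') andbF.
by rewrite mulr0 mul0r.
Qed.

End row_linear_change.

Section real_continuity.
Context {R : realType} {T : topologicalType}.
Implicit Types f g : T -> R.

Lemma contC (c : R) : continuous (fun _ : T => c).
Proof. by move=> x; exact: cvg_cst. Qed.

Lemma contD f g : continuous f -> continuous g -> continuous (fun x => f x + g x).
Proof. by move=> cf cg x; apply: cvgD; [exact: cf|exact: cg]. Qed.

Lemma contM f g : continuous f -> continuous g -> continuous (fun x => f x * g x).
Proof. by move=> cf cg x; apply: cvgM; [exact: cf|exact: cg]. Qed.

Lemma contN f : continuous f -> continuous (fun x => - f x).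
Proof. by move=> cf x; apply: cvgN; exact: cf. Qed.

Lemma contB f g : continuous f -> continuous g -> continuous (fun x => f x - g x).
Proof. by move=> cf cg; apply: contD => //; exact: contN. Qed.

Lemma cont_abs f : continuous f -> continuous (fun x => `|f x|).
Proof. by move=> cf x; apply: cvg_norm; exact: cf. Qed.

Lemma contX f k : continuous f -> continuous (fun x => f x ^+ k).
Proof.
move=> cf; elim: k => [|k IH]; first by under eq_fun do rewrite expr0; exact: contC.
by under eq_fun do rewrite exprS; exact: contM.
Qed.

Lemma cont_sum (J : Type) (r : seq J) (P : pred J) (F : J -> T -> R) :
  (forall j, continuous (F j)) -> continuous (fun x => \sum_(j <- r | P j) F j x).
Proof.
move=> cF; elim: r => [|j r IH].
  by under eq_fun do rewrite big_nil; exact: contC.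
under eq_fun do rewrite big_cons.
by case: (P j) => //; exact: contD.
Qed.

Lemma cont_prod (J : Type) (r : seq J) (P : pred J) (F : J -> T -> R) :
  (forall j, continuous (F j)) -> continuous (fun x => \prod_(j <- r | P j) F j x).
Proof.
move=> cF; elim: r => [|j r IH].
  by under eq_fun do rewrite big_nil; exact: contC.
under eq_fun do rewrite big_cons.
by case: (P j) => //; exact: contM.
Qed.

End real_continuity.

Section row_bounded.
Context {R : realType}.
Local Notation mu1 := (@lebesgue_measure R).

Definition boxed n (A : set 'rV[R]_n) :=
  exists r : R, forall x, A x -> forall i, `|x ord0 i| < r.

Lemma boxedS n (A B : set 'rV[R]_n) : A `<=` B -> boxed B -> boxed A.
Proof. by move=> AB [r hr]; exists r => x /AB; exact: hr. Qed.

Lemma bounded_set_boxed n (A : set 'rV[R]_n) : bounded_set A -> boxed A.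
Proof.
move=> bA; have [M [_ hM]] := bA.
have M1 : M < M + 1 by rewrite ltrDl.
exists (M + 2) => x Ax i; rewrite (@le_lt_trans _ _ (M + 1)) //; last first.
  by rewrite ltrD2l ltr1n.
apply: le_trans (hM _ M1 x Ax); rewrite [leRHS]/Num.norm /= mx_normrE.
exact: (le_bigmax (0:R) (fun j : 'I_1 * 'I_n => `|x j.1 j.2|) (ord0, i)).
Qed.

Lemma leb_rowball n (c : 'rV[R]_n) (e : R) : 0 < e ->
  leb n [set x : 'rV[R]_n | forall i, `|c ord0 i - x ord0 i| < e]
  = ((e *+ 2) ^+ n)%:E.
Proof.
move=> e0; elim: n c => [|n IH] c.
  rewrite expr0 /= diracE mem_set // => -[//].
rewrite [LHS]/= /leb_step /pushforward.
have -> : @row_cons R n @^-1` [set x | forall i, `|c ord0 i - x ord0 i| < e] =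
    @ball R R (c ord0 ord0) e `*`
    [set y : 'rV[R]_n | forall i, `|(\row_j c ord0 (lift ord0 j)) ord0 i - y ord0 i| < e].
  apply/seteqP; split=> -[t y] /= h.
    split; first by have := h ord0; rewrite mxE unlift_none.
    by move=> i; have := h (lift ord0 i); rewrite !mxE liftK.
  case: h => h0 h1 i; case: (unliftP ord0 i) => [j ->|->].
    by rewrite mxE liftK; have := h1 j; rewrite mxE.
  by rewrite mxE unlift_none.
rewrite product_measure1E; try exact: measurable_rowball; last first.
  exact: open_measurable (@ball_open R R _ _).
by rewrite IH [X in (X * _)%E](lebesgue_measure_ball (c ord0 ord0) (ltW e0)) -EFinM exprS.
Qed.

Lemma leb_boxed_lty n (A : set 'rV[R]_n) : measurable A -> boxed A ->
  (leb n A < +oo)%E.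
Proof.
move=> mA [r hr].
have e0 : 0 < `|r| + 1 by rewrite ltr_wpDl.
apply: (@le_lt_trans _ _ (((`|r| + 1) *+ 2) ^+ n)%:E); last exact: ltry.
rewrite -(leb_rowball (0 : 'rV[R]_n) e0); apply: le_measure.
- exact: mem_set.
- by apply: mem_set; exact: measurable_rowball.
move=> x Ax i; rewrite mxE sub0r normrN (lt_le_trans (hr _ Ax i)) //.
by rewrite (le_trans (ler_norm r)) // lerDl.
Qed.

Lemma leb_open_gt0 n (A : set 'rV[R]_n) : open A -> A !=set0 -> (0 < leb n A)%E.
Proof.
move=> oA [x Ax]; have [e e0 he] := open_rowP oA Ax.
apply: (@lt_le_trans _ _ ((e *+ 2) ^+ n)%:E).
  by rewrite lte_fin exprn_gt0 // pmulrn_lgt0.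
rewrite -(leb_rowball x e0); apply: le_measure => //; apply: mem_set.
- exact: measurable_rowball.
- exact: open_measurable_row.
Qed.

Lemma continuous_boxed n (f : 'rV[R]_n -> R) (A : set 'rV[R]_n) :
  continuous f -> boxed A -> exists M : R, forall x, A x -> `|f x| <= M.
Proof.
move=> cf [r hr].
pose K := [set v : 'rV[R]_n | forall i, `[- r, r]%classic (v ord0 i)].
have cK : compact K.
  by apply: (@rV_compact _ _ (fun=> `[- r, r]%classic)) => i; exact: segment_compact.
have cfK : compact (f @` K).
  by apply: continuous_compact => //; exact: continuous_subspaceT.
have [M [_ hM]] := compact_bounded cfK.
have M1 : M < M + 1 by rewrite ltrDl.
exists (M + 1) => x Ax; apply: (hM _ M1); exists x => // i; rewrite /= in_itv /=.
by have := hr _ Ax i; rewrite ltr_norml => /andP[/ltW -> /ltW ->].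
Qed.

Lemma integrable_bounded_boxed n (A : set 'rV[R]_n) (f : 'rV[R]_n -> R) (M : R) :
  measurable A -> boxed A -> measurable_fun A (f : _ -> measurableTypeR R) ->
  (forall x, A x -> `|f x| <= M) -> (leb n).-integrable A (EFin \o f).
Proof.
move=> mA bA mf hM; apply: measurable_bounded_integrable => //.
  exact: leb_boxed_lty.
exists M; split; first exact: num_real.
by move=> y My x Ax; apply: le_trans (ltW My); exact: hM.
Qed.

Lemma integrable_continuous_boxed n (A : set 'rV[R]_n) (f : 'rV[R]_n -> R) :
  measurable A -> boxed A -> continuous f -> (leb n).-integrable A (EFin \o f).
Proof.
move=> mA bA cf; have [M hM] := continuous_boxed cf bA.
apply: integrable_bounded_boxed hM => //.
by apply: measurable_funTS; exact: continuous_measurable_row.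
Qed.

(** Hyperplanes have measure zero: integrate first along a coordinate that the
    linear form depends on. *)
Lemma leb_hyperplane0 n (w : 'I_n -> R) (c : R) : (exists j, w j != 0) ->
  leb n [set x : 'rV[R]_n | \sum_j x ord0 j * w j = c] = 0%E.
Proof.
elim: n w c => [|n IH] w c; first by case=> -[].
move=> hw; set H := [set _ | _].
have mH : measurable H.
  have := @continuous_measurable_row R n.+1 (fun x => \sum_j x ord0 j * w j).
  move=> /(_ _ measurableT [set c] (measurable_set1 c)); rewrite setTI; apply.
  apply: cont_sum => j; apply: contM; [exact: continuous_coor|exact: contC].
have sumE t y : H (row_cons (t, y)) <->
    t * w ord0 + \sum_j y ord0 j * w (lift ord0 j) = c.
  rewrite /H /mkset big_ord_recl mxE unlift_none.
  by under eq_bigr do rewrite mxE liftK.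
rewrite -[H]setIT -integral_indic //.
have mI : measurable_fun setT (EFin \o \1_H : 'rV[R]_n.+1 -> \bar R).
  exact/measurable_EFinP/measurable_indic.
have [w0|w0] := eqVneq (w ord0) 0.
  rewrite ge0_integral_lebS //.
  rewrite integral0_eq // => t _.
  have mG : measurable [set y : 'rV[R]_n | \sum_j y ord0 j * w (lift ord0 j) = c].
    have := @continuous_measurable_row R n (fun x => \sum_j x ord0 j * w (lift ord0 j)).
    move=> /(_ _ measurableT [set c] (measurable_set1 c)); rewrite setTI; apply.
    apply: cont_sum => j; apply: contM; [exact: continuous_coor|exact: contC].
  transitivity (\int[leb n]_y
      (\1_[set y : 'rV[R]_n | \sum_j y ord0 j * w (lift ord0 j) = c] y)%:E)%E.
    apply: eq_integral => y _; congr (_%:E); rewrite !indicE; congr (nat_of_bool _)%:R.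
    apply/idP/idP => /set_mem h; apply/mem_set.
      by move/sumE: h; rewrite w0 mulr0 add0r.
    by apply/sumE; rewrite w0 mulr0 add0r.
  rewrite integral_indic // setIT; apply: IH.
  case: hw => j; case: (unliftP ord0 j) => [k ->|->] wj; first by exists k.
  by rewrite w0 eqxx in wj.
rewrite ge0_integral_lebS_swap //.
rewrite integral0_eq // => y _.
transitivity (\int[mu1]_t
    (\1_[set (c - \sum_j y ord0 j * w (lift ord0 j)) / w ord0] t)%:E)%E.
  apply: eq_integral => t _; congr (_%:E); rewrite !indicE; congr (nat_of_bool _)%:R.
  apply/idP/idP => /set_mem h; apply/mem_set.
    by move/sumE: h => <- /=; rewrite addrK mulfK.
  by apply/sumE; rewrite h divfK // subrK.
by rewrite integral_indic // setIT; exact: lebesgue_measure_set1.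
Qed.

End row_bounded.

Section change_of_measure.
Context d1 d2 (X : measurableType d1) (Y : measurableType d2) (R : realType).
Variables (mu : {measure set X -> \bar R}) (nu : {measure set Y -> \bar R}).
Variables (phi : X -> Y) (c : R).
Hypotheses (mphi : measurable_fun setT phi) (c0 : 0 < c).
Hypothesis muphi : forall f : Y -> \bar R, measurable_fun setT f ->
  (forall y, (0 <= f y)%E) -> (c%:E * \int[mu]_x f (phi x) = \int[nu]_y f y)%E.

Lemma integrable_change f : nu.-integrable setT f ->
  mu.-integrable setT (f \o phi).
Proof.
move=> /integrableP[mf foo]; apply/integrableP; split.
  exact: measurableT_comp.
move: foo; rewrite -(@muphi (fun y => `|f y|%E)) //; last exact: measurableT_comp.
rewrite /comp; case: (\int[mu]_x `|f (phi x)|)%E => [r _| |] //; first exact: ltry.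
by rewrite mulry gtr0_sg // mul1e.
Qed.

Lemma integral_change f : nu.-integrable setT f ->
  (c%:E * \int[mu]_x f (phi x) = \int[nu]_y f y)%E.
Proof.
move=> fi; have [mf foo] := integrableP _ _ _ fi.
have := integrable_change fi => fpi.
rewrite integralE [RHS]integralE (funepos_comp f phi) (funeneg_comp f phi).
have hp := @muphi (f^\+)%E (measurable_funepos mf) (fun y => funepos_ge0 _ _).
have hn := @muphi (f^\-)%E (measurable_funeneg mf) (fun y => funeneg_ge0 _ _).
rewrite -hp -hn muleBr //; apply: fin_num_adde_defl; rewrite fin_numN.
have := integrable_fin_num measurableT (integrable_funeneg measurableT fpi).
by rewrite (funeneg_comp f phi).
Qed.

End change_of_measure.


Section row_changes.
Context {R : realType}.
Local Notation mu1 := (@lebesgue_measure R).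

Lemma ge0_integral_leb_affine n (A : 'M[R]_n) (b : 'rV[R]_n)
    (f : 'rV[R]_n -> \bar R) : A \in unitmx ->
  measurable_fun setT f -> (forall x, (0 <= f x)%E) ->
  (`|\det A|%:E * \int[leb n]_x f (x *m A + b)%R = \int[leb n]_x f x)%E.
Proof.
move=> uA mf f0; rewrite -(ge0_integral_leb_shift b mf f0).
apply: (@linear_change_unitmx R n A uA (fun x => f (x + b))) => [|x]; last exact: f0.
by apply: measurableT_comp => //; exact: measurable_shift.
Qed.

Lemma det_unit_gt0 n (A : 'M[R]_n) : A \in unitmx -> 0 < `|\det A|.
Proof. by rewrite unitmxE unitfE normr_gt0. Qed.

Lemma integrable_leb_affine n (A : 'M[R]_n) (b : 'rV[R]_n)
    (f : 'rV[R]_n -> \bar R) : A \in unitmx ->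
  (leb n).-integrable setT f ->
  (leb n).-integrable setT (fun x => f (x *m A + b)).
Proof.
move=> uA; apply: (@integrable_change _ _ _ _ _ (leb n) (leb n) _ _
  (measurable_affine A b) (det_unit_gt0 uA)).
by move=> g; exact: ge0_integral_leb_affine.
Qed.

Lemma Rintegral_leb_affine n (A : 'M[R]_n) (b : 'rV[R]_n) (f : 'rV[R]_n -> R) :
  A \in unitmx -> (leb n).-integrable setT (EFin \o f) ->
  `|\det A| * \int[leb n]_x f (x *m A + b) = \int[leb n]_x f x.
Proof.
move=> uA fi; have fi' := integrable_leb_affine b uA fi.
rewrite /Rintegral -(@integral_change _ _ _ _ _ (leb n) (leb n) _ _
  (measurable_affine A b) (det_unit_gt0 uA)
  (fun g mg g0 => ge0_integral_leb_affine b uA mg g0) _ fi).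
rewrite fineM //; exact: integrable_fin_num fi'.
Qed.

(** The point with coordinate [t] in direction [i], the other coordinates being
    those of [y]. *)
Definition line n (i : 'I_n.+1) (t : R) (y : 'rV[R]_n) : 'rV[R]_n.+1 :=
  \row_k (if unlift i k is Some j then y ord0 j else t).

Lemma line_row_cons n (i : 'I_n.+1) t (y : 'rV[R]_n) :
  line i t y = row_cons (t, y) *m perm_mx (lift_perm i ord0 1)^-1.
Proof.
rewrite -col_permE; apply/rowP => k; rewrite !mxE.
case: (unliftP i k) => [j ->|->]; first by rewrite lift_perm_lift liftK perm1.
by rewrite lift_perm_id unlift_none.
Qed.

Lemma measurable_line n (i : 'I_n.+1) :
  measurable_fun setT (fun z : measurableTypeR R * 'rV[R]_n => line i z.1 z.2).
Proof.
apply: (eq_measurable_fun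
  (fun z => row_cons z *m perm_mx (lift_perm i ord0 1)^-1)).
  by move=> [t y] _; rewrite line_row_cons.
exact: (measurableT_comp
  (@measurable_linear R _ _ (perm_mx (lift_perm i ord0 1)^-1))
  (@measurable_row_cons R n)).
Qed.

Lemma ge0_integral_line n (i : 'I_n.+1) (f : 'rV[R]_n.+1 -> \bar R) :
  measurable_fun setT f -> (forall x, (0 <= f x)%E) ->
  (\int[mu1 \x leb n]_z f (line i z.1 z.2) = \int[leb n.+1]_x f x)%E.
Proof.
move=> mf f0.
have uP := unitmx_perm R (lift_perm i ord0 1)^-1.
rewrite -(@linear_change_unitmx R _ _ uP f mf f0).
rewrite det_perm normrX normrN1 expr1n mul1e.
rewrite [RHS](_ : _ = \int[pushforward (mu1 \x leb n)%E (@row_cons R n)]_x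
    f (x *m perm_mx (lift_perm i ord0 1)^-1))%E //.
rewrite ge0_integral_pushforward //.
- by apply: eq_integral => -[t y] _; rewrite line_row_cons.
- exact: measurable_row_cons.
- by apply: measurableT_comp => //; exact: measurable_linear.
Qed.

Lemma integrable_line n (i : 'I_n.+1) (f : 'rV[R]_n.+1 -> \bar R) :
  (leb n.+1).-integrable setT f ->
  (mu1 \x leb n)%E.-integrable setT
    (fun z : measurableTypeR R * 'rV[R]_n => f (line i z.1 z.2)).
Proof.
apply: (@integrable_change _ _ _ _ _ (mu1 \x leb n)%E (leb n.+1)
  (fun z => line i z.1 z.2) 1 (measurable_line i) ltr01).
by move=> g mg g0; rewrite mul1e ge0_integral_line.
Qed.

(** Fubini along the lines parallel to a coordinate axis. *)
Lemma integral_lines n (i : 'I_n.+1) (f : 'rV[R]_n.+1 -> \bar R) :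
  (leb n.+1).-integrable setT f ->
  (\int[leb n.+1]_x f x = \int[leb n]_y \int[mu1]_t f (line i t y))%E.
Proof.
move=> fi.
rewrite -(@integral_change _ _ _ _ _ (mu1 \x leb n)%E (leb n.+1)
  (fun z => line i z.1 z.2) 1 (measurable_line i) ltr01 _ _ fi); last first.
  by move=> g mg g0; rewrite mul1e ge0_integral_line.
by rewrite mul1e -(integral21_prod_meas1 (integrable_line i fi)).
Qed.

Lemma measurable_lines n (i : 'I_n.+1) (f : 'rV[R]_n.+1 -> \bar R) :
  (leb n.+1).-integrable setT f ->
  measurable_fun setT (fun y => \int[mu1]_t f (line i t y))%E.
Proof. by move=> fi; exact: measurable_fubini_G (integrable_line i fi). Qed.

End row_changes.

Section cauchy_schwarz.
Context {R : realType}.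

Lemma sum_CS (J : finType) (a b : J -> R) :
  (\sum_j a j * b j) ^+ 2 <= (\sum_j a j ^+ 2) * (\sum_j b j ^+ 2).
Proof.
have h : 0 <= \sum_i \sum_j (a i * b j - a j * b i) ^+ 2.
  by apply: sumr_ge0 => i _; apply: sumr_ge0 => j _; exact: sqr_ge0.
suff e : \sum_i \sum_j (a i * b j - a j * b i) ^+ 2 =
    2 * ((\sum_j a j ^+ 2) * (\sum_j b j ^+ 2) - (\sum_j a j * b j) ^+ 2).
  by move: h; rewrite e pmulr_rge0 // subr_ge0.
transitivity (\sum_i \sum_j (a i ^+ 2 * b j ^+ 2 + a j ^+ 2 * b i ^+ 2
     - 2 * ((a i * b i) * (a j * b j)))).
  by apply: eq_bigr => i _; apply: eq_bigr => j _; ring.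
under eq_bigr => i _ do rewrite !big_split /= -mulr_sumr -mulr_suml sumrN -mulr_sumr -mulr_sumr.
rewrite !big_split /= -mulr_suml -mulr_sumr sumrN -mulr_sumr -mulr_suml.
by rewrite expr2; ring.
Qed.

Lemma sqr_sum_le N (a : nat -> R) :
  (\sum_(j < N) a j) ^+ 2 <= N%:R * \sum_(j < N) a j ^+ 2.
Proof.
have := @sum_CS 'I_N (fun=> 1) (fun j => a j).
under eq_bigr do rewrite mul1r.
by under [X in X * _]eq_bigr do rewrite expr1n; rewrite sumr_const card_ord.
Qed.

Lemma mxdotE p q (A B : 'M[R]_(p, q)) :
  mxdot A B = \sum_(z : 'I_p * 'I_q) A z.1 z.2 * B z.1 z.2.
Proof. by rewrite /mxdot pair_big. Qed.

Lemma mxdot_ge0 p q (A : 'M[R]_(p, q)) : 0 <= mxdot A A.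
Proof. by rewrite mxdotE; apply: sumr_ge0 => z _; rewrite -expr2 sqr_ge0. Qed.

Lemma mxdot_CS p q (A B : 'M[R]_(p, q)) :
  mxdot A B ^+ 2 <= mxdot A A * mxdot B B.
Proof.
rewrite !mxdotE; have := sum_CS (fun z : 'I_p * 'I_q => A z.1 z.2) (fun z => B z.1 z.2).
by under [X in _ <= X * _ -> _]eq_bigr do rewrite expr2;
   under [X in _ <= _ * X -> _]eq_bigr do rewrite expr2.
Qed.

Lemma mxdotC p q (A B : 'M[R]_(p, q)) : mxdot A B = mxdot B A.
Proof. by rewrite !mxdotE; apply: eq_bigr => z _; rewrite mulrC. Qed.

Lemma mxdotDl p q (A B C : 'M[R]_(p, q)) :
  mxdot (A + B) C = mxdot A C + mxdot B C.
Proof.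
by rewrite !mxdotE -big_split; apply: eq_bigr => z _; rewrite mxE mulrDl.
Qed.

Lemma mxdotZl p q (c : R) (A B : 'M[R]_(p, q)) : mxdot (c *: A) B = c * mxdot A B.
Proof.
by rewrite !mxdotE mulr_sumr; apply: eq_bigr => z _; rewrite mxE mulrA.
Qed.

Lemma mxdotDr p q (A B C : 'M[R]_(p, q)) :
  mxdot A (B + C) = mxdot A B + mxdot A C.
Proof. by rewrite mxdotC mxdotDl !(mxdotC A). Qed.

Lemma mxdotZr p q (c : R) (A B : 'M[R]_(p, q)) : mxdot A (c *: B) = c * mxdot A B.
Proof. by rewrite mxdotC mxdotZl mxdotC. Qed.

Lemma mxdotNl p q (A B : 'M[R]_(p, q)) : mxdot (- A) B = - mxdot A B.
Proof. by rewrite -scaleN1r mxdotZl mulN1r. Qed.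

Lemma mxdotNr p q (A B : 'M[R]_(p, q)) : mxdot A (- B) = - mxdot A B.
Proof. by rewrite mxdotC mxdotNl mxdotC. Qed.

Lemma mxdot_row n (x y : 'rV[R]_n) : mxdot x y = \sum_j x ord0 j * y ord0 j.
Proof. by rewrite /mxdot big_ord1. Qed.

Lemma mxdot_mul n (x y : 'rV[R]_n) : x *m y^T = (mxdot x y)%:M.
Proof.
apply/rowP => i; rewrite ord1 !mxE mulr1n mxdot_row.
by apply: eq_bigr => j _; rewrite mxE.
Qed.

Lemma enorm_sqr n (x : 'rV[R]_n) : enorm x ^+ 2 = mxdot x x.
Proof. by rewrite /enorm sqr_sqrtr ?mxdot_ge0. Qed.

Lemma enorm_ge0 n (x : 'rV[R]_n) : 0 <= enorm x.
Proof. exact: sqrtr_ge0. Qed.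

Lemma coor_le_enorm n (x : 'rV[R]_n) i : `|x ord0 i| <= enorm x.
Proof.
rewrite -(@ler_pXn2r _ 2) ?nnegrE ?enorm_ge0 // enorm_sqr real_normK ?num_real //.
rewrite mxdot_row (bigD1 i) //= -expr2 lerDl; apply: sumr_ge0 => j _.
by rewrite -expr2 sqr_ge0.
Qed.

End cauchy_schwarz.

Section polynomials.
Context {R : realType} {n : nat}.
Local Notation E := 'rV[R]_n.+1.
Local Notation mp := (mpoly n.+1 R).
Implicit Types p q : mp.

Definition coorX (i : 'I_n.+1) : mp := mpolyX R (mnm1 i).

Lemma mpoly_gen_ind (P : mp -> Prop) :
  (forall c, P (mpolyC n.+1 c)) -> (forall i, P (coorX i)) ->
  (forall p q, P p -> P q -> P (p + q)) ->
  (forall p q, P p -> P q -> P (p * q)) -> forall p, P p.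
Proof.
move=> hC hX hD hM p; rewrite [p]mpolyE.
have h0 : P 0 by rewrite -mpolyC0.
have h1 : P 1 by rewrite -mpolyC1.
have hXn i k : P (coorX i ^+ k).
  elim: k => [|k IH]; first by rewrite expr0.
  by rewrite exprS; apply: hM => //; exact: hX.
apply: (big_ind P) => // m _; rewrite -mul_mpolyC; apply: (hM) => //.
rewrite mpolyXE_id; apply: (big_ind P) => // i _; exact: hXn.
Qed.

Lemma pevalC c (x : E) : peval (mpolyC n.+1 c) x = c.
Proof. exact: mevalC. Qed.
Lemma pevalX i (x : E) : peval (coorX i) x = x ord0 i.
Proof. exact: mevalXU. Qed.
Lemma pevalD p q (x : E) : peval (p + q) x = peval p x + peval q x.
Proof. exact: mevalD. Qed.
Lemma pevalB p q (x : E) : peval (p - q) x = peval p x - peval q x.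
Proof. exact: mevalB. Qed.
Lemma pevalM p q (x : E) : peval (p * q) x = peval p x * peval q x.
Proof. exact: mevalM. Qed.
Lemma pevalZ c p (x : E) : peval (c *: p) x = c * peval p x.
Proof. exact: mevalZ. Qed.
Lemma peval_sum (J : finType) (F : J -> mp) (x : E) :
  peval (\sum_j F j) x = \sum_j peval (F j) x.
Proof. exact: raddf_sum. Qed.

Lemma mderivXE i k : mderiv i (coorX k) = mpolyC n.+1 ((i == k)%:R).
Proof.
rewrite /coorX mderivX mnm1E eq_sym; have [->|ik] := eqVneq.
  by rewrite -[X in mnm_sub X _]add0m addmK mpolyX0 scale1r mpolyC1.
by rewrite scale0r mpolyC0.
Qed.

Lemma continuous_peval p : continuous (peval p : E -> R).
Proof.
elim/mpoly_gen_ind: p => [c|i|p q cp cq|p q cp cq].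
- rewrite (_ : peval _ = fun=> c); first exact: contC.
  by apply/funext => x; exact: pevalC.
- rewrite (_ : peval _ = fun x : E => x ord0 i); first exact: continuous_coor.
  by apply/funext => x; exact: pevalX.
- rewrite (_ : peval _ = fun x : E => peval p x + peval q x); first exact: contD.
  by apply/funext => x; exact: pevalD.
- rewrite (_ : peval _ = fun x : E => peval p x * peval q x); first exact: contM.
  by apply/funext => x; exact: pevalM.
Qed.

Lemma peval_line p i (y : 'rV[R]_n) : exists q : {poly R},
  (forall t, q.[t] = peval p (line i t y)) /\
  (forall t, q^`().[t] = peval (mderiv i p) (line i t y)).
Proof.
elim/mpoly_gen_ind: p => [c|k|p q [P [hP dP]] [Q [hQ dQ]]|p q [P [hP dP]] [Q [hQ dQ]]].
- exists c%:P; split=> t; first by rewrite hornerC pevalC.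
  by rewrite derivC horner0 mderivC -mpolyC0 pevalC.
- case: (unliftP i k) => [j ->|->].
    exists (y ord0 j)%:P; split=> t; first by rewrite hornerC pevalX mxE liftK.
    by rewrite derivC horner0 mderivXE (negPf (neq_lift _ _)) pevalC.
  exists 'X; split=> t; first by rewrite hornerX pevalX mxE unlift_none.
  by rewrite derivX hornerC mderivXE eqxx pevalC.
- exists (P + Q); split=> t; first by rewrite hornerD hP hQ pevalD.
  by rewrite derivD hornerD dP dQ mderivD pevalD.
- exists (P * Q); split=> t; first by rewrite hornerM hP hQ pevalM.
  by rewrite derivM hornerD !hornerM dP dQ hP hQ mderivM pevalD !pevalM.
Qed.

Lemma size_prod_le (J : Type) (r : seq J) (F : J -> {poly R}) (d : J -> nat) :
  (forall j, (size (F j) <= (d j).+1)%N) ->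
  (size (\prod_(j <- r) F j)%R <= (\sum_(j <- r) d j).+1)%N.
Proof.
move=> hF; elim: r => [|j r IH]; first by rewrite !big_nil size_poly1.
rewrite !big_cons (leq_trans (size_polyMleq _ _)) //.
have h := leq_add (hF j) IH; rewrite addSn addnS in h.
by rewrite -subn1 leq_subLR add1n.
Qed.

Lemma peval_segment l p (a b : E) : (msize p <= l.+1)%N ->
  exists2 q : {poly R}, (size q <= l.+1)%N &
    forall s, q.[s] = peval p (a + s *: b).
Proof.
move=> pl.
pose q : {poly R} := \sum_(m <- msupp p) mcoeff m p *:
  \prod_i ((a ord0 i)%:P + b ord0 i *: 'X) ^+ m i.
exists q; last first.
  move=> s; rewrite horner_sum /peval mevalE; apply: eq_bigr => m _.
  rewrite hornerZ horner_prod; congr (_ * _); apply: eq_bigr => i _.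
  by rewrite horner_exp hornerD hornerC hornerZ hornerX !mxE mulrC.
rewrite /q big_seq; apply: (big_ind (fun q : {poly R} => (size q <= l.+1)%N)).
- by rewrite size_poly0.
- by move=> u v hu hv; rewrite (leq_trans (size_polyD _ _)) // geq_max hu.
- move=> m mp; rewrite (leq_trans (size_scale_leq _ _)) //.
  apply: (@leq_trans (mdeg m).+1); last first.
    by rewrite (leq_trans _ pl) // msize_mdeg_lt.
  rewrite mdegE; apply: size_prod_le => i.
  rewrite (leq_trans (size_poly_exp_leq _ _)) // ltnS.
  have hL : (size ((a ord0 i)%:P + b ord0 i *: 'X)%R <= 2)%N.
    rewrite (leq_trans (size_polyD _ _)) // geq_max.
    rewrite (leq_trans (size_polyC_leq1 _)) // (leq_trans (size_scale_leq _ _)) //.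
    by rewrite size_polyX.
  rewrite -[leqRHS]mul1n leq_mul2r; apply/orP; right.
  by rewrite -subn1 leq_subLR.
Qed.

Lemma msize_mderiv l p i : (msize p <= l)%N -> (msize (mderiv i p) <= l)%N.
Proof.
move=> pl; rewrite (leq_trans _ pl) // [leqLHS]msizeE.
apply/bigmax_leqP_seq => m + _; rewrite mcoeff_msupp mcoeff_deriv => h.
have : mnm_add m (mnm1 i) \in msupp p.
  by rewrite mcoeff_msupp; apply: contraNneq h => ->; rewrite mul0rn.
move=> /msize_mdeg_lt; apply: leq_trans; rewrite ltnS mdegD; exact: leq_addr.
Qed.

Lemma msize_lincomb l (J : finType) (c : J -> R) (F : J -> mp) :
  (forall j, (msize (F j) <= l)%N) -> (msize (\sum_j c j *: F j)%R <= l)%N.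
Proof.
move=> hF; rewrite (leq_trans (msize_sum _ _ _)) //; apply/bigmax_leqP => j _.
by rewrite (leq_trans (msizeZ_le _ _)).
Qed.

End polynomials.

Section extrapolation.
Context {R : realType}.
Local Notation mu1 := (@lebesgue_measure R).

(** Vanishing of the higher finite differences of a polynomial of low degree:
    its value at 0 is a combination, with universal weights, of its values at
    equally spaced points, whatever the step. *)
Lemma poly_extrapolation N : exists c : nat -> R,
  forall (q : {poly R}) (h : R), (size q <= N)%N ->
    q.[0] = \sum_(j < N) c j * q.[h *+ j.+1].
Proof.
elim: N => [|N [c hc]].
  exists (fun=> 0) => q h; rewrite leqn0 size_poly_eq0 => /eqP ->.
  by rewrite horner0 big_ord0.
exists (fun j => (j == 0%N)%:R + (if (j < N)%N then c j else 0)
   - (if j is k.+1 then c k else 0)) => q h hq.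
pose r := q \Po ('X + h%:P) - q.
have sXh : size ('X + h%:P) = 2%N by rewrite size_XaddC.
have hr : (size r <= N)%N.
  have sr : (size r <= N.+1)%N.
    rewrite (leq_trans (size_polyD _ _)) // geq_max size_polyN hq andbT.
    by rewrite size_comp_poly2.
  apply/leq_sizeP => j Nj.
  have [jN|jN] := ltnP N j; first by move/leq_sizeP: sr; apply.
  have {jN Nj} -> : j = N by apply/eqP; rewrite eqn_leq jN.
  rewrite coefB; have [sq|sq] := leqP (size q) N.
    by rewrite !nth_default ?subr0 // size_comp_poly2.
  have {}sq : size q = N.+1 by apply/eqP; rewrite eqn_leq hq.
  have := lead_coef_comp q (q := 'X + h%:P); rewrite sXh => /(_ isT).
  rewrite lead_coefXaddC expr1n mulr1 /lead_coef size_comp_poly2 // sq /= => ->.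
  by rewrite subrr.
have := hc r h hr.
have rE x : r.[x] = q.[x + h] - q.[x].
  by rewrite /r hornerD hornerN horner_comp hornerD hornerX hornerC.
rewrite rE add0r => e.
have {e} -> : q.[0] = q.[h] - \sum_(j < N) c j * r.[h *+ j.+1] by rewrite -e; ring.
rewrite (eq_bigr (fun j : 'I_N.+1 => (nat_of_ord j == 0%N)%:R * q.[h *+ j.+1]
  + ((if (j < N)%N then c j else 0) * q.[h *+ j.+1]
   - (if nat_of_ord j is k.+1 then c k else 0) * q.[h *+ j.+1]))); last first.
  by move=> j _; rewrite mulrBl mulrDl addrA.
rewrite !big_split /= big_ord_recl mul1r [X in _ = _ + X + _]big1 ?addr0 => [|j _]; last first.
  by rewrite lift0 mul0r.
congr (_ + _); rewrite [X in _ = X + _]big_ord_recr /= ltnn mul0r addr0 sumrN.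
rewrite [X in _ = _ - X]big_ord_recl mul0r add0r -sumrB -sumrN.
apply: eq_bigr => j _; rewrite ltn_ord rE lift0 [h *+ j.+2]mulrSr; ring.
Qed.

Lemma poly_sqr_extrapolation N : exists2 K : R, 0 < K &
  forall q : {poly R}, (size q <= N)%N ->
  ((q.[0] ^+ 2)%:E <= K%:E * \int[mu1]_(s in `[0%R, 2^-1%R]) (q.[s] ^+ 2)%:E)%E.
Proof.
have [c hc] := poly_extrapolation N.
pose S := \sum_(j < N) c j ^+ 2.
pose d : R := (2 * N.+1%:R)^-1.
have d0 : 0 < d by rewrite invr_gt0 mulr_gt0.
have S0 : 0 <= S by apply: sumr_ge0 => j _; exact: sqr_ge0.
exists (d^-1 * (S * N%:R + 1)).
  by rewrite mulr_gt0 ?invr_gt0 // ltr_wpDl // mulr_ge0.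
move=> q hq; set I := (\int[mu1]_(s in _) _)%E.
pose g (s : measurableTypeR R) := (q.[s] ^+ 2)%:E : \bar R.
have mg : measurable_fun setT g.
  apply/measurable_EFinP/measurable_funX; apply: continuous_measurable_fun.
  exact: continuous_horner.
have mI : measurable (`[0, 2^-1]%classic : set (measurableTypeR R)).
  exact: measurable_itv.
have mJ : measurable (`[0, d]%classic : set (measurableTypeR R)).
  exact: measurable_itv.
pose G : measurableTypeR R -> \bar R := (g \_ `[0%R, 2^-1%R]%classic).
have mG : measurable_fun setT G.
  by apply/measurable_restrict => //; apply: measurable_funTS.
have G0 s : (0 <= G s)%E.
  by rewrite /G patchE; case: ifP => // _; rewrite lee_fin sqr_ge0.
have IE : I = (\int[mu1]_s G s)%E by rewrite /I integral_mkcond.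
have mGj (j : nat) : measurable_fun setT (fun h : measurableTypeR R => G (j.+1%:R * h + 0)%R).
  apply: (measurableT_comp mG); apply: continuous_measurable_fun => x.
  by apply: cvgD; [apply: cvgM => //; exact: cvg_cst|exact: cvg_cst].
have IG (j : nat) : (\int[mu1]_h G (j.+1%:R * h + 0)%R <= I)%E.
  rewrite IE -(@ge0_integral_lebesgue_affine R j.+1%:R 0 G) ?pnatr_eq0 //.
  rewrite -[leLHS]mul1e lee_wpmul2r ?integral_ge0 // lee_fin.
  by rewrite ger0_norm // ler1n.
have h1 (h : R) : h \in `[0, d]%R ->
    ((q.[0] ^+ 2)%:E <= S%:E * \sum_(j < N) G (j.+1%:R * h + 0)%R)%E.
  move=> hd.
  rewrite (eq_bigr (fun j : 'I_N => ((q.[h *+ j.+1]) ^+ 2)%:E)); last first.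
    move=> j _; rewrite /G patchE addr0 mulr_natl mem_set //=.
    move: hd; rewrite !in_itv /= => /andP[h0 hd]; rewrite mulrn_wge0 //=.
    apply: (@le_trans _ _ (d *+ N)).
      by apply: (@le_trans _ _ (d *+ j.+1)); rewrite ?lerMn2r ?hd ?orbT // ler_wpMn2l // ltW.
    rewrite -[d *+ N]mulr_natr /d ler_pdivrMl ?mulr_gt0 // mulrAC mulfV ?pnatr_eq0 //.
    by rewrite mul1r ler_nat.
  rewrite sumEFin -EFinM lee_fin (hc q h hq).
  exact: (sum_CS (fun j : 'I_N => c j) (fun j => q.[h *+ j.+1])).
have h2 : ((q.[0] ^+ 2)%:E * d%:E <= (S * N%:R)%:E * I)%E.
  have -> : ((q.[0] ^+ 2)%:E * d%:E = \int[mu1]_(h in `[0%R, d]) (q.[0] ^+ 2)%:E)%E.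
    rewrite integral_cst //; congr (_ * _)%E; apply/esym.
    have -> : d%:E = mu1 `[0%R, d]%classic; last by [].
    by rewrite lebesgue_measure_itv /= lte_fin d0 oppr0 adde0.
  apply: (@le_trans _ _ (\int[mu1]_(h in `[0%R, d])
      (S%:E * \sum_(j < N) G (j.+1%:R * h + 0)%R))%E).
    apply: ge0_le_integral => //.
    - by move=> h _; rewrite lee_fin sqr_ge0.
    - apply: measurable_funTS; apply: measurable_funeM.
      by apply: emeasurable_sum => j; exact: mGj.
  apply: (@le_trans _ _ (\int[mu1]_h (S%:E * \sum_(j < N) G (j.+1%:R * h + 0)%R))%E).
    apply: ge0_subset_integral => //.
    - by apply: measurable_funeM; apply: emeasurable_sum => j; exact: mGj.
    - by move=> h _; rewrite mule_ge0 ?lee_fin // sume_ge0.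
  rewrite ge0_integralZl //; first last.
  - by move=> h _; rewrite sume_ge0.
  - by apply: emeasurable_sum => j; exact: mGj.
  rewrite ge0_integral_sum //.
  rewrite EFinM -muleA lee_wpmul2l ?lee_fin //.
  apply: (@le_trans _ _ (\sum_(j < N) I)%E); first by apply: lee_sum => j _.
  by rewrite sumr_const card_ord mule_natl.
have -> : (q.[0] ^+ 2)%:E = (d^-1%:E * ((q.[0] ^+ 2)%:E * d%:E))%E.
  by rewrite -!EFinM mulrCA mulVf ?mulr1 // gt_eqF.
rewrite [(d^-1 * (S * N%:R + 1))%:E]EFinM -muleA lee_wpmul2l ?lee_fin ?invr_ge0 ?(ltW d0) //.
rewrite (le_trans h2) // lee_wpmul2r ?lee_fin ?lerDl //.
by rewrite IE integral_ge0.
Qed.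

End extrapolation.

Section row_maps.
Context {R : realType}.

Lemma cont_row (T : topologicalType) n (f : T -> 'rV[R]_n) :
  (forall i, continuous (fun x => f x ord0 i)) -> continuous f.
Proof.
move=> cf x; apply/cvgrPdist_lt => e e0.
have : \forall y \near x, forall i, `|f x ord0 i - f y ord0 i| < e.
  apply: filter_forall => i.
  by have /cvgrPdist_lt := cf i x; apply.
apply: filterS => y hy; have : ball (f x) e (f y) by apply/row_ballP.
by rewrite -ball_normE.
Qed.

Lemma cont_affine m n (A : 'M[R]_(m, n)) (b : 'rV[R]_n) :
  continuous (fun x : 'rV[R]_m => x *m A + b).
Proof.
apply: cont_row => i.
rewrite (_ : (fun _ => _) =
   fun x : 'rV[R]_m => \sum_j x ord0 j * A j i + b ord0 i); last first.
  by apply/funext => x; rewrite !mxE.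
apply: contD; last exact: contC.
by apply: cont_sum => j; apply: contM; [exact: continuous_coor|exact: contC].
Qed.

Lemma measurable_le_cont n (f g : 'rV[R]_n -> R) : continuous f -> continuous g ->
  measurable [set x | f x <= g x].
Proof.
move=> cf cg; have cfg := contB cf cg.
have := continuous_measurable_row cfg measurableT (measurable_itv `]-oo, 0]).
by rewrite setTI; congr (measurable _); apply/seteqP; split=> x /=;
  rewrite in_itv /= subr_le0.
Qed.

Lemma closed_le_cont (T : topologicalType) (f g : T -> R) :
  continuous f -> continuous g -> closed [set x | f x <= g x].
Proof.
move=> cf cg; have cfg := contB cf cg.
rewrite (_ : [set x | f x <= g x] = (fun x => f x - g x) @^-1` [set y | y <= 0]).
  by apply: (closed_comp _ (@closed_le R 0)) => x _; exact: cfg.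
by apply/seteqP; split=> x /=; rewrite subr_le0.
Qed.

Lemma refsimplexE n : @refsimplex R n = (\bigcap_(i in [set: 'I_n])
  [set t : 'rV[R]_n | 0 <= t ord0 i]) `&` [set t | \sum_i t ord0 i <= 1].
Proof.
by apply/seteqP; split=> t [h1 h2]; split => // i; [move=> _|]; exact: h1.
Qed.

Lemma measurable_refsimplex n : measurable (@refsimplex R n).
Proof.
rewrite refsimplexE; apply: measurableI.
  apply: fin_bigcap_measurable => [|i _]; first exact: finite_finset.
  by apply: measurable_le_cont; [exact: contC|exact: continuous_coor].
apply: measurable_le_cont; last exact: contC.
by apply: cont_sum => j; exact: continuous_coor.
Qed.

Lemma boxed_refsimplex n : boxed (@refsimplex R n).
Proof.
exists 2 => t [h1 h2] i; rewrite ger0_norm ?h1 // (@le_lt_trans _ _ 1) ?ltr1n //.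
by apply: le_trans h2; rewrite (bigD1 i) //= lerDl sumr_ge0.
Qed.

End row_maps.

Section simplices.
Context {R : realType}.

Lemma simplex_paramE k q (V : 'M[R]_(k.+1, q)) (t : 'rV[R]_k.+1) :
  \sum_i t ord0 i = 1 ->
  t *m V = simplex_param V (\row_j t ord0 (lift ord0 j)).
Proof.
rewrite big_ord_recl => h; apply/rowP => c; rewrite !mxE big_ord_recl.
have -> : t ord0 ord0 = 1 - \sum_(i < k) t ord0 (lift ord0 i) by rewrite -h addrK.
rewrite mulrBl mul1r -addrA; congr (_ + _).
rewrite mulr_suml addrC -sumrB; apply: eq_bigr => j _.
by rewrite /edges !mxE mulrBr.
Qed.

(** Barycentric coordinates from the coordinates relative to vertex 0. *)
Definition bary k (t : 'rV[R]_k) : 'rV[R]_k.+1 :=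
  \row_i (if unlift ord0 i is Some j then t ord0 j else 1 - \sum_j t ord0 j).

Lemma bary_sum k (t : 'rV[R]_k) : \sum_i bary t ord0 i = 1.
Proof.
rewrite big_ord_recl mxE unlift_none.
rewrite [X in _ + X](eq_bigr (fun i => t ord0 i)) ?subrK // => i _.
by rewrite mxE liftK.
Qed.

Lemma simplex_param_bary k q (V : 'M[R]_(k.+1, q)) (t : 'rV[R]_k) :
  simplex_param V t = bary t *m V.
Proof.
rewrite simplex_paramE ?bary_sum //; congr simplex_param.
by apply/rowP => j; rewrite !mxE liftK.
Qed.

Lemma bary_ge0 k (t : 'rV[R]_k) : refsimplex t -> forall i, 0 <= bary t ord0 i.
Proof.
move=> [h1 h2] i; rewrite mxE; case: (unlift ord0 i) => [j|]; first exact: h1.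
by rewrite subr_ge0.
Qed.

Lemma simplexP k q (V : 'M[R]_(k.+1, q)) x :
  simplex V x <-> exists2 t, refsimplex t & x = simplex_param V t.
Proof.
split=> [[t [t0 t1 ->]]|[t ht ->]]; last first.
  exists (bary t); split; [exact: bary_ge0|exact: bary_sum|].
  exact: simplex_param_bary.
exists (\row_j t ord0 (lift ord0 j)); last exact: simplex_paramE.
split=> [i|]; first by rewrite mxE.
under eq_bigr do rewrite mxE.
by rewrite -t1 [leRHS]big_ord_recl lerDr.
Qed.

Lemma closed_simplex k q (V : 'M[R]_(k.+1, q)) : closed (simplex V).
Proof.
pose K := [set v : 'rV[R]_k | forall i, `[(0:R), 1]%classic (v ord0 i)].
have cK : compact K.
  by apply: (@rV_compact _ _ (fun=> `[(0:R), 1]%classic)) => i; exact: segment_compact.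
have cref : compact (@refsimplex R k).
  apply: (subclosed_compact _ cK).
    rewrite refsimplexE; apply: closedI.
      apply: closed_bigI => i _; apply: closed_le_cont; first exact: contC.
      exact: continuous_coor.
    apply: closed_le_cont; last exact: contC.
    by apply: cont_sum => j; exact: continuous_coor.
  move=> t [h1 h2] i; rewrite /= in_itv /= h1 /=.
  by apply: le_trans h2; rewrite (bigD1 i) //= lerDl sumr_ge0.
have -> : simplex V = simplex_param V @` @refsimplex R k.
  apply/seteqP; split=> x; first by move/simplexP => [t ht ->]; exists t.
  by move=> [t ht <-]; apply/simplexP; exists t.
apply: compact_closed; first exact: norm_hausdorff.
apply: continuous_compact => //; apply: continuous_subspaceT.
rewrite (_ : simplex_param V = fun t => t *m edges V + row ord0 V); last first.
  by apply/funext => t; rewrite /simplex_param addrC.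
exact: cont_affine.
Qed.

Lemma gram_square n (V : 'M[R]_(n.+1, n)) : gram V = `|\det (edges V)|.
Proof. by rewrite /gram det_mulmx det_tr -expr2 sqrtr_sqr. Qed.

End simplices.

Section simplex_trace.
Context {R : realType}.
Local Notation mu1 := (@lebesgue_measure R).
Variables (n : nat) (V : 'M[R]_(n.+2, n.+1)).
Let W : 'M[R]_(n.+1, n.+1) := row' ord0 V.
Let A := row ord0 V.
Let w0 := row ord0 W.

(** Edges issued from the first vertex of the base: towards the apex, then along
    the base. *)
Let cedges : 'M[R]_(1 + n, n.+1) := col_mx (A - w0) (edges W).

Let cedgesE : cedges = block_mx ((-1)%:M : 'M[R]_1) 0 (const_mx (-1)) 1%:M *m edges V.
Proof.
have -> : edges V = col_mx (row ord0 (edges V))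
    (row' ord0 (edges V)) :> 'M[R]_(1 + n, n.+1).
  apply/matrixP => i j; case: (unliftP ord0 i) => [k ->|->].
    have -> : lift ord0 k = rshift 1 k :> 'I_(1 + n) by apply: val_inj.
    by rewrite col_mxEd !mxE; congr (V _ _ - _); apply: val_inj.
  have -> : ord0 = lshift n ord0 :> 'I_(1 + n) by apply: val_inj.
  by rewrite col_mxEu !mxE; congr (V _ _ - _); apply: val_inj.
rewrite mul_block_col mul0mx addr0 mul1mx; congr col_mx.
  rewrite mul_scalar_mx scaleN1r; apply/rowP => j.
  by rewrite !mxE opprB.
apply/matrixP => i j; rewrite !mxE big_ord1 !mxE mulN1r addrC opprB addrA.
by rewrite addrNK.
Qed.

Let det_cedges : `|\det cedges| = gram V.
Proof.
by rewrite gram_square cedgesE det_mulmx det_lblock det_scalar1 det1 mulr1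
  normrM normrN1 mul1r.
Qed.

Let cone (z : 'rV[R]_n.+1) : 'rV[R]_n.+1 := z *m (cedges : 'M[R]_n.+1) + w0.

Let coneE s (t : 'rV[R]_n) : cone (row_cons (s, (1 - s) *: t)) =
  simplex_param W t + s *: (A - simplex_param W t).
Proof.
rewrite /cone /cedges row_consE (mul_row_col (s%:M : 'M[R]_1) ((1 - s) *: t)
  (A - w0) (edges W)) mul_scalar_mx -scalemxAl.
rewrite /simplex_param -/w0; set u := t *m edges W.
by apply/rowP => j; rewrite !mxE; ring.
Qed.

Let cone_simplex s (t : 'rV[R]_n) : 0 <= s <= 1 -> refsimplex t ->
  simplex V (cone (row_cons (s, (1 - s) *: t))).
Proof.
move=> /andP[s0 s1] ht; rewrite coneE.
pose b := bary t.
exists (row_cons (s, (1 - s) *: b)); split.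
- move=> i; rewrite mxE; case: (unlift ord0 i) => [j|] //=.
  by rewrite mxE mulr_ge0 ?subr_ge0 ?bary_ge0.
- rewrite big_ord_recl mxE unlift_none (eq_bigr (fun j => (1 - s) * b ord0 j)).
    by rewrite -mulr_sumr bary_sum mulr1 /= subrKC.
  by move=> j _; rewrite mxE liftK /= mxE.
rewrite row_consE; have -> : V = col_mx A W :> 'M[R]_(1 + n.+1, n.+1).
  apply/matrixP => i j; case: (unliftP ord0 i) => [k ->|->].
    have -> : lift ord0 k = rshift 1 k :> 'I_(1 + n.+1) by apply: val_inj.
    rewrite col_mxEd !mxE; congr (V _ _).
    by apply: val_inj.
  have -> : ord0 = lshift n.+1 ord0 :> 'I_(1 + n.+1) by apply: val_inj.
  by rewrite col_mxEu !mxE; congr (V _ _); apply: val_inj.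
rewrite (mul_row_col (s%:M : 'M[R]_1) ((1 - s) *: b) A W) mul_scalar_mx -scalemxAl -simplex_param_bary.
by apply/rowP => j; rewrite !mxE; ring.
Qed.

(** The value of a polynomial at a point of the base is controlled by its values
    on the half, next to the base, of the segment that joins this point to the
    apex; integrating over the base gives the integral over the simplex in
    conical coordinates. *)
Lemma simplex_trace_aux l K : 0 < K ->
  (forall q : {poly R}, (size q <= l.+1)%N ->
  ((q.[0] ^+ 2)%:E <= K%:E * \int[mu1]_(s in `[0%R, 2^-1%R]) (q.[s] ^+ 2)%:E)%E) ->
  gram V != 0 -> forall p : mpoly n.+1 R, (msize p <= l.+1)%N ->
  ((gram V)%:E * \int[leb n]_(t in @refsimplex R n) (peval p (simplex_param W t) ^+ 2)%:E
   <= (K * 2 ^+ n)%:E * \int[leb n.+1]_(x in simplex V) (peval p x ^+ 2)%:E)%E.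
Proof.
move=> K0 hK gV p hp.
have ucE : (cedges : 'M[R]_n.+1) \in unitmx.
  by rewrite unitmxE unitfE -normr_eq0 det_cedges.
pose f (x : 'rV[R]_n.+1) := (peval p x ^+ 2)%:E : \bar R.
have f0 x : (0 <= f x)%E by rewrite lee_fin sqr_ge0.
have mf : measurable_fun setT f.
  apply/measurable_EFinP/measurable_funX.
  exact: (continuous_measurable_row (@continuous_peval R n p)).
have mS : measurable (simplex V) by exact: closed_measurable_row (@closed_simplex R _ _ V).
pose F := f \_ (simplex V).
have F0 x : (0 <= F x)%E by rewrite /F patchE; case: ifP.
have mF : measurable_fun setT F.
  by apply/measurable_restrict => //; apply: measurable_funTS.
rewrite [X in (_ <= _ * X)%E]integral_mkcond -/f -/F.
rewrite -(ge0_integral_leb_affine w0 ucE mF F0) det_cedges.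
rewrite muleCA; apply: lee_wpmul2l; first by rewrite lee_fin sqrtr_ge0.
rewrite ge0_integral_lebS //; last first.
  exact: (measurableT_comp mF (@measurable_affine R _ _ (cedges : 'M[R]_n.+1) w0)).
pose J := `[0%R, 2^-1%R]%classic : set (measurableTypeR R).
have mJ : measurable J by exact: measurable_itv.
pose sc (z : 'rV[R]_n.+1) : 'rV[R]_n.+1 :=
  \row_i (if unlift ord0 i is Some j then (1 - z ord0 ord0) * z ord0 i else z ord0 i).
have scE s t : sc (row_cons (s, t)) = row_cons (s, (1 - s) *: t).
  apply/rowP => i; rewrite mxE [RHS]mxE; case: (unliftP ord0 i) => [j ->|->].
    by rewrite !mxE liftK unlift_none.
  by rewrite mxE unlift_none.
have csc : continuous (fun z => peval p (cone (sc z))).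
  have cs : continuous sc.
    apply: cont_row => i.
    case: (unliftP ord0 i) => [j ->|->].
      rewrite (_ : (fun _ => _) =
        (fun z : 'rV[R]_n.+1 => (1 - z ord0 ord0) * z ord0 (lift ord0 j))).
        apply: contM; [apply: contB; first exact: contC|]; exact: continuous_coor.
      by apply/funext => z; rewrite mxE liftK.
    rewrite (_ : (fun _ => _) = (fun z : 'rV[R]_n.+1 => z ord0 ord0)).
      exact: continuous_coor.
    by apply/funext => z; rewrite mxE unlift_none.
  have cpc : continuous (peval p \o cone).
    move=> z; apply: continuous_comp; first exact: cont_affine.
    exact: continuous_peval.
  by move=> z; exact: (@continuous_comp _ _ _ sc (peval p \o cone) z (cs z) (cpc (sc z))).
pose H (z : measurableTypeR R * 'rV[R]_n) : \bar R :=
  ((\1_J z.1 * \1_(@refsimplex R n) z.2) * (peval p (cone (sc (row_cons z)))) ^+ 2)%:E.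
have H0 z : (0 <= H z)%E by rewrite lee_fin mulr_ge0 ?sqr_ge0.
have mH : measurable_fun setT H.
  apply/measurable_EFinP/measurable_funM.
    apply: measurable_funM.
      exact: (measurableT_comp (measurable_indic mJ) measurable_fst).
    exact: (measurableT_comp (measurable_indic (@measurable_refsimplex R n)) measurable_snd).
  apply/measurable_funX; apply: (measurableT_comp (continuous_measurable_row csc)).
  exact: measurable_row_cons.
have Hin s t : J s -> refsimplex t ->
    H (s, t) = f (simplex_param W t + s *: (A - simplex_param W t)).
  move=> hs ht; rewrite /H /= !indicE !mem_set // !mul1r /f; congr ((peval p _) ^+ 2)%:E.
  by rewrite scE coneE.
apply: (@le_trans _ _ (K%:E * \int[leb n]_t \int[mu1]_s H (s, t))%E).
  rewrite integral_mkcond -ge0_integralZl //; first last.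
  - by rewrite lee_fin ltW.
  - by move=> t _; apply: integral_ge0.
  - exact: (@measurable_fun_fubini_tonelli_G _ _ _ _ _ mu1 H mH H0).
  apply: ge0_le_integral => //.
  - by move=> t _; rewrite patchE; case: ifP => // _; rewrite lee_fin sqr_ge0.
  - apply/(measurable_restrictT _ (@measurable_refsimplex R n)).
    apply/measurable_EFinP/measurable_funTS/measurable_funX.
    apply: (measurableT_comp (continuous_measurable_row (@continuous_peval R n p))).
    apply: (eq_measurable_fun (fun t => t *m edges W + w0)).
      by move=> t _; rewrite /simplex_param addrC.
    exact: measurable_affine.
  - apply: measurable_funeM.
    exact: (@measurable_fun_fubini_tonelli_G _ _ _ _ _ mu1 H mH H0).
  move=> t _; rewrite patchE; case: ifPn => [/set_mem ht|_]; last first.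
    by rewrite mule_ge0 ?integral_ge0 // lee_fin ltW.
  have [q sq hq] := peval_segment (simplex_param W t) (A - simplex_param W t) hp.
  have := hK q sq; rewrite hq scale0r addr0 => /le_trans; apply.
  rewrite lee_wpmul2l ?lee_fin ?(ltW K0) //.
  rewrite [leLHS]integral_mkcond; apply: ge0_le_integral => //.
  - by move=> s _; rewrite patchE; case: ifP => // _; rewrite lee_fin sqr_ge0.
  - apply/(measurable_restrictT _ mJ)/measurable_EFinP/measurable_funTS/measurable_funX.
    apply: continuous_measurable_fun; exact: continuous_horner.
  - exact: (measurableT_comp mH (measurable_pair2 _)).
  move=> s _; rewrite patchE; case: ifPn => [/set_mem hs|_]; last exact: H0.
  by rewrite Hin // hq.
rewrite EFinM -muleA; apply: lee_wpmul2l; first by rewrite lee_fin ltW.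
rewrite -(@fubini_tonelli _ _ _ _ _ mu1 (leb n) H mH H0).
have mG := @measurable_fun_fubini_tonelli_F _ _ _ _ _ (leb n) H mH H0.
rewrite -ge0_integralZl //; first last.
- by move=> s _; apply: integral_ge0.
- apply: (@measurable_fun_fubini_tonelli_F _ _ _ _ _ (leb n)
    (fun z => F (cone (row_cons z)))) => //.
  apply: (measurableT_comp mF); apply: measurableT_comp; last exact: measurable_row_cons.
  exact: measurable_affine.
apply: ge0_le_integral => //.
- by move=> s _; apply: integral_ge0.
- apply: measurable_funeM.
  apply: (@measurable_fun_fubini_tonelli_F _ _ _ _ _ (leb n)
    (fun z => F (cone (row_cons z)))) => //.
  apply: (measurableT_comp mF); apply: measurableT_comp; last exact: measurable_row_cons.
  exact: measurable_affine.
move=> s _.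
have [/set_mem hs|hs] := boolP (s \in J); last first.
  rewrite integral0_eq ?mule_ge0 ?lee_fin ?integral_ge0 // => t _.
  by rewrite /H /= indicE (negPf hs) !mul0r.
have [s0 s2] : 0 <= s /\ s <= 2^-1.
  by move: hs; rewrite /J /= in_itv /= => /andP.
have s1 : 2^-1 <= 1 - s by lra.
have us : ((1 - s)%:M : 'M[R]_n) \in unitmx.
  by rewrite unitmxE det_scalar unitrX // unitfE gt_eqF //; lra.
pose G t := F (cone (row_cons (s, t))).
have mGs : measurable_fun setT G.
  apply: (measurableT_comp mF); apply: measurableT_comp; last exact: measurable_row_cons1.
  exact: measurable_affine.
have G0 t : (0 <= G t)%E by exact: F0.
rewrite -(linear_change_unitmx us mGs G0) det_scalar muleA -EFinM.
apply: (@le_trans _ _ (1%:E * \int[leb n]_x G (x *m (1 - s)%:M)%R)%E); last first.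
  rewrite lee_wpmul2r //; first by apply: integral_ge0 => x _; exact: F0.
  rewrite lee_fin.
  have h1s : 0 <= 1 - s by lra.
  rewrite ger0_norm ?exprn_ge0 // -exprMn.
  by apply: exprn_ege1; lra.
rewrite mul1e; apply: ge0_le_integral => //.
- exact: (measurableT_comp mH (measurable_pair1 _)).
- by apply: (measurableT_comp mGs); exact: measurable_linear.
move=> t _; have [/set_mem ht|ht] := boolP (t \in @refsimplex R n); last first.
  by rewrite /H /= [X in _ * X * _]indicE (negPf ht) mulr0 mul0r; exact: F0.
rewrite Hin // -coneE /G mul_mx_scalar /F patchE mem_set //.
by apply: cone_simplex => //; apply/andP; split => //; lra.
Qed.

End simplex_trace.

(** Trace inequality on a simplex for polynomials of bounded degree, with a
    constant that depends only on the degree and the dimension. *)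
Lemma simplex_trace (R : realType) n l : exists2 K : R, 0 < K &
  forall V : 'M[R]_(n.+2, n.+1), Defs.nondegenerate V ->
  forall p : mpoly n.+1 R, (msize p <= l.+1)%N ->
  ((gram V)%:E * \int[leb n]_(t in @refsimplex R n)
       (peval p (simplex_param (row' ord0 V) t) ^+ 2)%:E
   <= K%:E * \int[leb n.+1]_(x in simplex V) (peval p x ^+ 2)%:E)%E.
Proof.
have [K K0 hK] := @poly_sqr_extrapolation R l.+1.
exists (K * 2 ^+ n); first by rewrite mulr_gt0 ?exprn_gt0.
move=> V nV p hp; apply: simplex_trace_aux K0 hK _ p hp.
by rewrite gram_square normr_eq0 -unitfE -unitmxE -row_free_unit.
Qed.

Section piecewise_FTC.
Context {R : realType}.
Local Notation mu1 := (@lebesgue_measure R).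

Lemma integrable_itv_poly (q : {poly R}) (i : interval R) (a b : R) :
  i = `]a, b[%R \/ i = `[a, b]%R \/ i = `]a, b]%R \/ i = `[a, b[%R ->
  mu1.-integrable [set` i] (EFin \o horner q).
Proof.
move=> hi.
have h : mu1.-integrable `[a, b]%classic (EFin \o horner q).
  apply: continuous_compact_integrable; first exact: segment_compact.
  by apply: continuous_subspaceT; exact: continuous_horner.
apply: integrableS h; rewrite //; [exact: measurable_itv..|].
by case: hi => [->|[->|[->|->]]] x /=; rewrite !in_itv /= => /andP[h1 h2];
  rewrite ?(ltW h1) ?(ltW h2) ?h1 ?h2.
Qed.

Lemma Rintegral_deriv_poly (q : {poly R}) (a b : R) : a < b ->
  \int[mu1]_(t in `]a, b[) q^`().[t] = q.[b] - q.[a].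
Proof.
move=> ab.
rewrite Rintegral_itv_obnd_cbnd; last first.
  by apply: (@integrable_itv_poly _ _ a b); left.
rewrite Rintegral_itv_bndo_bndc; last first.
  by apply: (@integrable_itv_poly _ _ a b); do 3 right.
rewrite /Rintegral (@continuous_FTC2 _ _ (horner q)) //.
- by apply: continuous_subspaceT; exact: continuous_horner.
- split.
  + by move=> x _; exact: derivable_horner.
  + by apply: cvg_at_right_filter; exact: continuous_horner.
  + by apply: cvg_at_left_filter; exact: continuous_horner.
- by move=> x _; rewrite derivE.
Qed.

Lemma integrable_indic_poly (U : set R) (q : {poly R}) (i : interval R) (a b : R) :
  measurable (U : set (measurableTypeR R)) ->
  i = `]a, b[%R \/ i = `[a, b]%R \/ i = `]a, b]%R \/ i = `[a, b[%R ->
  mu1.-integrable [set` i] (EFin \o (fun t => \1_U t * q.[t])).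
Proof.
move=> mU hi; apply: le_integrable (integrable_itv_poly q hi).
- exact: measurable_itv.
- apply/measurable_EFinP; apply: measurable_funM.
    exact: measurable_funTS (measurable_indic mU).
  apply: measurable_funTS; apply: continuous_measurable_fun.
  exact: continuous_horner.
- move=> t _; rewrite lee_fin normrM ler_piMl // indicE.
  by case: (t \in U); rewrite ?normr1 ?normr0.
Qed.

(** Fundamental theorem of calculus against the indicator of an open set of the
    line that is constant off finitely many points [z F], where it jumps down
    by [sg F]. *)
Lemma piecewise_FTC (T : eqType) (z sg : T -> R) (U : set R) (q : {poly R}) (b : R)
    (s : seq T) (a c : R) :
  measurable (U : set (measurableTypeR R)) ->
  (forall F, F \in s -> exists2 e : R, 0 < e & forall t, 0 < t < e ->
    \1_U (z F - t) - \1_U (z F + t) = sg F) ->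
  path <%R a (rcons [seq z F | F <- s] b) ->
  (forall u v, a <= u -> v <= b -> (forall F, F \in s -> ~~ (u < z F < v)) ->
     forall x y, u < x < v -> u < y < v -> \1_U x = \1_U y :> R) ->
  (forall x, a < x < head b [seq z F | F <- s] -> \1_U x = c) ->
  (forall x, last a [seq z F | F <- s] < x < b -> \1_U x = 0 :> R) ->
  \int[mu1]_(t in `]a, b[) (\1_U t * q^`().[t]) =
  \sum_(F <- s) sg F * q.[z F] - c * q.[a].
Proof.
move=> mU; elim: s a c => [|F s IH] a c hj /=.
  rewrite andbT => ab _ hc h0.
  have hm : a < (a + b) / 2 < b by apply/andP; split; lra.
  have -> : c = 0 by rewrite -(hc _ hm) h0.
  rewrite big_nil mul0r subr0.
  transitivity (\int[mu1]_(t in `]a, b[) (0 : R)).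
    apply: eq_Rintegral => t /set_mem; rewrite /= in_itv /= => ht.
    by rewrite h0 // mul0r.
  by rewrite Rintegral_cst ?mul0r //; exact: measurable_itv.
move=> /andP[az pz] hcst hc h0.
have zb : z F < b.
  have : all (> z F) (rcons [seq z F | F <- s] b) by apply: order_path_min pz; exact: lt_trans.
  by rewrite all_rcons => /andP[].
set zs := [seq z F | F <- s] in pz hc h0 *.
have [e e0 he] := hj F (mem_head _ _).
have zh : z F < head b zs.
  by move: pz; case: (zs) => [|y l] /=; [rewrite andbT|case/andP].
have hs_lt G : G \in s -> z F < z G.
  move=> Gs; have : all (> z F) (rcons zs b) by apply: order_path_min pz; exact: lt_trans.
  by rewrite all_rcons => /andP[_ /allP]; apply; rewrite map_f.
have hs_head G : G \in s -> head b zs <= z G.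
  move: pz; rewrite /zs; case: (s) => // y l /= /andP[_ pl].
  rewrite inE => /predU1P[->//|Gl]; apply: ltW.
  have : all (> z y) (rcons [seq z F | F <- l] b) by apply: order_path_min pl; exact: lt_trans.
  by rewrite all_rcons => /andP[_ /allP]; apply; rewrite map_f.
have hb : head b zs <= b.
  move: pz; rewrite /zs; case: (s) => //= y l /andP[_ pl]; apply: ltW.
  have : all (> z y) (rcons [seq z F | F <- l] b) by apply: order_path_min pl; exact: lt_trans.
  by rewrite all_rcons => /andP[].
have hc' x : z F < x < head b zs -> \1_U x = c - sg F.
  move=> hx.
  pose t := Num.min (e / 2) (Num.min ((z F - a) / 2) ((head b zs - z F) / 2)).
  have t0 : 0 < t by rewrite /t !lt_min; apply/and3P; split; lra.
  have t1 : t <= e / 2 by rewrite /t ge_min lexx.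
  have t2 : t <= (z F - a) / 2 by rewrite /t !ge_min lexx !orbT.
  have t3 : t <= (head b zs - z F) / 2 by rewrite /t !ge_min lexx !orbT.
  rewrite -(he t); last by apply/andP; split; lra.
  rewrite -(hc (z F - t)); last by apply/andP; split; lra.
  rewrite opprB addrC subrK.
  apply: (hcst (z F) (head b zs)) => //; first exact: ltW.
    move=> G; rewrite inE => /predU1P[->|Gs]; first by rewrite ltxx.
    by rewrite negb_and -!leNgt hs_head // orbT.
  by apply/andP; split; lra.
have intU (q' : {poly R}) (i : interval R) (u v : R) := @integrable_indic_poly U q' i u v mU.
have e1 := @Rintegral_itvB R (fun t => \1_U t * q^`().[t]) (BRight a) (BLeft b) (z F).
move: e1; rewrite !bnd_simp => /(_ _ (ltW az) zb) /(canRL (subrK _)) ->; last first.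
  by apply: (intU _ _ a b); left.
rewrite (IH _ (c - sg F)) //; first last.
- move=> u v zu vb hG; apply: hcst => //; first exact: le_trans (ltW az) zu.
  move=> G; rewrite inE => /predU1P[->|]; last exact: hG.
  by rewrite negb_and -leNgt zu.
- by move=> G Gs; apply: hj; rewrite inE Gs orbT.
rewrite -Rintegral_itv_bndo_bndc; last first.
  by apply: (intU _ _ a (z F)); left.
have -> : \int[mu1]_(t in `]a, (z F)[) (\1_U t * q^`().[t]) = c * (q.[z F] - q.[a]).
  rewrite -Rintegral_deriv_poly // -RintegralZl //; last first.
    by apply: (@integrable_itv_poly _ _ a (z F)); left.
  by apply: eq_Rintegral => t /set_mem; rewrite /= in_itv /= => ht; rewrite hc.
rewrite big_cons; ring.
Qed.

End piecewise_FTC.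

Section negligible_finite.
Context d (T : measurableType d) (R : realType) (mu : {measure set T -> \bar R}).

Lemma negligible_finite (J : finType) (F : J -> set T) :
  (forall j, mu.-negligible (F j)) -> mu.-negligible [set x | exists j, F j x].
Proof.
move=> hF.
have h (s : seq J) : mu.-negligible [set x | exists2 j, j \in s & F j x].
  elim: s => [|j s IH].
    by apply: negligibleS (negligible_set0 mu) => x [].
  apply: negligibleS (negligibleU (hF j) IH) => x [k].
  by rewrite inE => /predU1P[->|ks] Fk; [left|right; exists k].
by apply: negligibleS (h (enum J)) => x [j Fj]; exists j; rewrite ?mem_enum.
Qed.

End negligible_finite.

(** A barycentric coordinate is a nonconstant affine function of the point. *)
Lemma negligible_bary0 (R : realType) n (Q : 'M[R]_n) (b : 'rV[R]_n) (j : 'I_n.+1) :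
  Q \in unitmx ->
  (leb n).-negligible [set y : 'rV[R]_n | bary ((y - b) *m Q) ord0 j = 0].
Proof.
move=> uQ.
have QE (y : 'rV[R]_n) k : ((y - b) *m Q) ord0 k = \sum_a y ord0 a * Q a k - (b *m Q) ord0 k.
  by rewrite mulmxBl mxE [X in X + _]mxE [X in _ + X]mxE.
have key (u : 'cV[R]_n) (c : R) : u != 0 ->
    (leb n).-negligible [set y : 'rV[R]_n | \sum_a y ord0 a * (Q *m u) a ord0 = c].
  move=> u0; apply/negligibleP; last first.
    apply: leb_hyperplane0; apply/existsP.
    rewrite -[X in is_true X]negbK; apply/negP => /existsPn h.
    move/eqP: u0; apply; apply: (can_inj (mulKmx uQ)).
    rewrite mulmx0; apply/matrixP => a c'; rewrite ord1 [RHS]mxE.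
    by have /negPn/eqP := h a.
  have := @continuous_measurable_row R n (fun y => \sum_a y ord0 a * (Q *m u) a ord0).
  move=> /(_ _ measurableT [set c] (measurable_set1 _)).
  rewrite setTI; apply.
  by apply: cont_sum => a; apply: contM; [exact: continuous_coor|exact: contC].
case: (unliftP ord0 j) => [k ->|->].
  apply: negligibleS (key (delta_mx k ord0) ((b *m Q) ord0 k) _).
    move=> y; rewrite /= mxE liftK QE => /eqP; rewrite subr_eq0 => /eqP <-.
    apply: eq_bigr => a _; congr (_ * _).
    by rewrite -colE mxE.
  apply/eqP => /matrixP/(_ k ord0); rewrite !mxE !eqxx => /eqP.
  by rewrite oner_eq0.
have [n0|n0] := posnP n.
  apply: negligibleS (negligible_set0 _) => y; rewrite /= mxE unlift_none.
  rewrite big1 ?subr0 => [/eqP|k _]; first by rewrite oner_eq0.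
  by exfalso; case: k => k; rewrite n0.
apply: negligibleS (key (const_mx 1) (1 + \sum_k (b *m Q) ord0 k) _).
  move=> y; rewrite /= mxE unlift_none => /eqP; rewrite subr_eq0 => /eqP e.
  rewrite [X in _ = X + _]e; under [X in _ = X + _]eq_bigr do rewrite QE.
  rewrite big_split /= sumrN subrK exchange_big /=; apply: eq_bigr => a _.
  rewrite -mulr_sumr; congr (_ * _); rewrite mxE; apply: eq_bigr => k _.
  by rewrite [X in _ * X]mxE mulr1.
apply/eqP => /matrixP/(_ (Ordinal n0) ord0); rewrite !mxE => /eqP.
by rewrite oner_eq0.
Qed.

Section row_projection.
Context {R : realType} {n : nat}.
Variable i : 'I_n.+1.
Local Notation E := 'rV[R]_n.+1.

Lemma col'_line t (y : 'rV[R]_n) : col' i (line i t y) = y.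
Proof. by apply/rowP => j; rewrite !mxE liftK. Qed.

Lemma line_coor t (y : 'rV[R]_n) : line i t y ord0 i = t.
Proof. by rewrite mxE unlift_none. Qed.

Lemma line_col' (x : E) : line i (x ord0 i) (col' i x) = x.
Proof.
apply/rowP => k; rewrite mxE; case: (unliftP i k) => [j ->|->] //.
by rewrite mxE.
Qed.

Lemma col'_mulmx m p (A : 'M[R]_(m, p)) (B : 'M[R]_(p, n.+1)) :
  col' i (A *m B) = A *m col' i B.
Proof.
by apply/matrixP => a b; rewrite !mxE; apply: eq_bigr => c _; rewrite !mxE.
Qed.

Lemma col'D m (A B : 'M[R]_(m, n.+1)) : col' i (A + B) = col' i A + col' i B.
Proof. by apply/matrixP => a b; rewrite !mxE. Qed.

Lemma mxdot_line t (y : 'rV[R]_n) (v : E) :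
  mxdot (line i t y) v = t * v ord0 i + \sum_j y ord0 j * v ord0 (lift i j).
Proof.
rewrite mxdot_row (bigD1_ord i) //= mxE unlift_none; congr (_ + _).
by apply: eq_bigr => j _; rewrite mxE liftK.
Qed.

Lemma continuous_line (y : 'rV[R]_n) : continuous (fun t : R => line i t y).
Proof.
apply: cont_row => k; case: (unliftP i k) => [j ->|->].
  rewrite (_ : (fun _ => _) = (fun=> y ord0 j)); first exact: contC.
  by apply/funext => t; rewrite mxE liftK.
rewrite (_ : (fun _ => _) = id); first by move=> t; exact: cvg_id.
by apply/funext => t; rewrite mxE unlift_none.
Qed.

End row_projection.

Section face_geometry.
Context {R : realType} {n : nat}.
Local Notation E := 'rV[R]_n.+1.
Variables (V : 'M[R]_(n.+1, n.+1)) (nu : E) (i : 'I_n.+1).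
Hypotheses (nu1 : enorm nu = 1) (Vnu : edges V *m nu^T = 0).

Let mxdot_nu : mxdot nu nu = 1.
Proof. by rewrite -enorm_sqr nu1 expr1n. Qed.

Let N : 'M[R]_(1 + n) := col_mx nu (edges V).

Let det_N : `|\det N| = gram V.
Proof.
have NNT : N *m N^T = block_mx 1%:M 0 0 (edges V *m (edges V)^T).
  rewrite /N tr_col_mx mul_col_row mxdot_mul mxdot_nu Vnu; congr block_mx.
  by apply: trmx_inj; rewrite trmx_mul trmxK Vnu trmx0.
rewrite /gram -sqrtr_sqr; congr Num.sqrt.
by rewrite expr2 -[X in _ * X]det_tr -det_mulmx NNT det_ublock det1 mul1r.
Qed.

(** Cofactor expansion of the square matrix made of the unit normal and of the
    edges: its determinant is the volume spanned by the edges, and it sends the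
    normal to the first basis vector. *)
Lemma det_col'_edges : `|\det (col' i (edges V))| = `|nu ord0 i| * gram V.
Proof.
have Nnu : N *m nu^T = col_mx 1%:M 0.
  by rewrite /N mul_col_mx mxdot_mul mxdot_nu Vnu.
have h : \det N *: nu^T = \adj N *m col_mx 1%:M 0.
  by rewrite -Nnu mulmxA mul_adj_mx mul_scalar_mx.
have := congr1 (fun A : 'cV[R]_(1 + n) => `|A i ord0|) h.
rewrite mxE normrM det_N mxE mulrC => ->; rewrite mxE (bigD1 (ord0 : 'I_(1 + n))) //=.
rewrite big1 => [|k k0]; last first.
  rewrite [X in _ * X]mxE; case: splitP => [a ka|a _]; last by rewrite [X in _ * X]mxE mulr0.
  by case/eqP: k0; apply: val_inj; rewrite /= ka ord1.
rewrite addr0 [X in _ * X]mxE; case: splitP => [a _|a /eqP] //.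
rewrite ord1 [X in _ * X]mxE eqxx mulr1 mxE /cofactor.
rewrite normrM normrX normrN1 expr1n mul1r; congr (`|\det _|).
apply/matrixP => k c; rewrite !mxE.
case: splitP => [a0 /= e|a1 /= e]; first by have := ltn_ord a0; rewrite -e.
have -> : a1 = k by apply: val_inj; rewrite /=; move: e => /addnI.
by rewrite !mxE.
Qed.

Lemma simplex_param_plane t : mxdot (simplex_param V t) nu = mxdot (row ord0 V) nu.
Proof.
rewrite /simplex_param mxdotDl; have : t *m edges V *m nu^T = 0.
  by rewrite -mulmxA Vnu mulmx0.
rewrite mxdot_mul => /(congr1 (fun A : 'M[R]_1 => A ord0 ord0)).
by rewrite !mxE mulr1n => ->; rewrite addr0.
Qed.

Lemma simplex_plane x : simplex V x -> mxdot x nu = mxdot (row ord0 V) nu.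
Proof. by move=> /simplexP[t _ ->]; exact: simplex_param_plane. Qed.

Lemma negligible_vertical : nu ord0 i = 0 ->
  (leb n).-negligible [set y : 'rV[R]_n | exists t, simplex V (line i t y)].
Proof.
move=> nui.
apply: (@negligibleS _ _ _ _ [set y : 'rV[R]_n |
   \sum_j y ord0 j * nu ord0 (lift i j) = mxdot (row ord0 V) nu]).
  move=> y [t] /simplex_plane; rewrite mxdot_line nui mulr0 add0r; exact.
apply/negligibleP.
  have := @continuous_measurable_row R n (fun y => \sum_j y ord0 j * nu ord0 (lift i j)).
  move=> /(_ _ measurableT [set mxdot (row ord0 V) nu] (measurable_set1 _)).
  rewrite setTI; apply.
  by apply: cont_sum => j; apply: contM; [exact: continuous_coor|exact: contC].
apply: leb_hyperplane0.
apply/existsP; rewrite -[X in is_true X]negbK; apply/negP => /existsPn h.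
have : mxdot nu nu = 0.
  rewrite mxdot_row (bigD1_ord i) //= nui mulr0 add0r big1 // => j _.
  by have /negPn/eqP -> := h j; rewrite mulr0.
by rewrite mxdot_nu => /eqP; rewrite oner_eq0.
Qed.

Hypothesis nondegV : Defs.nondegenerate V.
Lemma gram_gt0 : 0 < gram V.
Proof.
rewrite lt_neqAle sqrtr_ge0 andbT eq_sym -det_N normr_eq0.
rewrite -unitfE -unitmxE -row_free_unit; apply/inj_row_free => v.
rewrite -[v]hsubmxK mul_row_col => h.
have l0 : lsubmx v = 0.
  have := congr1 (mulmx^~ nu^T) h; rewrite mulmxDl mul0mx -!mulmxA Vnu mulmx0 addr0.
  by rewrite mxdot_mul mxdot_nu mulmx1.
move: h; rewrite l0 mul0mx add0r => /eqP; rewrite mulmx_free_eq0 // => /eqP ->.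
by rewrite row_mx0.
Qed.

Hypothesis nui : nu ord0 i != 0.

Lemma col'_edges_unit : col' i (edges V) \in unitmx.
Proof.
rewrite unitmxE unitfE -normr_eq0 det_col'_edges mulf_neq0 ?normr_eq0 //.
by rewrite gt_eqF // gram_gt0.
Qed.

Let Q := invmx (col' i (edges V)).

(** Parameter, relative to vertex 0, of the point of the plane of the face that
    lies on the line through [y]. *)
Definition tpar (y : 'rV[R]_n) : 'rV[R]_n :=
  (y - col' i (row ord0 V)) *m Q.

Definition zpar (y : 'rV[R]_n) : R := simplex_param V (tpar y) ord0 i.

Lemma simplex_param_tpar y : simplex_param V (tpar y) = line i (zpar y) y.
Proof.
rewrite -[LHS](line_col' i); congr line.
rewrite /simplex_param col'D col'_mulmx /tpar -mulmxA mulVmx ?col'_edges_unit //.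
by rewrite mulmx1 addrC subrK.
Qed.

Lemma line_param t y s : line i t y = simplex_param V s -> s = tpar y /\ t = zpar y.
Proof.
move=> h; have e : s = tpar y.
  have hy : y = col' i (row ord0 V) + s *m col' i (edges V).
    by rewrite -(col'_line i t y) h /simplex_param col'D col'_mulmx.
  by rewrite /tpar {1}hy addrAC subrr add0r mulmxK ?col'_edges_unit.
by split=> //; rewrite /zpar -e -h line_coor.
Qed.

Lemma simplex_line t y : simplex V (line i t y) <-> refsimplex (tpar y) /\ t = zpar y.
Proof.
split=> [/simplexP[s hs /line_param[<- ->]] //|[h ->]].
by apply/simplexP; exists (tpar y); rewrite ?simplex_param_tpar.
Qed.

Lemma negligible_rim : (leb n).-negligible
  [set y | exists t, simplex V (line i t y) /\ ~ open_simplex V (line i t y)].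
Proof.
pose F (j : 'I_n.+1) := [set y : 'rV[R]_n | bary (tpar y) ord0 j = 0].
apply: (@negligibleS _ _ _ _ [set y | exists j, F j y]).
  move=> y [t] [/simplex_line[ht tz]] hopen.
  have b0 := bary_ge0 ht.
  apply: contrapT => hn; apply: hopen; exists (bary (tpar y)); split.
  - move=> j; rewrite lt_neqAle b0 andbT eq_sym; apply/eqP => bj.
    by apply: hn; exists j.
  - exact: bary_sum.
  - by rewrite tz -simplex_param_tpar simplex_param_bary.
apply: negligible_finite => j.
apply: negligible_bary0; by rewrite unitmx_inv col'_edges_unit.
Qed.

Lemma continuous_simplex_param (f : E -> R) : continuous f ->
  continuous (fun t => f (simplex_param V t)).
Proof.
move=> cf.
have cs : continuous (fun t : 'rV[R]_n => t *m edges V + row ord0 V) by exact: cont_affine.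
rewrite (_ : (fun _ => _) = (f \o (fun t : 'rV[R]_n => t *m edges V + row ord0 V))).
  by move=> t; apply: continuous_comp; [exact: cs|exact: cf].
by apply/funext => t; rewrite /= /simplex_param addrC.
Qed.

Let integrable_ref (f : E -> R) : continuous f -> (leb n).-integrable setT
  (fun t => (\1_(@refsimplex R n) t * f (simplex_param V t))%:E).
Proof.
move=> cf; have := integrable_continuous_boxed (@measurable_refsimplex R n)
  (@boxed_refsimplex R n) (continuous_simplex_param cf).
move=> /(integrable_mkcond _ (@measurable_refsimplex R n)).
apply: eq_integrable => // t _; rewrite /= patchE indicE.
by case: (t \in _); rewrite ?mul1r ?mul0r.
Qed.

Let uQ : Q \in unitmx.
Proof. by rewrite unitmx_inv col'_edges_unit. Qed.

Lemma integrable_projection (f : E -> R) : continuous f ->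
  (leb n).-integrable setT
    (fun y => (\1_(@refsimplex R n) (tpar y) * f (simplex_param V (tpar y)))%:E).
Proof.
move=> cf.
have := integrable_leb_affine (- (col' i (row ord0 V) *m Q)) uQ (integrable_ref cf).
by apply: eq_integrable => // y _; rewrite -mulmxBl.
Qed.

(** Integrals over the face and over its projection along a coordinate axis. *)
Lemma Rintegral_projection (f : E -> R) : continuous f ->
  \int[leb n]_y (\1_(@refsimplex R n) (tpar y) * f (simplex_param V (tpar y)))
  = `|nu ord0 i| * simplex_integral V f.
Proof.
move=> cf; rewrite /simplex_integral mulrA -det_col'_edges.
pose g (t : 'rV[R]_n) := \1_(@refsimplex R n) t * f (simplex_param V t).
have e : \int[leb n]_(t in @refsimplex R n) f (simplex_param V t) = \int[leb n]_t g t.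
  rewrite Rintegral_mkcond; apply: eq_Rintegral => t _; rewrite /g patchE indicE.
  by case: (t \in _); rewrite ?mul1r ?mul0r.
rewrite e -(Rintegral_leb_affine (- (col' i (row ord0 V) *m Q)) uQ (integrable_ref cf)) mulrA.
rewrite det_inv normrV ?unitfE -?unitfE; last by rewrite -unitmxE col'_edges_unit.
rewrite divff ?mul1r; last by rewrite normr_eq0 -unitfE -unitmxE col'_edges_unit.
by apply: eq_Rintegral => y _; rewrite -mulmxBl.
Qed.

End face_geometry.

Section segments.
Context {R : realType}.

(** A segment that starts in an open set and avoids its frontier stays in it. *)
Lemma segment_avoids_frontier n (A : set 'rV[R]_n) (a b : 'rV[R]_n) : open A -> A a ->
  (forall s, 0 <= s <= 1 -> ~ frontier A (a + s *: (b - a))) -> A b.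
Proof.
move=> oA Aa hfr.
pose f (s : R) : 'rV[R]_n := a + s *: (b - a).
have cf : continuous f.
  apply: cont_row => j.
  rewrite (_ : (fun _ => _) = (fun s : R => a ord0 j + s * (b - a) ord0 j)); last first.
    by apply/funext => s; rewrite !mxE.
  apply: contD; first exact: contC.
  by apply: contM; [move=> s; exact: cvg_id|exact: contC].
have cS : connected (f @` `[0, 1]%classic).
  apply: connected_continuous_connected; first exact: segment_connected.
  exact: continuous_subspaceT.
have Sfr x : (f @` `[0, 1]%classic) x -> ~ frontier A x.
  by move=> [s /=]; rewrite in_itv /= => hs <-; exact: hfr.
have fb : (f @` `[0, 1]%classic) b.
  by exists 1; rewrite /= ?in_itv /= ?ler01 ?lexx // /f scale1r addrC subrK.
have fa : (f @` `[0, 1]%classic) a.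
  by exists 0; rewrite /= ?in_itv /= ?ler01 ?lexx // /f scale0r addr0.
have := cS ((f @` `[0, 1]%classic) `&` A); move=> h.
suff : ((f @` `[0, 1]%classic) `&` A) b by case.
rewrite h //; first by exists a.
  by exists A.
exists (closure A); first exact: closed_closure.
apply/seteqP; split=> x [Sx]; first by split => //; exact: subset_closure.
move=> clx; split=> //; apply: contrapT => nAx; apply: (Sfr _ Sx); split => //.
by move=> /interior_subset.
Qed.

End segments.

Section mesh_lines.
Context {R : realType} {n : nat} {Om : set 'rV[R]_n.+1} (M : polymesh Om).
Local Notation E := 'rV[R]_n.+1.
Local Notation mu1 := (@lebesgue_measure R).
Hypothesis bOm : boxed Om.

Lemma boxed_dom (k : elt M) : boxed (dom k).
Proof. exact: boxedS (@dom_sub _ _ _ M k) bOm. Qed.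

Lemma measurable_dom (k : elt M) : measurable (dom k).
Proof. by apply: open_measurable_row; exact: dom_open. Qed.

Lemma dom_unique (k k' : elt M) x : dom k x -> dom k' x -> k = k'.
Proof.
move=> kx k'x; apply: contrapT => /eqP kk'.
by have := dom_disjoint kk' => /seteqP[/(_ x) + _]; apply.
Qed.

(** Orientation of the normal of [F] with respect to [k]. *)
Definition sgnF (F : face M) (k : elt M) : R := if k == kplus F then 1 else -1.

Lemma faces_isolated (F : face M) (x : E) :
  (forall G, G != F -> ~ simplex (fvert G) x) ->
  exists2 r : R, 0 < r & forall y : E, (forall j, `|x ord0 j - y ord0 j| < r) ->
    forall G, G != F -> ~ simplex (fvert G) y.
Proof.
move=> hx; pose C := \bigcup_(G in [set G | G != F]) simplex (fvert G).
have cC : closed C.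
  by apply: closed_bigcup => [|G _]; [exact: finite_finset|exact: closed_simplex].
have nCx : (~` C) x by move=> [G /= GF Gx]; exact: (hx G GF).
have [r r0 hr] := open_rowP (closed_openC cC) nCx.
by exists r => // y /hr nCy G GF Gy; apply: nCy; exists G.
Qed.

Variable i : 'I_n.+1.

Lemma line_shift (z s : R) (y : 'rV[R]_n) :
  line i (z + s) y = line i z y + s *: delta_mx ord0 i.
Proof.
apply/rowP => j; rewrite !mxE; case: (unliftP i j) => [c ->|->].
  by rewrite [lift i c == i]eq_sym (negPf (neq_lift _ _)) andbF mulr0 addr0.
by rewrite !eqxx mulr1.
Qed.

Lemma crossing_sides (F : face M) (z : R) (y : 'rV[R]_n) :
  simplex (fvert F) (line i z y) ->
  (forall G, G != F -> ~ simplex (fvert G) (line i z y)) ->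
  exists2 e : R, 0 < e & forall s, 0 < `|s| < e ->
    (s * normal F ord0 i < 0 -> dom (kplus F) (line i (z + s) y)) /\
    (0 < s * normal F ord0 i -> if kminus F is Some k' then dom k' (line i (z + s) y)
       else forall k : elt M, ~ dom k (line i (z + s) y)).
Proof.
move=> Fx hG; set x := line i z y.
have [e e0 he] := normal_outward Fx hG.
have [r r0 hr] := faces_isolated hG.
exists (Num.min e r); first by rewrite lt_min e0.
move=> s /andP[s0]; rewrite lt_min => /andP[se sr].
have {}he := he `|s|; rewrite s0 se in he; have {he} [hp hm] := he isT.
set nu := normal F in hp hm *; set w := line i (z + s) y.
have nunu : mxdot nu nu = 1 by rewrite -enorm_sqr (normal_unit F) expr1n.
have wE : w = x + s *: delta_mx ord0 i by exact: line_shift.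
have dnu : mxdot (delta_mx ord0 i) nu = nu ord0 i.
  rewrite mxdot_row (bigD1 i) //= mxE !eqxx mul1r big1 ?addr0 // => j ji.
  by rewrite mxE (negPf ji) andbF mul0r.
(* the segment from the shift of [x] along the normal to [w] stays on one side of
   the plane of [F] and near [x] *)
have avoid (d : R) (k : elt M) (a b : E) : `|d| = 1 ->
    0 < d * (s * nu ord0 i) ->
    (a = x + (d * `|s|) *: nu /\ b = w) \/ (b = x + (d * `|s|) *: nu /\ a = w) ->
    forall t, 0 <= t <= 1 -> ~ frontier (dom k) (a + t *: (b - a)).
  move=> d1 dnu0 hab t /andP[t0 t1].
  suff h c : 0 <= c <= 1 -> ~ frontier (dom k)
      (x + ((1 - c) * (d * `|s|)) *: nu + (c * s) *: delta_mx ord0 i).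
    case: hab => -[-> ->]; rewrite wE.
      have := h t; rewrite t0 t1 => /(_ isT); congr (~ frontier _ _).
      by apply/rowP => j; rewrite !mxE; ring.
    have := h (1 - t); rewrite subr_ge0 t1 gerBl t0 => /(_ isT).
    by congr (~ frontier _ _); apply/rowP => j; rewrite !mxE; ring.
  move=> /andP[c0 c1]; set u := (X in frontier _ X).
  rewrite dom_frontier => -[G /= _ Gu].
  have [GF|GF] := eqVneq G F.
    move: Gu; rewrite GF => /simplex_plane => /(_ _ (normal_orthogonal F)).
    rewrite -(simplex_plane (normal_orthogonal F) Fx) -/nu -/x /u !mxdotDl !mxdotZl nunu dnu.
    move=> hh; have {hh} : (1 - c) * `|s| + c * (d * (s * nu ord0 i)) = 0.
      have -> : (1 - c) * `|s| + c * (d * (s * nu ord0 i)) =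
        d * ((1 - c) * (d * `|s|) * 1 + c * s * nu ord0 i) + (1 - d ^+ 2) * ((1 - c) * `|s|).
        by ring.
      rewrite -real_normK ?num_real // d1 expr1n subrr mul0r addr0.
      have -> : (1 - c) * (d * `|s|) * 1 + c * s * nu ord0 i = 0; last by rewrite mulr0.
      by move: hh => /eqP; rewrite -addrA -subr_eq0 addrAC subrr add0r => /eqP.
    have h1 : 0 <= (1 - c) * `|s| by rewrite mulr_ge0 ?subr_ge0 // ltW.
    have h2 : 0 <= c * (d * (s * nu ord0 i)) by rewrite mulr_ge0 // ltW.
    move=> /eqP; rewrite paddr_eq0 // => /andP[].
    rewrite mulf_eq0 (gt_eqF s0) orbF subr_eq0 => /eqP <-.
    by rewrite mul1r (gt_eqF dnu0).
  apply: (hr u _ G GF Gu) => j.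
  have -> : x ord0 j - u ord0 j =
      - ((1 - c) * (d * `|s|) * nu ord0 j + c * s * (delta_mx ord0 i : E) ord0 j).
    by rewrite /u !mxE; ring.
  rewrite normrN (le_lt_trans (ler_normD _ _)) // !normrM normr_id d1 mul1r.
  rewrite ger0_norm ?subr_ge0 // (ger0_norm c0).
  have nuj : `|nu ord0 j| <= 1 by rewrite -(normal_unit F) coor_le_enorm.
  have dj : `|(delta_mx ord0 i : E) ord0 j| <= 1.
    by rewrite mxE normr_nat lern1 leq_b1.
  apply: le_lt_trans sr.
  rewrite [leRHS](_ : _ = (1 - c) * `|s| * 1 + c * `|s| * 1); last by ring.
  by apply: lerD; rewrite ler_wpM2l // mulr_ge0 ?subr_ge0 // ltW.
split=> hs.
  apply: (@segment_avoids_frontier _ _ _ (x - `|s| *: nu)) => //; first exact: dom_open.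
  apply: (avoid (-1)); rewrite ?normrN1 ?mulN1r ?oppr_gt0 //.
  by left; rewrite scaleNr.
move: hm; case: (kminus F) => [k' hk'|hcl k hk].
  apply: (@segment_avoids_frontier _ _ _ (x + `|s| *: nu)) => //; first exact: dom_open.
  by apply: (avoid 1); rewrite ?normr1 ?mul1r //; left.
apply: hcl; apply: subset_closure; apply: (@dom_sub _ _ _ M k).
apply: (@segment_avoids_frontier _ _ _ w) => //; first exact: dom_open.
by apply: (avoid 1); rewrite ?normr1 ?mul1r //; right.
Qed.

Lemma crossing_jump (F : face M) (k : elt M) (z : R) (y : 'rV[R]_n) : adj F k ->
  normal F ord0 i != 0 -> simplex (fvert F) (line i z y) ->
  (forall G, G != F -> ~ simplex (fvert G) (line i z y)) ->
  exists2 e : R, 0 < e & forall s, 0 < s < e ->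
    \1_(dom k) (line i (z - s) y) - \1_(dom k) (line i (z + s) y)
    = sgnF F k * Num.sg (normal F ord0 i).
Proof.
move=> Fk nui Fx hG; have [e e0 he] := crossing_sides Fx hG.
exists e => // s /andP[s0 se].
have s1 : 0 < `|s| < e by rewrite gtr0_norm // s0.
have s2 : 0 < `|- s| < e by rewrite normrN.
have [hp1 hm1] := he s s1; have [hp2 hm2] := he (- s) s2.
(* indicator on the inner and on the outer side *)
have inner t : dom (kplus F) (line i t y) -> \1_(dom k) (line i t y) = (k == kplus F)%:R :> R.
  move=> ht; rewrite indicE; congr (nat_of_bool _)%:R; apply/idP/eqP => [/set_mem kt|->].
    exact: dom_unique kt ht.
  exact/mem_set.
have outer t : (if kminus F is Some k' then dom k' (line i t y)
       else forall k : elt M, ~ dom k (line i t y)) ->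
    \1_(dom k) (line i t y) = (k != kplus F)%:R :> R.
  move: Fk (@face_two_elements _ _ _ M F); rewrite /adj; case: (kminus F) => [k'|] Fk ff ht.
    rewrite indicE; congr (nat_of_bool _)%:R; apply/idP/idP => [/set_mem kt|kF].
      by apply: contraNneq ff => e'; rewrite -e' (dom_unique kt ht).
    by move: Fk; rewrite (negPf kF) /= => /eqP[->]; apply/mem_set.
  rewrite orbF in Fk; rewrite Fk indicE /=.
  by apply/eqP; rewrite pnatr_eq0 eqb0; apply/negP => /set_mem; exact: ht.
rewrite /sgnF; have := nui; rewrite neq_lt => /orP[nu0|nu0].
  rewrite ltr0_sg //.
  have h1 : 0 < - s * normal F ord0 i by rewrite mulNr oppr_gt0 pmulr_rlt0.
  have h2 : s * normal F ord0 i < 0 by rewrite pmulr_rlt0.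
  rewrite (outer _ (hm2 h1)) (inner _ (hp1 h2)).
  by case: eqP; rewrite /= ?sub0r ?subr0 ?mul1r ?mulN1r ?opprK.
rewrite gtr0_sg //.
have h1 : - s * normal F ord0 i < 0 by rewrite mulNr oppr_lt0 pmulr_rgt0.
have h2 : 0 < s * normal F ord0 i by rewrite pmulr_rgt0.
rewrite (inner _ (hp2 h1)) (outer _ (hm1 h2)).
by case: eqP; rewrite /= ?sub0r ?subr0 ?mul1r ?mulN1r ?opprK.
Qed.

End mesh_lines.

Lemma path_lt_le_last (R : realType) (a x : R) (s : seq R) :
  path <%R a s -> x \in s -> x <= last a s.
Proof.
elim: s a => [//|b s IH] a /= /andP[ab bs]; rewrite inE => /predU1P[->|]; last exact: IH.
elim: s b bs {IH ab} => [//|c s IH] b /= /andP[bc cs].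
exact: le_trans (ltW bc) (IH c cs).
Qed.

Lemma Rintegral_eq0 d (T : measurableType d) (R : realType)
    (mu : {measure set T -> \bar R}) (D : set T) (f : T -> R) :
  (forall x, D x -> f x = 0) -> \int[mu]_(x in D) f x = 0.
Proof.
by move=> f0; rewrite /Rintegral integral0_eq // => x Dx; rewrite f0.
Qed.

Section divergence.
Context {R : realType} {n : nat} {Om : set 'rV[R]_n.+1} (M : polymesh Om).
Local Notation E := 'rV[R]_n.+1.
Local Notation mu1 := (@lebesgue_measure R).
Hypothesis bOm : boxed Om.
Variables (k : elt M) (i : 'I_n.+1).

(** Every point of the skeleton on a generic line parallel to the axis [i] lies
    in the relative interior of a face that is transverse to the line. *)
Definition generic (y : 'rV[R]_n) := forall (F : face M) t,
  simplex (fvert F) (line i t y) ->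
  normal F ord0 i != 0 /\ open_simplex (fvert F) (line i t y).

Lemma ae_generic : {ae leb n, forall y, generic y}.
Proof.
have h : (leb n).-negligible [set y | exists F : face M, exists t,
  simplex (fvert F) (line i t y) /\
  ~ (normal F ord0 i != 0 /\ open_simplex (fvert F) (line i t y))].
  apply: negligible_finite => F.
  have [nui|nui] := eqVneq (normal F ord0 i) 0.
    apply: negligibleS (negligible_vertical (normal_unit F) (normal_orthogonal F) nui).
    by move=> y [t [Ft _]]; exists t.
  apply: negligibleS (negligible_rim (normal_unit F) (normal_orthogonal F)
    (face_nondegenerate F) nui).
  by move=> y [t [Ft Fo]]; exists t; split => // Fo'; apply: Fo.
apply: negligibleS h => y /= hy.
apply: contrapT => hn; apply: hy => F t Ft; apply: contrapT => hF.
by apply: hn; exists F, t.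
Qed.

Lemma generic_unique y (F G : face M) t : generic y ->
  simplex (fvert F) (line i t y) -> simplex (fvert G) (line i t y) -> F = G.
Proof.
move=> gy Ft Gt; apply: contrapT => /eqP FG.
have := face_disjoint FG => /seteqP[/(_ (line i t y)) + _]; apply; split.
  by have [_] := gy F t Ft.
by have [_] := gy G t Gt.
Qed.

Let flux (p : mpoly n.+1 R) (F : face M) (y : 'rV[R]_n) : R :=
  sgnF F k * Num.sg (normal F ord0 i) *
  (\1_(@refsimplex R n) (tpar (fvert F) i y) *
   peval p (simplex_param (fvert F) (tpar (fvert F) i y))).

Lemma integral_line_deriv (p : mpoly n.+1 R) (y : 'rV[R]_n) : generic y ->
  (\int[mu1]_t (\1_(dom k) (line i t y) * peval (mderiv i p) (line i t y))%:E =
   (\sum_(F | adj F k) flux p F y)%:E)%E.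
Proof.
move=> gy.
have [q [hq dq]] := peval_line p i y.
pose hit (F : face M) := (normal F ord0 i != 0) && (tpar (fvert F) i y \in @refsimplex R n).
pose z (F : face M) := zpar (fvert F) i y.
pose sg (F : face M) := sgnF F k * Num.sg (normal F ord0 i).
pose fs := [seq F <- enum (face M) | adj F k && hit F].
pose s := sort (fun F G => z F <= z G) fs.
pose U := [set t : R | dom k (line i t y)].
have hitP F : hit F -> simplex (fvert F) (line i (z F) y).
  move=> /andP[nui /set_mem ht].
  by apply/(simplex_line (normal_unit F) (normal_orthogonal F) (face_nondegenerate F) nui).
have hitI F t : simplex (fvert F) (line i t y) -> hit F /\ t = z F.
  move=> Ft; have [nui _] := gy F t Ft; move: Ft.
  move/(simplex_line (normal_unit F) (normal_orthogonal F) (face_nondegenerate F) nui).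
  by move=> [h1 h2]; split=> //; rewrite /hit nui; exact/mem_set.
have sP F : (F \in s) = (adj F k && hit F).
  by rewrite mem_sort mem_filter mem_enum andbT.
have [r [r0 hr]] : exists r : R, 0 <= r /\ forall t, dom k (line i t y) -> `|t| < r.
  have [r hr] := boxed_dom bOm k; exists `|r|; split=> // t /hr/(_ i).
  rewrite line_coor => h; exact: lt_le_trans h (ler_norm r).
pose B := r + \sum_(F : face M) `|z F| + 1.
have zB F : `|z F| < B.
  rewrite /B ltr_pwDr // (bigD1 F) //= addrCA lerDl addr_ge0 // sumr_ge0 //.
have rB : r < B by rewrite /B ltr_pwDr // lerDl sumr_ge0.
have Bp : 0 < B by exact: le_lt_trans r0 rB.
have Ur t : U t -> `|t| < r by exact: hr.
have oU : open U.
  have := @dom_open _ _ _ M k; rewrite -/U => od.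
  rewrite (_ : U = (fun t => line i t y) @^-1` (dom k)) //.
  by apply: open_comp => // t _; exact: continuous_line.
have mU : measurable (U : set (measurableTypeR R)) by exact: open_measurable.
have UE t : \1_(dom k) (line i t y) = \1_U t :> R.
  by rewrite !indicE; congr (nat_of_bool _)%:R; apply/idP/idP => /set_mem h; exact/mem_set.
have hcst u v : (forall F, F \in s -> ~~ (u < z F < v)) ->
    forall x x', u < x < v -> u < x' < v -> \1_U x = \1_U x' :> R.
  move=> hz.
  have sub x x' : u < x < v -> u < x' < v -> U x -> U x'.
    move=> /andP[ux xv] /andP[ux' xv'] hx.
    apply: (@segment_avoids_frontier _ _ _ (line i x y)) => //; first exact: dom_open.
    move=> c /andP[c0 c1].
    have -> : line i x y + c *: (line i x' y - line i x y) = line i (x + c * (x' - x)) y.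
      apply/rowP => j; rewrite !mxE; case: (unlift i j) => [j'|//].
      by rewrite subrr mulr0 addr0.
    rewrite dom_frontier => -[F /= Fk Ft].
    have [hF tz] := hitI F _ Ft.
    have := hz F; rewrite sP Fk hF => /(_ isT) /negP; apply.
    rewrite -tz; have [xx'|x'x] := leP x x'.
      have h1 : 0 <= c * (x' - x) by rewrite mulr_ge0 // subr_ge0.
      have h2 : c * (x' - x) <= x' - x by rewrite ler_piMl // subr_ge0.
      by apply/andP; split; lra.
    have h1 : 0 <= c * (x - x') by rewrite mulr_ge0 // subr_ge0 ltW.
    have h2 : c * (x - x') <= x - x' by rewrite ler_piMl // subr_ge0 ltW.
    by apply/andP; split; lra.
  move=> x x' hx hx'; rewrite !indicE; congr (nat_of_bool _)%:R.
  by apply/idP/idP => /set_mem h; apply/mem_set; [exact: (sub x)|exact: (sub x')].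
have outU t : r <= `|t| -> \1_U t = 0 :> R.
  move=> rt; rewrite indicE memNset // => /Ur; rewrite ltNge rt //.
have zinj : {in fs &, injective z}.
  move=> F G; rewrite !mem_filter => /andP[/andP[_ hF] _] /andP[/andP[_ hG] _] zFG.
  by apply: (generic_unique gy (hitP F hF)); rewrite zFG; exact: hitP.
have ps : path <%R (- B) (rcons [seq z F | F <- s] B).
  rewrite rcons_path path_min_sorted; last first.
    by apply/allP => _ /mapP[F _ ->] /=; have := zB F; rewrite ltr_norml => /andP[].
  rewrite lt_sorted_uniq_le map_inj_in_uniq; last first.
    by move=> F G; rewrite !mem_sort; exact: zinj.
  rewrite sort_uniq filter_uniq ?enum_uniq //=.
  apply/andP; split.
    rewrite sorted_map; apply: sort_sorted => F G; exact: le_total.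
  have [->|] := eqVneq [seq z F | F <- s] [::]; first by rewrite /= (lt_trans _ Bp) // oppr_lt0.
  move=> s0; have : last (- B) [seq z F | F <- s] \in [seq z F | F <- s].
    by case: [seq z F | F <- s] s0 => //= a l _; exact: mem_last.
  by move=> /mapP[F _ ->]; have := zB F; rewrite ltr_norml => /andP[].
have B0 : 0 <= r < B by rewrite r0.
have mid (a b x : R) : a < x < b -> exists2 t, a < t < x & t < (a + x) / 2 + 1.
  by move=> /andP[ax xb]; exists ((a + x) / 2); [apply/andP; split|]; lra.
have hF := @piecewise_FTC R (face M) z sg U q B s (- B) 0 mU.
have e0 : \int[mu1]_(t in `](- B), B[) (\1_U t * q^`().[t]) = \sum_(F <- s) sg F * q.[z F].
  rewrite hF ?mul0r ?subr0 //.
  - move=> F; rewrite sP => /andP[Fk hF'].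
    have [nui _] := andP hF'.
    have [|e e1 he] := crossing_jump Fk nui (hitP F hF').
      by move=> G /eqP GF /(generic_unique gy (hitP F hF')) FG; apply: GF.
    by exists e => // t ht; rewrite -!UE he.
  - by move=> u v _ _; exact: hcst.
  - move=> x /andP[ax xb].
    pose w := Num.min x (- r).
    have hw : - B < ((- B) + w) / 2 < head B [seq z F | F <- s].
      have wx : w <= x by rewrite /w ge_min lexx.
      have wB : - B < w by rewrite /w lt_min ax ltrN2; case/andP: B0.
      by apply/andP; split; lra.
    rewrite (hcst (- B) (head B [seq z F | F <- s]) _ x _ _ hw) ?ax ?xb //; last first.
      move=> F Fs; rewrite negb_and -!leNgt; apply/orP; right.
      move: ps Fs; case: (s) => // G l /= /andP[_ pl]; rewrite inE => /predU1P[->//|Fl].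
      have : all (> z G) (rcons [seq z F | F <- l] B) by apply: order_path_min pl; exact: lt_trans.
      by rewrite all_rcons => /andP[_ /allP h]; apply/ltW/h/map_f.
    apply: outU; have wr : w <= - r by rewrite /w ge_min lexx orbT.
    by case/andP: B0 => B1 B2; rewrite ler0_norm; lra.
  - move=> x /andP[ax xb].
    pose w := Num.max x r.
    have hw : last (- B) [seq z F | F <- s] < (B + w) / 2 < B.
      have wx : x <= w by rewrite /w le_max lexx.
      have wB : w < B by rewrite /w gt_max xb; case/andP: B0.
      by apply/andP; split; lra.
    rewrite (hcst (last (- B) [seq z F | F <- s]) B _ x _ _ hw) ?ax ?xb //; last first.
      move=> F Fs; rewrite negb_and -!leNgt; apply/orP; left.
      apply: (path_lt_le_last (a := - B)); last by rewrite map_f.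
      by move: ps; rewrite rcons_path => /andP[].
    apply: outU; have wr : r <= w by rewrite /w le_max lexx orbT.
    by case/andP: B0 => B1 B2; rewrite ger0_norm; lra.
have e1 : \sum_(F <- s) sg F * q.[z F] = \sum_(F | adj F k) flux p F y.
  rewrite (perm_big _ (permEl (perm_sort _ _))) big_filter big_enum_cond /=.
  rewrite big_mkcondr; apply: eq_bigr => F _; rewrite /flux -/(sg F).
  have [nui|nui] := eqVneq (normal F ord0 i) 0.
    by rewrite /hit nui eqxx /= /sg nui sgr0 mulr0 mul0r.
  rewrite /hit nui /= indicE; case: ifP => _; last by rewrite mul0r mulr0.
  rewrite mul1r hq (simplex_param_tpar (normal_unit F) (normal_orthogonal F)
    (face_nondegenerate F) nui) //.
rewrite -e1 -e0 /Rintegral fineK; last first.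
  apply: integrable_fin_num; first exact: measurable_itv.
  by apply: (@integrable_indic_poly _ U _ _ (- B) B) => //; left.
rewrite [RHS]integral_mkcond; apply: eq_integral => t _.
rewrite patchE; case: ifPn => [_|ht]; first by rewrite UE dq.
rewrite UE outU ?mul0r //; rewrite leNgt; apply: contra ht => ht.
apply/mem_set; rewrite /= in_itv /=; move: ht; rewrite ltr_norml => /andP[h1 h2].
by case/andP: B0 => B1 B2; apply/andP; split; lra.
Qed.

Let integrable_flux p F : (leb n).-integrable setT (EFin \o flux p F).
Proof.
have [nui|nui] := eqVneq (normal F ord0 i) 0.
  apply: (eq_integrable _ (fun=> 0%E)) => //; last exact: integrable0.
  by move=> y _; rewrite /flux /= nui sgr0 mulr0 mul0r.
have := integrable_projection (normal_unit F) (normal_orthogonal F)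
  (face_nondegenerate F) nui (@continuous_peval R n p).
move=> /(integrableZl measurableT (sgnF F k * Num.sg (normal F ord0 i))).
by apply: eq_integrable => // y _; rewrite /flux /= EFinM.
Qed.

(** Divergence theorem on an element: by Fubini along the lines parallel to the
    axis [i], the integral of a derivative is a sum over the crossings of the
    faces, and the projection of a face scales its area by the component of its
    normal. *)
Theorem divergence_dom (p : mpoly n.+1 R) :
  \int[leb n.+1]_(x in dom k) peval (mderiv i p) x =
  \sum_(F | adj F k) sgnF F k * intF F (fun x => peval p x * normal F ord0 i).
Proof.
pose f (x : E) := \1_(dom k) x * peval (mderiv i p) x.
have fi : (leb n.+1).-integrable setT (EFin \o f).
  have := integrable_continuous_boxed (measurable_dom k) (boxed_dom bOm k)
    (@continuous_peval R n (mderiv i p)).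
  move=> /(integrable_mkcond _ (measurable_dom k)).
  apply: eq_integrable => // x _; rewrite /f /= patchE indicE.
  by case: (x \in _); rewrite ?mul1r ?mul0r.
have -> : \int[leb n.+1]_(x in dom k) peval (mderiv i p) x = \int[leb n.+1]_x f x.
  rewrite Rintegral_mkcond; apply: eq_Rintegral => x _; rewrite /f patchE indicE.
  by case: (x \in _); rewrite ?mul1r ?mul0r.
rewrite /Rintegral (integral_lines i fi).
have -> : (\int[leb n]_y \int[mu1]_t (EFin \o f) (line i t y) =
   \int[leb n]_y (\sum_(F | adj F k) flux p F y)%:E)%E.
  apply: ae_eq_integral => //.
  - exact: measurable_lines fi.
  - have : (leb n).-integrable setT (fun y => \sum_(F | adj F k) (flux p F y)%:E)%E.
      by apply: integrable_sum => // F _; exact: integrable_flux.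
    move=> /(measurable_int _); apply: eq_measurable_fun => y _.
    by rewrite sumEFin.
  - have := ae_generic; apply: filterS => y gy _; exact: integral_line_deriv.
under eq_integral do rewrite -sumEFin.
rewrite integral_sum //; last by move=> F; exact: integrable_flux.
rewrite (eq_bigr (fun F => (\int[leb n]_y flux p F y)%:E)); last first.
  move=> F _; rewrite /Rintegral fineK //.
  exact: integrable_fin_num (integrable_flux p F).
rewrite sumEFin /=; apply: eq_bigr => F _.
have [nui|nui] := eqVneq (normal F ord0 i) 0.
  rewrite /intF /simplex_integral nui !Rintegral_eq0 ?mulr0 //.
    by move=> y _; rewrite /flux nui sgr0 mulr0 mul0r.
  by move=> y _; rewrite mulr0.
have hi := integrable_projection (normal_unit F) (normal_orthogonal F)
  (face_nondegenerate F) nui (@continuous_peval R n p).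
rewrite /flux (@RintegralZl _ _ _ (leb n) setT
  (fun y => \1_(@refsimplex R n) (tpar (fvert F) i y) *
    peval p (simplex_param (fvert F) (tpar (fvert F) i y))) _ measurableT hi).
rewrite (Rintegral_projection (normal_unit F) (normal_orthogonal F)
  (face_nondegenerate F) nui (@continuous_peval R n p)).
rewrite -mulrA; congr (_ * _); rewrite mulrA -numEsg /intF /simplex_integral.
rewrite mulrCA; congr (_ * _); rewrite mulrC -RintegralZr //.
  exact: measurable_refsimplex.
apply: integrable_continuous_boxed; [exact: measurable_refsimplex|exact: boxed_refsimplex|].
exact: continuous_simplex_param (@continuous_peval R n p).
Qed.

End divergence.

Section element_trace.
Context {R : realType} {n : nat}.
Local Notation E := 'rV[R]_n.+1.

Lemma negligible_simplex_rim (V : 'M[R]_(n.+2, n.+1)) : nondegenerate V ->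
  (leb n.+1).-negligible [set x : E | simplex V x /\ ~ open_simplex V x].
Proof.
move=> nV; have uV : edges V \in unitmx by rewrite -row_free_unit.
apply: (@negligibleS _ _ _ _ [set x | exists j,
    bary ((x - row ord0 V) *m invmx (edges V)) ord0 j = 0]); last first.
  by apply: negligible_finite => j; apply: negligible_bary0; rewrite unitmx_inv.
move=> x [/simplexP[t ht xt] nx].
have tE : (x - row ord0 V) *m invmx (edges V) = t.
  by rewrite xt /simplex_param addrAC subrr add0r mulmxK.
apply: contrapT => hn; apply: nx; exists (bary t); split.
- move=> j; rewrite lt_neqAle bary_ge0 // andbT eq_sym; apply/eqP => bj.
  by apply: hn; exists j; rewrite /= tE.
- exact: bary_sum.
- by rewrite xt simplex_param_bary.
Qed.

Lemma negligible_face (V : 'M[R]_(n.+1, n.+1)) (nu : E) :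
  enorm nu = 1 -> edges V *m nu^T = 0 -> (leb n.+1).-negligible (simplex V).
Proof.
move=> nu1 Vnu.
apply: (@negligibleS _ _ _ _ [set x : E |
   \sum_j x ord0 j * nu ord0 j = mxdot (row ord0 V) nu]).
  by move=> x /(simplex_plane Vnu); rewrite mxdot_row.
apply/negligibleP.
  have := @continuous_measurable_row R n.+1 (fun y => \sum_j y ord0 j * nu ord0 j).
  move=> /(_ _ measurableT [set mxdot (row ord0 V) nu] (measurable_set1 _)).
  rewrite setTI; apply.
  by apply: cont_sum => j; apply: contM; [exact: continuous_coor|exact: contC].
apply: leb_hyperplane0; apply/existsP.
rewrite -[X in is_true X]negbK; apply/negP => /existsPn h.
have : mxdot nu nu = 0.
  by rewrite mxdot_row big1 // => j _; have /negPn/eqP -> := h j; rewrite mulr0.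
by rewrite -enorm_sqr nu1 expr1n => /eqP; rewrite oner_eq0.
Qed.

Lemma simplex_vol_ratio (C : R) (S : 'M[R]_(n.+2, n.+1)) (V : 'M[R]_(n.+1, n.+1)) :
  C * (n.+1%:R * simplex_vol S / simplex_vol V) = C * (gram S / gram V).
Proof.
rewrite /simplex_vol factS natrM; congr (_ * _).
have n1 : (n.+1%:R : R) != 0 by rewrite pnatr_eq0.
have nf : (n`!%:R : R) != 0 by rewrite pnatr_eq0 -lt0n fact_gt0.
have [->|V0] := eqVneq (gram V) 0; first by rewrite mul0r invr0 !mulr0.
move: (n.+1%:R) (n`!%:R) n1 nf => a b a0 b0; field.
by rewrite V0 a0 b0.
Qed.

(** Inverse trace inequality on an element: the simplices on the faces of a
    polytopic regular element do not overlap, so that the trace inequalities on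
    them add up. *)
Lemma element_trace l (C : R) : 0 < C -> exists2 K : R, 0 < K &
  forall (Om : set E) (M : polymesh Om), boxed Om -> polytopic_regular C M ->
  forall (k : elt M) (p : mpoly n.+1 R), (msize p <= l.+1)%N ->
  hdiam k * (\sum_(F | adj F k) intF F (fun x => peval p x ^+ 2))
  <= K * \int[leb n.+1]_(x in dom k) peval p x ^+ 2.
Proof.
move=> C0; have [K K0 hK] := @simplex_trace R n l.
exists (C * K); first exact: mulr_gt0.
move=> Om M bOm reg k p hp; have [S [hS dS]] := reg k.
pose f (x : E) := (peval p x ^+ 2)%:E : \bar R.
have cp2 : continuous (fun x : E => peval p x ^+ 2).
  by apply: contX; exact: continuous_peval.
have mf : measurable_fun setT f.
  by apply/measurable_EFinP; exact: continuous_measurable_row.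
have f0 x : (0 <= f x)%E by rewrite lee_fin sqr_ge0.
have mS F : measurable (simplex (S F)).
  exact: closed_measurable_row (@closed_simplex R _ _ (S F)).
have one F : adj F k -> ((hdiam k * intF F (fun x => peval p x ^+ 2))%:E <=
    (C * K)%:E * \int[leb n.+1]_(x in simplex (S F)) f x)%E.
  move=> Fk; have [SF nS _] := hS F Fk; rewrite simplex_vol_ratio => hh.
  have g0 : 0 < gram (fvert F).
    exact: gram_gt0 (normal_unit F) (normal_orthogonal F) (face_nondegenerate F).
  pose I := \int[leb n]_(t in @refsimplex R n) (peval p (simplex_param (fvert F) t) ^+ 2).
  have I0 : 0 <= I by apply: Rintegral_ge0 => t _; exact: sqr_ge0.
  have := hK (S F) nS p hp; rewrite SF => hF.
  apply: (@le_trans _ _ (C%:E * ((gram (S F))%:E * I%:E))%E).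
    rewrite -!EFinM lee_fin /intF /simplex_integral -/I mulrA mulrA.
    apply: ler_wpM2r => //; apply: le_trans (ler_wpM2r (ltW g0) hh) _.
    by rewrite -mulrA divfK // gt_eqF.
  rewrite EFinM -muleA; apply: lee_wpmul2l; first by rewrite lee_fin ltW.
  rewrite /I /Rintegral fineK //.
  apply: integrable_fin_num; first exact: measurable_refsimplex.
  apply: integrable_continuous_boxed; [exact: measurable_refsimplex|exact: boxed_refsimplex|].
  exact: continuous_simplex_param cp2.
have ae : {ae leb n.+1, forall x, [set: E] x ->
    (\sum_(F | adj F k) (f \_ (simplex (S F))) x <= (f \_ (dom k)) x)%E}.
  have n1 : (leb n.+1).-negligible [set x : E | exists F : face M,
      adj F k /\ simplex (S F) x /\ ~ open_simplex (S F) x].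
    apply: negligible_finite => F; have [Fk|Fk] := boolP (adj F k).
      have [_ nS _ _] := hS F Fk.
      by apply: negligibleS (negligible_simplex_rim nS) => x [].
    by apply: negligibleS (negligible_set0 _) => x [].
  have n2 : (leb n.+1).-negligible [set x : E | exists F : face M, simplex (fvert F) x].
    apply: negligible_finite => F.
    exact: negligible_face (normal_unit F) (normal_orthogonal F).
  apply: negligibleS (negligibleU n1 n2) => x /= hx.
  apply: contrapT => hn; apply: hx => _.
  have hopen F : adj F k -> simplex (S F) x -> open_simplex (S F) x.
    by move=> Fk Fx; apply: contrapT => nFx; apply: hn; left; exists F.
  have hdom F : adj F k -> simplex (S F) x -> dom k x.
    move=> Fk Fx; have [_ _ sub _] := hS F Fk; apply: contrapT => ndx; apply: hn; right.
    have : frontier (dom k) x by split; [exact: sub|move=> /interior_subset].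
    by rewrite dom_frontier => -[G _ Gx]; exists G.
  have [[F [Fk Fx]]|none] := pselect (exists F, adj F k /\ simplex (S F) x); last first.
    rewrite big1 ?patchE; first by case: ifP.
    by move=> F Fk; rewrite patchE memNset // => Fx; apply: none; exists F.
  rewrite (bigD1 F) //= big1 => [|G /andP[Gk GF]]; last first.
    rewrite patchE memNset // => Gx.
    have := dS F G Fk Gk; rewrite eq_sym => /(_ GF) /seteqP[/(_ x) + _]; apply.
    by split; apply: hopen.
  by rewrite adde0 !patchE !mem_set //; exact: hdom Fx.
have patch0 (A : set E) x : (0 <= (f \_ A) x)%E by rewrite patchE; case: ifP.
have mpatch (A : set E) : measurable A -> measurable_fun setT (f \_ A).
  by move=> mA; apply/measurable_restrict => //; apply: measurable_funTS.
have mdk := measurable_dom k.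
have : ((hdiam k * (\sum_(F | adj F k) intF F (fun x => peval p x ^+ 2)))%:E <=
    (C * K)%:E * \int[leb n.+1]_(x in dom k) f x)%E.
  rewrite mulr_sumr -sumEFin; apply: le_trans (lee_sum _ one) _.
  rewrite -ge0_sume_distrr; last by move=> F _; apply: integral_ge0.
  apply: lee_wpmul2l; first by rewrite lee_fin mulr_ge0 // ltW.
  rewrite [leRHS]integral_mkcond; under eq_bigr do rewrite integral_mkcond.
  rewrite -big_filter -ge0_integral_sum //; last by move=> F; exact: mpatch.
  apply: ae_ge0_le_integral => //.
  - by move=> x _; apply: sume_ge0.
  - by apply: emeasurable_sum => F; exact: mpatch.
  - exact: mpatch.
  by apply: filterS ae => x; rewrite big_filter.
rewrite -lee_fin => /le_trans; apply.
rewrite [leRHS]EFinM /Rintegral fineK //.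
by apply: integrable_fin_num => //; apply: integrable_continuous_boxed => //; exact: boxed_dom.
Qed.

End element_trace.

Section matrix_square_root.
Context {R : realType}.

Lemma interpolation (c : R -> R) (s : seq R) : uniq s ->
  exists r : {poly R}, forall x, x \in s -> r.[x] = c x.
Proof.
elim: s => [_|a s IH /= /andP[as_ us]]; first by exists 0.
have [r hr] := IH us.
pose g : {poly R} := \prod_(b <- s) ('X - b%:P).
have ga : g.[a] != 0 by rewrite -rootE root_prod_XsubC.
exists (r + ((c a - r.[a]) / g.[a]) *: g) => x; rewrite inE => /predU1P[->|xs].
  by rewrite hornerD hornerZ divfK // addrC subrK.
rewrite hornerD hornerZ hr //.
have -> : g.[x] = 0 by apply/eqP; rewrite -rootE root_prod_XsubC.
by rewrite mulr0 addr0.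
Qed.

Lemma trmx_horner_mx n (A : 'M[R]_n.+1) (p : {poly R}) : A^T = A ->
  (horner_mx A p)^T = horner_mx A p.
Proof.
move=> AT; elim/poly_ind: p => [|p c IH]; first by rewrite raddf0 trmx0.
rewrite rmorphD rmorphM /= horner_mx_X horner_mx_C linearD /= tr_scalar_mx.
congr (_ + _); rewrite -[RHS]/(horner_mx A p *m A) -[in LHS]/(horner_mx A p *m A).
rewrite trmx_mul AT IH.
have := congr1 (horner_mx A) (mulrC 'X p).
by rewrite !rmorphM /= horner_mx_X.
Qed.

Lemma mxsqrt_exists n (A : 'M[R]_n.+1) : A^T = A ->
  (forall x : 'rV[R]_n.+1, 0 <= mxdot x (mxapp A x)) ->
  exists B : 'M[R]_n.+1, [/\ B^T = B, forall x, 0 <= mxdot x (mxapp B x) & B *m B = A].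
Proof.
move=> AT A0.
pose toC := real_complex R.
pose A' := map_mx toC A.
have hA' : A' \is hermsymmx.
  apply: realsym_hermsym.
    apply/is_hermitianmxP; rewrite expr0 scale1r map_mx_id //.
    by apply/matrixP => a b; rewrite !mxE -[in LHS]AT mxE.
  apply/mxOverP => i j; rewrite mxE; apply/complex_realP; eexists; reflexivity.
have := hermitian_normalmx hA' => /orthomx_spectralP.
set P := spectralmx A'; set d := spectral_diag A' => AE.
have uP : P \in unitmx by exact: spectral_unit.
have [lam hlam] : exists lam : 'I_n.+1 -> R, forall j, d ord0 j = toC (lam j).
  have /mxOverP dr := hermitian_spectral_diag_real hA'.
  have /choice[lam hl] : forall j, exists x : R, d ord0 j = toC x.
    by move=> j; have /complex_realP[x ->] := dr ord0 j; exists x.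
  by exists lam.
have hd (p : {poly R}) : (forall j, p.[lam j] = 0) -> horner_mx A p = 0.
  move=> hp; apply: (map_mx_inj (f := toC)); rewrite map_mx0.
  rewrite map_horner_mx -/A' AE.
  rewrite horner_mx_uconjC // horner_mx_diag.
  have -> : map_mx (horner (map_poly toC p)) d = 0.
    by apply/rowP => j; rewrite !mxE hlam horner_map /= hp rmorph0.
  by rewrite linear0 mulmx0 mul0mx.
have lam0 j : 0 <= lam j.
  rewrite leNgt; apply/negP => lj.
  have uB : A - (lam j)%:M \in unitmx.
    rewrite -row_free_unit; apply/inj_row_free => x.
    rewrite mulmxBr mul_mx_scalar => /eqP; rewrite subr_eq0 => /eqP xA.
    have := A0 x; rewrite /mxapp AT xA mxdotZr => h.
    have x0 : mxdot x x = 0.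
      by apply/eqP; rewrite eq_le mxdot_ge0 andbT -(nmulr_rge0 _ lj).
    apply/rowP => k; rewrite mxE; apply/eqP; rewrite -normr_le0.
    by rewrite (le_trans (coor_le_enorm x k)) // /enorm x0 sqrtr0.
  have hv : row j P *m map_mx toC (A - (lam j)%:M) = 0.
    rewrite map_mxB map_scalar_mx -/A' -[X in X%:M]/(toC (lam j)) -hlam mulmxBr mul_mx_scalar -row_mul AE.
    rewrite !mulmxA mulmxV // mul1mx row_mul; apply/eqP; rewrite subr_eq0; apply/eqP.
    by rewrite row_diag_mx -scalemxAl -rowE.
  have : row j P = 0.
    have uBC : map_mx toC (A - (lam j)%:M) \in unitmx by rewrite map_unitmx.
    by rewrite -(mulmxK uBC (row j P)) hv mul0mx.
  move=> /(congr1 (mulmx^~ (invmx P))); rewrite mul0mx -row_mul mulmxV // => /rowP/(_ j).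
  by rewrite !mxE eqxx => /eqP; rewrite oner_eq0.
have [r hr] := @interpolation (fun x => Num.sqrt (Num.sqrt x))
  (undup [seq lam j | j <- enum 'I_n.+1]) (undup_uniq _).
have hrj j : r.[lam j] = Num.sqrt (Num.sqrt (lam j)).
  by apply: hr; rewrite mem_undup map_f ?mem_enum.
pose B0 := horner_mx A r.
have B0T : B0^T = B0 by exact: trmx_horner_mx.
exists (B0 *m B0); split.
- by rewrite trmx_mul B0T.
- move=> x; rewrite /mxapp trmx_mul B0T.
  have -> : mxdot x (x *m (B0 *m B0)) = mxdot (x *m B0) (x *m B0).
    have e : x *m (x *m (B0 *m B0))^T = (x *m B0) *m (x *m B0)^T.
      by rewrite !trmx_mul !B0T !mulmxA.
    have := congr1 (fun M : 'M[R]_1 => M ord0 ord0) e.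
    by rewrite !mxdot_mul !mxE !mulr1n.
  exact: mxdot_ge0.
have : horner_mx A (r ^+ 4 - 'X) = 0.
  apply: hd => j; rewrite hornerD hornerN hornerX horner_exp hrj.
  by rewrite (exprM _ 2 2) sqr_sqrtr ?sqrtr_ge0 // sqr_sqrtr ?subrr.
rewrite rmorphB /= horner_mx_X rmorphXn /= -/B0 => /eqP; rewrite subr_eq0 => /eqP <-.
by rewrite !exprS expr0 mulr1 -!mulmxE !mulmxA.
Qed.

Lemma mxsqrtP n (A : 'M[R]_n.+1) : A^T = A ->
  (forall x : 'rV[R]_n.+1, 0 <= mxdot x (mxapp A x)) ->
  [/\ (mxsqrt A)^T = mxsqrt A, forall x, 0 <= mxdot x (mxapp (mxsqrt A) x)
    & mxsqrt A *m mxsqrt A = A].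
Proof.
move=> AT A0; have [B hB] := mxsqrt_exists AT A0.
exact: (@getPex _ [set B : 'M[R]_n.+1 | [/\ B^T = B,
  forall x, 0 <= mxdot x (mxapp B x) & B *m B = A]] (ex_intro _ B hB)).
Qed.

End matrix_square_root.

Ltac cont := repeat first
  [ exact: continuous_peval | exact: contC | exact: continuous_coor
  | apply: contB | apply: contD | apply: contN | apply: contX | apply: contM
  | apply: cont_abs | apply: cont_sum => ? ].

Section almost_everywhere_monotonicity.
Context {R : realType} d {T : measurableType d} (mu : {measure set T -> \bar R}).

Lemma Rintegral_ae_ge0 (D : set T) (f : T -> R) : measurable D ->
  measurable_fun D (f : T -> measurableTypeR R) ->
  {ae mu, forall x, D x -> 0 <= f x} -> 0 <= \int[mu]_(x in D) f x.
Proof.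
move=> mD mf f0.
have -> : \int[mu]_(x in D) f x = \int[mu]_(x in D) `|f x|.
  congr fine; apply: ae_eq_integral => //.
  - exact/measurable_EFinP.
  - by apply/measurable_EFinP; exact: measurableT_comp.
  by apply: filterS f0 => x /= h Dx; rewrite ger0_norm // h.
by apply: Rintegral_ge0.
Qed.

Lemma le_Rintegral_ae (D : set T) (f g : T -> R) : measurable D ->
  mu.-integrable D (EFin \o f) -> mu.-integrable D (EFin \o g) ->
  {ae mu, forall x, D x -> f x <= g x} ->
  \int[mu]_(x in D) f x <= \int[mu]_(x in D) g x.
Proof.
move=> mD fi gi fg; rewrite -subr_ge0 -RintegralB //; apply: Rintegral_ae_ge0 => //.
  apply: measurable_funB; apply/measurable_EFinP; [exact: measurable_int gi|exact: measurable_int fi].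
by apply: filterS fg => x h Dx; rewrite subr_ge0 h.
Qed.

End almost_everywhere_monotonicity.

Section element_and_face_integrals.
Context {R : realType} {n : nat} {Om : set 'rV[R]_n.+1} (M : polymesh Om).
Hypothesis bOm : boxed Om.
Local Notation E := 'rV[R]_n.+1.
Implicit Types (k : elt M) (F : face M) (f g : E -> R).

Lemma integrable_dom k f : continuous f -> (leb n.+1).-integrable (dom k) (EFin \o f).
Proof.
move=> cf; apply: integrable_continuous_boxed => //; first exact: measurable_dom.
exact: boxed_dom.
Qed.

Lemma integrable_face F f : continuous f ->
  (leb n).-integrable (@refsimplex R n) (EFin \o (fun t => f (simplex_param (fvert F) t))).
Proof.
move=> cf; apply: integrable_continuous_boxed.
- exact: measurable_refsimplex.
- exact: boxed_refsimplex.
- exact: continuous_simplex_param.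
Qed.

Lemma intK_D k f g : continuous f -> continuous g ->
  \int[leb n.+1]_(x in dom k) (f x + g x) =
  \int[leb n.+1]_(x in dom k) f x + \int[leb n.+1]_(x in dom k) g x.
Proof.
by move=> cf cg; rewrite RintegralD //; [exact: measurable_dom|exact: integrable_dom..].
Qed.

Lemma intK_Z k (c : R) f : continuous f ->
  \int[leb n.+1]_(x in dom k) (c * f x) = c * \int[leb n.+1]_(x in dom k) f x.
Proof. by move=> cf; rewrite RintegralZl //; [exact: measurable_dom|exact: integrable_dom]. Qed.

Lemma intK_sum k (J : Type) (r : seq J) (f : J -> E -> R) : (forall j, continuous (f j)) ->
  \int[leb n.+1]_(x in dom k) (\sum_(j <- r) f j x) =
  \sum_(j <- r) \int[leb n.+1]_(x in dom k) f j x.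
Proof.
move=> cf; elim: r => [|j r IH].
  by rewrite big_nil Rintegral_eq0 // => x _; rewrite big_nil.
rewrite big_cons -IH -intK_D //; last by cont.
by apply: eq_Rintegral => x _; rewrite big_cons.
Qed.

Lemma intK_le_ae k f g : continuous f -> continuous g ->
  {ae leb n.+1, forall x, dom k x -> f x <= g x} ->
  \int[leb n.+1]_(x in dom k) f x <= \int[leb n.+1]_(x in dom k) g x.
Proof.
by move=> cf cg; apply: le_Rintegral_ae; [exact: measurable_dom|exact: integrable_dom..].
Qed.

Lemma intK_le k f g : continuous f -> continuous g ->
  (forall x, dom k x -> f x <= g x) ->
  \int[leb n.+1]_(x in dom k) f x <= \int[leb n.+1]_(x in dom k) g x.
Proof.
by move=> cf cg fg; apply: intK_le_ae => //; apply: aeW => x; exact: fg.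
Qed.

Lemma eq_intF F f g : f =1 g -> intF F f = intF F g.
Proof. by move=> fg; congr (intF F _); apply/funext. Qed.

Lemma intF_D F f g : continuous f -> continuous g ->
  intF F (fun x => f x + g x) = intF F f + intF F g.
Proof.
move=> cf cg; rewrite /intF /simplex_integral -mulrDr; congr (_ * _).
exact: (@RintegralD _ _ _ (leb n) _ _ _ (@measurable_refsimplex R n)
  (integrable_face F cf) (integrable_face F cg)).
Qed.

Lemma intF_Z F (c : R) f : continuous f -> intF F (fun x => c * f x) = c * intF F f.
Proof.
move=> cf; rewrite /intF /simplex_integral mulrCA; congr (_ * _).
exact: (@RintegralZl _ _ _ (leb n) _ _ _ (@measurable_refsimplex R n) (integrable_face F cf)).
Qed.

Lemma intF_B F f g : continuous f -> continuous g ->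
  intF F (fun x => f x - g x) = intF F f - intF F g.
Proof.
move=> cf cg; under eq_intF do rewrite -mulN1r.
by rewrite intF_D //; [rewrite intF_Z ?mulN1r|cont].
Qed.

Lemma intF_sum F (J : Type) (r : seq J) (P : pred J) (f : J -> E -> R) :
  (forall j, continuous (f j)) ->
  intF F (fun x => \sum_(j <- r | P j) f j x) = \sum_(j <- r | P j) intF F (f j).
Proof.
move=> cf; elim: r => [|j r IH].
  rewrite big_nil /intF /simplex_integral Rintegral_eq0 ?mulr0 // => x _.
  by rewrite big_nil.
rewrite big_cons -IH; case: ifPn => Pj.
  rewrite -intF_D //; last by cont.
  by apply: eq_intF => x; rewrite big_cons Pj.
by apply: eq_intF => x; rewrite big_cons (negPf Pj).
Qed.

Lemma intF_le_ae F f g : continuous f -> continuous g ->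
  {ae leb n, forall t, @refsimplex R n t ->
    f (simplex_param (fvert F) t) <= g (simplex_param (fvert F) t)} ->
  intF F f <= intF F g.
Proof.
move=> cf cg fg; rewrite /intF /simplex_integral ler_wpM2l ?sqrtr_ge0 //.
exact: (le_Rintegral_ae (@measurable_refsimplex R n) (integrable_face F cf)
  (integrable_face F cg) fg).
Qed.

Lemma intF_le F f g : continuous f -> continuous g ->
  (forall t, @refsimplex R n t ->
    f (simplex_param (fvert F) t) <= g (simplex_param (fvert F) t)) ->
  intF F f <= intF F g.
Proof.
by move=> cf cg fg; apply: intF_le_ae => //; apply: aeW => x; exact: fg.
Qed.

Lemma intF_ge0 F f : (forall x, 0 <= f x) -> 0 <= intF F f.
Proof. by move=> f0; rewrite mulr_ge0 ?sqrtr_ge0 // Rintegral_ge0. Qed.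

Lemma sum_sides F (V : nmodType) (G : elt M -> V) :
  \sum_(k | adj F k) G k =
  if kminus F is Some k' then G (kplus F) + G k' else G (kplus F).
Proof.
case hF: (kminus F) => [k'|].
  have kk' : k' != kplus F.
    by apply/eqP => e; have := face_two_elements F; rewrite hF e eqxx.
  rewrite (bigD1 (kplus F)) /= ?/adj ?eqxx //; congr (_ + _).
  rewrite (big_pred1 k') // => k; rewrite /adj hF.
  by have [->|] := eqVneq k (kplus F); rewrite ?andbT //= eq_sym (negPf kk').
by rewrite (big_pred1 (kplus F)) // => k; rewrite /adj hF orbF.
Qed.

Lemma exchange_sides (V : nmodType) (G : face M -> elt M -> V) :
  \sum_F \sum_(k | adj F k) G F k = \sum_k \sum_(F | adj F k) G F k.
Proof. exact: (exchange_big_dep xpredT). Qed.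

End element_and_face_integrals.

Section mesh_data.
Context {R : realType} {n : nat} {Om : set 'rV[R]_n.+1} (M : polymesh Om).
Hypothesis bOm : boxed Om.
Local Notation E := 'rV[R]_n.+1.
Implicit Types (k : elt M) (F : face M).

Lemma ae_on_dom k (P : E -> Prop) : ae_on Om P -> exists2 x, dom k x & P x.
Proof.
move=> [N [mN N0 hN]]; apply: contrapT => h.
have : (0 < leb n.+1 (dom k))%E.
  by apply: leb_open_gt0; [exact: dom_open|exact: dom_nonempty].
apply/negP; rewrite -leNgt -N0; apply: le_measure; [apply/mem_set|exact/mem_set|].
  exact: measurable_dom.
move=> x kx; apply: hN => /= hP; apply: h; exists x => //.
by apply: hP; exact: dom_sub kx.
Qed.

Lemma onelt_const (T : Type) (f : E -> T) k x : elementwise_constant M f ->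
  dom k x -> f x = onelt f k.
Proof.
move=> /(_ k)[c hc] kx; rewrite /onelt !hc //.
exact: getPex (dom_nonempty k).
Qed.

Lemma onelt_ae (T : Type) (f : E -> T) k (P : T -> Prop) :
  elementwise_constant M f -> ae_on Om (fun x => P (f x)) -> P (onelt f k).
Proof. by move=> cf /ae_on_dom-/(_ k)[x kx]; rewrite (onelt_const cf kx). Qed.

Lemma hdiam_gt0 k : 0 < hdiam k.
Proof.
have [x kx] := dom_nonempty k; have [e e0 he] := open_rowP (@dom_open _ _ _ M k) kx.
pose y : E := x + const_mx (e / 2).
have ky : dom k y.
  by apply: he => i; rewrite !mxE opprD addrA subrr sub0r normrN gtr0_norm
    ?divr_gt0 // ltr_pdivrMr // ltr_pMr // ltr1n.
have xy : 0 < enorm (y - x).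
  apply: lt_le_trans (coor_le_enorm _ ord0).
  by rewrite !mxE addrAC subrr add0r normr_gt0 gt_eqF // divr_gt0.
apply: (lt_le_trans xy); apply: sup_upper_bound; last by exists (y, x).
split; first by exists (enorm (y - x)), (y, x).
have [r hr] := boxed_dom bOm k.
exists (Num.sqrt (n.+1%:R * (r *+ 2) ^+ 2)) => _ [[a b] [/= ka kb] <-].
rewrite /enorm ler_wsqrtr // mxdot_row.
apply: le_trans (_ : \sum_(j < n.+1) (r *+ 2) ^+ 2 <= _).
  apply: ler_sum => j _; rewrite -expr2 -real_normK ?num_real // !mxE.
  rewrite lerXn2r ?nnegrE // ?(le_trans (ler_normB _ _)) //.
    by rewrite mulrn_wge0 // (le_trans _ (ltW (hr _ ka j))).
  by rewrite mulr2n lerD // ltW // hr.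
by rewrite sumr_const card_ord mulr_natl.
Qed.

Variable l : nat.
Hypothesis l1 : (1 <= l)%N.

Lemma l2h_ge F k : adj F k -> l%:R ^+ 2 / hdiam k <= l2h l F.
Proof.
rewrite /adj /l2h => /orP[/eqP->|/eqP <-]; last by rewrite le_max lexx orbT.
by case: (kminus F) => // k'; rewrite le_max lexx.
Qed.

Lemma l2h_gt0 F : 0 < l2h l F.
Proof.
apply: lt_le_trans (@l2h_ge F (kplus F) _); last by rewrite /adj eqxx.
by rewrite divr_gt0 ?hdiam_gt0 // exprn_gt0 // ltr0n.
Qed.

Lemma l2h_inv_le F k : adj F k -> (l2h l F)^-1 <= hdiam k.
Proof.
move=> Fk; rewrite -[leRHS]invrK lef_pV2 ?posrE ?invr_gt0 ?hdiam_gt0 ?l2h_gt0 //.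
apply: le_trans (l2h_ge Fk); rewrite -[leLHS]mul1r.
by apply: ler_wpM2r; [rewrite invr_ge0 ltW ?hdiam_gt0|rewrite exprn_ege1 // ler1n].
Qed.

(** On every face, the trace inequality weighted by the inverse of the penalty
    scale, which is at most the diameter of both neighbours. *)
Lemma weighted_trace (J : finType) (Kt : R) (q : elt M -> J -> mpoly n.+1 R) :
  0 <= Kt ->
  (forall k (p : mpoly n.+1 R), (msize p <= l.+1)%N ->
     hdiam k * (\sum_(F | adj F k) intF F (fun x => peval p x ^+ 2))
     <= Kt * \int[leb n.+1]_(x in dom k) peval p x ^+ 2) ->
  (forall k j, (msize (q k j) <= l.+1)%N) ->
  \sum_F (l2h l F)^-1 * \sum_(k | adj F k) intF F (fun x => \sum_j peval (q k j) x ^+ 2)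
  <= Kt * intE (fun k x => \sum_j peval (q k j) x ^+ 2).
Proof.
move=> Kt0 htr hq.
under eq_bigr do rewrite mulr_sumr.
rewrite exchange_sides mulr_sumr; apply: ler_sum => k _.
rewrite intK_sum //; last by move=> j; cont.
apply: (@le_trans _ _ (\sum_j hdiam k * \sum_(F | adj F k) intF F (fun x => peval (q k j) x ^+ 2))).
  rewrite -mulr_sumr exchange_big /= mulr_sumr; apply: ler_sum => F Fk.
  rewrite intF_sum; last by move=> j; cont.
  apply: ler_wpM2r; last exact: l2h_inv_le.
  by apply: sumr_ge0 => j _; apply: intF_ge0 => x; exact: sqr_ge0.
by rewrite mulr_sumr; apply: ler_sum => j _; exact: htr.
Qed.

(** Coercivity of a symmetric interior penalty form. The consistency terms
    [cross] are dominated, at each point of a face, by half of the penalty and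
    a small multiple of the energy densities [\sum_j (q k j)^2] of the adjacent
    elements; the trace inequality absorbs the latter into the volume energy. *)
Lemma penalty_coercive (J : finType) (Kt : R) (q : elt M -> J -> mpoly n.+1 R)
    (pen : face M -> R) (cross J2 : face M -> E -> R) : 0 < Kt ->
  (forall k (p : mpoly n.+1 R), (msize p <= l.+1)%N ->
     hdiam k * (\sum_(F | adj F k) intF F (fun x => peval p x ^+ 2))
     <= Kt * \int[leb n.+1]_(x in dom k) peval p x ^+ 2) ->
  (forall k j, (msize (q k j) <= l.+1)%N) ->
  (forall F, continuous (cross F)) -> (forall F, continuous (J2 F)) ->
  (forall F x, cross F x <= 2^-1 * (pen F * J2 F x) +
     ((Kt *+ 2) ^-1 * (l2h l F)^-1) * \sum_(k | adj F k) \sum_j peval (q k j) x ^+ 2) ->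
  2^-1 * (intE (fun k x => \sum_j peval (q k j) x ^+ 2)
          + \sum_F intF F (fun x => pen F * J2 F x))
  <= intE (fun k x => \sum_j peval (q k j) x ^+ 2)
     - \sum_F intF F (fun x => cross F x - pen F * J2 F x).
Proof.
move=> Kt0 htr hq ccr cJ hcr.
have cq F : continuous (fun x : E => \sum_(k | adj F k) \sum_j peval (q k j) x ^+ 2) by cont.
have := @weighted_trace J Kt q (ltW Kt0) htr hq.
set B := intE _; set W := \sum_F _ => hW.
have hF F : intF F (fun x => cross F x - pen F * J2 F x) <=
   (Kt *+ 2)^-1 * ((l2h l F)^-1 * \sum_(k | adj F k) intF F (fun x => \sum_j peval (q k j) x ^+ 2))
   - 2^-1 * intF F (fun x => pen F * J2 F x).
  rewrite -intF_sum; last by move=> k; cont.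
  rewrite mulrA -intF_Z // -intF_Z; last by cont.
  rewrite -intF_B; [|by cont..].
  apply: intF_le; [by cont|by cont|] => t _.
  by have := hcr F (simplex_param (fvert F) t); lra.
have : \sum_F intF F (fun x => cross F x - pen F * J2 F x) <=
    (Kt *+ 2)^-1 * W - 2^-1 * \sum_F intF F (fun x => pen F * J2 F x).
  by rewrite !mulr_sumr -sumrB; apply: ler_sum => F _; exact: hF.
have : (Kt *+ 2)^-1 * W <= 2^-1 * B.
  rewrite -(ler_pM2l (_ : 0 < Kt *+ 2)) ?pmulrn_lgt0 //.
  by rewrite mulrA divff ?mul1r ?gt_eqF ?pmulrn_lgt0 //; lra.
lra.
Qed.

End mesh_data.

Section traces.
Context {R : realType} {n : nat} {Om : set 'rV[R]_n.+1} (M : polymesh Om).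
Local Notation E := 'rV[R]_n.+1.
Implicit Types (k : elt M) (F : face M) (v : bpoly M).

Lemma young (c m P b : R) : 0 < c -> 0 <= P -> 0 <= b -> m ^+ 2 <= P * b ->
  2 * m <= c * P + c^-1 * b.
Proof.
move=> c0 P0 b0 hm; set X := c * P; set Y := c^-1 * b.
have X0 : 0 <= X by rewrite mulr_ge0 // ltW.
have Y0 : 0 <= Y by rewrite mulr_ge0 // invr_ge0 ltW.
have XY : m ^+ 2 <= X * Y by rewrite /X /Y mulrACA divff ?mul1r ?gt_eqF.
have : `|2 * m| <= `|X + Y|.
  rewrite -(@ler_pXn2r _ 2) ?nnegrE // !real_normK ?num_real //.
  by have := sqr_ge0 (X - Y); nra.
rewrite [X in _ <= X]ger0_norm ?addr_ge0 // => h.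
exact: le_trans (ler_norm _) h.
Qed.

Lemma harmonic_weight (a b : R) : 0 < a -> 0 < b ->
  (b / (a + b)) ^+ 2 * a <= a * b / (a + b).
Proof.
move=> a0 b0; have s0 : 0 < a + b by rewrite addr_gt0.
have -> : (b / (a + b)) ^+ 2 * a = (b / (a + b)) * (a * b / (a + b)).
  by field; rewrite gt_eqF.
apply: ler_piMl; last by rewrite ler_pdivrMr // mul1r lerDr ltW.
by apply: divr_ge0; [apply: mulr_ge0|]; exact: ltW.
Qed.

Lemma cont_mxdot (T : topologicalType) p q (A B : T -> 'M[R]_(p, q)) :
  (forall i j, continuous (fun x => A x i j)) ->
  (forall i j, continuous (fun x => B x i j)) ->
  continuous (fun x => mxdot (A x) (B x)).
Proof. by move=> cA cB; rewrite /mxdot; apply: cont_sum => i; apply: cont_sum => j; apply: contM. Qed.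

Lemma normal_sqr F : mxdot (normal F) (normal F) = 1.
Proof. by rewrite -enorm_sqr normal_unit expr1n. Qed.

Lemma peval0 (x : E) : peval 0 x = 0.
Proof. exact: meval0. Qed.

(** The two traces enter the jumps only through the polynomial [v^+ - v^-],
    read as [v^+] on the boundary. *)
Definition trj v F : mpoly n.+1 R :=
  v (kplus F) - (if kminus F is Some k' then v k' else 0).

Lemma jumpE v F x : jump (bval v) F x = peval (trj v F) x *: normal F.
Proof.
rewrite /jump /trj /bval pevalB scalerBl; case: (kminus F) => [k'|].
  by rewrite scalerN.
by rewrite peval0 scale0r subr0.
Qed.

Lemma vjumpE (v : bvpoly M) F x i j :
  vjump (bvval v) F x i j = peval (trj (v i) F) x * normal F ord0 j.
Proof.
rewrite /vjump /trj pevalB; case: (kminus F) => [k'|]; rewrite !mxE !big_ord1 !mxE.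
  by rewrite mulrN mulrBl.
by rewrite peval0 subr0.
Qed.

Lemma jump_sqr v F x :
  mxdot (jump (bval v) F x) (jump (bval v) F x) = peval (trj v F) x ^+ 2.
Proof. by rewrite jumpE mxdotZl mxdotZr normal_sqr mulr1 expr2. Qed.

Lemma cont_jump v F i j : continuous (fun x => jump (bval v) F x i j).
Proof. by under eq_fun do rewrite jumpE mxE; cont. Qed.

Lemma cont_vjump (v : bvpoly M) F i j : continuous (fun x => vjump (bvval v) F x i j).
Proof. by under eq_fun do rewrite vjumpE; cont. Qed.

Lemma cont_wavg p q w (a : elt M -> E -> 'M[R]_(p, q)) F i j :
  (forall k, continuous (fun x => a k x i j)) ->
  continuous (fun x => wavg w a F x i j).
Proof.
move=> ca; rewrite /wavg; case: (kminus F) => [k'|]; last exact: ca.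
by under eq_fun do rewrite !mxE; cont.
Qed.

Lemma mxapp_sqr q (S : 'M[R]_q) (x y : 'rV[R]_q) : S^T = S ->
  mxdot (mxapp (S *m S) x) y = mxdot (mxapp S x) (mxapp S y).
Proof.
move=> ST; rewrite /mxapp trmx_mul ST.
have e : (x *m (S *m S)) *m y^T = (x *m S) *m (y *m S)^T.
  by rewrite trmx_mul ST !mulmxA.
by have := congr1 (fun M : 'M[R]_1 => M ord0 ord0) e; rewrite !mxdot_mul !mxE !mulr1n.
Qed.

Lemma mxnorm2_ge q (S : 'M[R]_q) (x : 'rV[R]_q) : enorm x <= 1 ->
  enorm (mxapp S x) <= mxnorm2 S.
Proof.
move=> x1; apply: sup_upper_bound; last by exists x.
split; first by exists (enorm (mxapp S x)), x.
exists (Num.sqrt (mxdot S S)) => _ [y /= y1 <-]; rewrite /enorm ler_wsqrtr //.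
rewrite mxdot_row [leRHS]/mxdot; apply: ler_sum => j _.
have -> : mxapp S y ord0 j = \sum_i y ord0 i * S j i.
  by rewrite mxE; apply: eq_bigr => i _; rewrite mxE.
rewrite -expr2; apply: le_trans (sum_CS _ _) _.
under [leRHS]eq_bigr do rewrite -expr2.
rewrite -[leRHS]mul1r; apply: ler_pM => //; try by apply: sumr_ge0 => i _; exact: sqr_ge0.
under eq_bigr do rewrite expr2.
by rewrite -mxdot_row -enorm_sqr expr_le1 // enorm_ge0.
Qed.

End traces.

Section coercivity.
Context {R : realType} {n : nat} {Om : set 'rV[R]_n.+1} (M : polymesh Om).
Hypothesis bOm : boxed Om.
Variables (l : nat) (Kt : R).
Hypotheses (l1 : (1 <= l)%N) (Kt0 : 0 < Kt).
Hypothesis trace_ineq : forall (k : elt M) (p : mpoly n.+1 R), (msize p <= l.+1)%N ->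
  hdiam k * (\sum_(F | adj F k) intF F (fun x => peval p x ^+ 2))
  <= Kt * \int[leb n.+1]_(x in dom k) peval p x ^+ 2.
Local Notation E := 'rV[R]_n.+1.
Implicit Types (k : elt M) (F : face M) (v : bpoly M).

Let L0 F : 0 < l2h l F. Proof. exact: l2h_gt0. Qed.

Section diffusion.
Variables (A : E -> 'M[R]_n.+1) (hA : admissible_tensor M A).

Lemma onelt_sym k : (onelt A k)^T = onelt A k.
Proof. by have [cA hT _] := hA; exact: (@onelt_ae _ _ _ M _ A k (fun B => B^T = B)). Qed.

Lemma onelt_pos k : exists2 c : R, 0 < c &
  forall z : E, c * mxdot z z <= mxdot z (mxapp (onelt A k) z).
Proof.
have [cA _ [km [kM [km0 _ hb]]]] := hA; exists km => // z.
have := @onelt_ae _ _ _ M _ A k (fun B => forall z : E,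
   km * mxdot z z <= mxdot z (mxapp B z) <= kM * mxdot z z) cA hb.
by move=> /(_ z)/andP[].
Qed.

Let S k := mxsqrt (onelt A k).

Lemma onelt_sqrt k : (S k)^T = S k /\ S k *m S k = onelt A k.
Proof.
have [] // := mxsqrtP (onelt_sym k); move=> z.
have [c c0 hc] := onelt_pos k; apply: le_trans (hc z).
by rewrite mulr_ge0 ?mxdot_ge0 // ltW.
Qed.

Lemma mxdot_onelt k (x y : E) :
  mxdot (mxapp (onelt A k) x) y = mxdot (mxapp (S k) x) (mxapp (S k) y).
Proof. by have [ST <-] := onelt_sqrt k; exact: mxapp_sqr. Qed.

Lemma delta_gt0 F k : 0 < delta A F k.
Proof.
have [c c0 hc] := onelt_pos k; apply: lt_le_trans (hc (normal F)).
by rewrite normal_sqr mulr1.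
Qed.

Lemma deltaE F k : delta A F k = mxdot (mxapp (S k) (normal F)) (mxapp (S k) (normal F)).
Proof. by rewrite -mxdot_onelt mxdotC. Qed.

Lemma delta_le F k : delta A F k <= mxnorm2 (S k) ^+ 2.
Proof.
have h : enorm (mxapp (S k) (normal F)) <= mxnorm2 (S k).
  by apply: mxnorm2_ge; rewrite normal_unit.
by rewrite deltaE -enorm_sqr ler_pXn2r // nnegrE ?enorm_ge0 // (le_trans _ h) ?enorm_ge0.
Qed.

Lemma pen_t_ge0 al F : 0 <= al -> 0 <= pen_t al l A F.
Proof.
move=> al0; rewrite /pen_t; case: (kminus F) => [k'|].
  by rewrite !mulr_ge0 ?invr_ge0 ?addr_ge0 ?(ltW (delta_gt0 _ _)) ?(ltW (L0 _)).
by apply: mulr_ge0; [apply: mulr_ge0; [|exact: sqr_ge0]|exact: ltW].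
Qed.

Let q v k j : mpoly n.+1 R := \sum_i S k j i *: mderiv i (v k).

Let qE v k x j : peval (q v k j) x = mxapp (S k) (grad v k x) ord0 j.
Proof.
rewrite peval_sum mxE; apply: eq_bigr => i _.
by rewrite pevalZ !mxE mulrC.
Qed.

Let qS v k x : \sum_j peval (q v k j) x ^+ 2 = mxdot (mxapp (S k) (grad v k x)) (mxapp (S k) (grad v k x)).
Proof. by rewrite mxdot_row; apply: eq_bigr => j _; rewrite qE expr2. Qed.

Let mxdot_sqr_le k F v x : mxdot (mxapp (onelt A k) (grad v k x)) (normal F) ^+ 2
  <= delta A F k * \sum_j peval (q v k j) x ^+ 2.
Proof. by rewrite mxdot_onelt qS deltaE mulrC; exact: mxdot_CS. Qed.

Lemma form_diff_coercive al v : in_P l v -> Kt *+ 16 <= al ->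
  2^-1 * sq_dG_diff A (pen_t al l A) v <= form_diff A (pen_t al l A) v v.
Proof.
move=> vl hal; have al0 : 0 <= al by apply: le_trans hal; rewrite mulrn_wge0 // ltW.
have [cA _ _] := hA.
set pen := pen_t al l A.
pose flux k x := mxapp (onelt A k) (grad v k x).
pose W F x := wavg (omega_t A) flux F x.
pose J F x := jump (bval v) F x.
have cflux k j : continuous (fun x => flux k x ord0 j).
  under eq_fun do rewrite mxE; apply: cont_sum => i; apply: contM; last exact: contC.
  by under eq_fun do rewrite mxE; cont.
have cW F i j : continuous (fun x => W F x i j).
  by apply: cont_wavg => k; rewrite (ord1 i); exact: cflux.
have cJ F i j : continuous (fun x => J F x i j) by exact: cont_jump.
have := @penalty_coercive _ _ _ M bOm l l1 _ Kt (q v) pen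
  (fun F x => mxdot (W F x) (J F x) + mxdot (J F x) (W F x))
  (fun F x => mxdot (J F x) (J F x)) Kt0 trace_ineq.
have -> : form_diff A pen v v = intE (fun k x => \sum_j peval (q v k j) x ^+ 2) -
    \sum_F intF F (fun x => mxdot (W F x) (J F x) + mxdot (J F x) (W F x) - pen F * mxdot (J F x) (J F x)).
  congr (_ - _); apply: eq_bigr => k _; apply: eq_Rintegral => x /set_mem kx.
  by rewrite qS (onelt_const cA kx) mxdot_onelt.
have -> : sq_dG_diff A pen v = intE (fun k x => \sum_j peval (q v k j) x ^+ 2) +
    \sum_F intF F (fun x => pen F * mxdot (J F x) (J F x)).
  congr (_ + _).
    apply: eq_bigr => k _; apply: eq_Rintegral => x /set_mem kx.
    by rewrite qS (onelt_const cA kx) enorm_sqr.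
  apply: eq_bigr => F _; apply: eq_intF => x.
  by rewrite enorm_sqr mxdotZl mxdotZr mulrA -expr2 sqr_sqrtr ?pen_t_ge0.
apply.
- by move=> k j; apply: msize_lincomb => i; apply: msize_mderiv; exact: vl.
- by move=> F; apply: contD; apply: cont_mxdot.
- by move=> F; apply: cont_mxdot.
move=> F x; rewrite [X in _ + X <= _]mxdotC -mulr2n -mulr_natl.
rewrite sum_sides /J jump_sqr jumpE /W /wavg /pen /pen_t.
set t := peval (trj v F) x.
have t2 : 0 <= t ^+ 2 by exact: sqr_ge0.
have c0 : 0 < Kt *+ 2 * l2h l F by rewrite mulr_gt0 ?pmulrn_lgt0.
have b0 k : 0 <= \sum_j peval (q v k j) x ^+ 2 by apply: sumr_ge0 => j _; exact: sqr_ge0.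
rewrite -invfM mxdotZr.
have side (w P : R) k : 0 <= P -> w ^+ 2 * delta A F k <= P ->
    2 * (w * (t * mxdot (flux k x) (normal F))) <=
    Kt *+ 2 * l2h l F * (P * t ^+ 2) + (Kt *+ 2 * l2h l F)^-1 * \sum_j peval (q v k j) x ^+ 2.
  move=> P0 hw; apply: young => //; first exact: mulr_ge0.
  have -> : (w * (t * mxdot (flux k x) (normal F))) ^+ 2 =
    t ^+ 2 * w ^+ 2 * mxdot (flux k x) (normal F) ^+ 2 by ring.
  apply: le_trans (ler_wpM2l _ (mxdot_sqr_le k F v x)) _.
    by rewrite mulr_ge0 ?sqr_ge0.
  rewrite mulrA; apply: ler_wpM2r => //.
  by rewrite -mulrA mulrC; apply: ler_wpM2r.
case hF: (kminus F) => [k'|].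
- set k := kplus F; set g := gamma_t A F k k'.
  have g0 : 0 <= g by rewrite !mulr_ge0 ?invr_ge0 ?addr_ge0 ?(ltW (delta_gt0 _ _)).
  have h1 := side (omega_t A F k k') g k g0 (harmonic_weight (delta_gt0 F k) (delta_gt0 F k')).
  have gC : g = delta A F k' * delta A F k / (delta A F k' + delta A F k).
    by rewrite /g /gamma_t mulrC [delta A F k + _]addrC [delta A F k * _]mulrC mulrC.
  have := side (omega_t A F k' k) g k' g0.
  rewrite {1}gC => /(_ (harmonic_weight (delta_gt0 F k') (delta_gt0 F k))).
  have hl : Kt *+ 16 * (g * l2h l F * t ^+ 2) <= al * (g * l2h l F * t ^+ 2).
    by apply: ler_wpM2r => //; apply: mulr_ge0 => //; apply: mulr_ge0 => //; exact: ltW.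
  have gLt : 0 <= Kt * (g * l2h l F * t ^+ 2).
    by apply: mulr_ge0; [exact: ltW|apply: mulr_ge0 => //; apply: mulr_ge0 => //; exact: ltW].
  rewrite mxdotDl !mxdotZl.
  move: h1 hl gLt; lra.
- have := side 1 (delta A F (kplus F)) (kplus F) (ltW (delta_gt0 _ _)).
  rewrite expr1n mul1r => /(_ (lexx _)); set k := kplus F.
  have hN : Kt *+ 2 * (delta A F k * l2h l F * t ^+ 2) <= Kt *+ 2 * (mxnorm2 (S k) ^+ 2 * l2h l F * t ^+ 2).
    apply: ler_wpM2l; first by rewrite mulrn_wge0 // ltW.
    by apply: ler_wpM2r => //; apply: ler_wpM2r; [exact: ltW|exact: delta_le].
  have NLt : 0 <= mxnorm2 (S k) ^+ 2 * l2h l F * t ^+ 2.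
    by apply: mulr_ge0 => //; apply: mulr_ge0; [exact: sqr_ge0|exact: ltW].
  have hl : Kt *+ 16 * (mxnorm2 (S k) ^+ 2 * l2h l F * t ^+ 2)
      <= al * (mxnorm2 (S k) ^+ 2 * l2h l F * t ^+ 2) by apply: ler_wpM2r.
  have gLt := mulr_ge0 (ltW Kt0) NLt.
  move: hN hl gLt; rewrite -/(S k); lra.
Qed.

End diffusion.
End coercivity.

Lemma mxdot_scale_sqrt (R : realType) p q (c : R) (A : 'M[R]_(p, q)) : 0 <= c ->
  mxdot (Num.sqrt c *: A) (Num.sqrt c *: A) = c * mxdot A A.
Proof. by move=> c0; rewrite mxdotZl mxdotZr mulrA -expr2 sqr_sqrtr. Qed.

Section elasticity.
Context {R : realType} {n : nat} {Om : set 'rV[R]_n.+1} (M : polymesh Om).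
Hypothesis bOm : boxed Om.
Variables (l : nat) (Kt : R).
Hypotheses (l1 : (1 <= l)%N) (Kt0 : 0 < Kt).
Hypothesis trace_ineq : forall (k : elt M) (p : mpoly n.+1 R), (msize p <= l.+1)%N ->
  hdiam k * (\sum_(F | adj F k) intF F (fun x => peval p x ^+ 2))
  <= Kt * \int[leb n.+1]_(x in dom k) peval p x ^+ 2.
Local Notation E := 'rV[R]_n.+1.
Implicit Types (k : elt M) (F : face M) (v : bvpoly M).
Variables (cs : coefficients R n) (mu_m : R).
Hypotheses (mu_m0 : 0 < mu_m) (cmu : elementwise_constant M (mu cs)).
Hypothesis mu_ge : ae_on Om (fun x => mu_m <= mu cs x).

Let L0 F : 0 < l2h l F. Proof. exact: l2h_gt0. Qed.
Let m k := onelt (mu cs) k.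

Lemma onelt_mu_ge k : mu_m <= m k.
Proof. exact: (@onelt_ae _ _ _ M _ (mu cs) k (fun c => mu_m <= c)). Qed.

Let m0 k : 0 < m k. Proof. exact: lt_le_trans (onelt_mu_ge k). Qed.

Lemma pen_s_gt0 al F : 0 < al -> 0 < pen_s al l (mu cs) F.
Proof.
move=> al0; rewrite /pen_s /gamma_s -/(m _); case: (kminus F) => [k'|]; last first.
  by rewrite !mulr_gt0 ?m0.
by rewrite -/(m _) !mulr_gt0 ?invr_gt0 ?addr_gt0 ?m0.
Qed.

Lemma pen_s_ge al F : 0 < al -> al * (mu_m / 2) * l2h l F <= pen_s al l (mu cs) F.
Proof.
move=> al0; rewrite /pen_s /gamma_s -/(m _).
have := onelt_mu_ge (kplus F); have := m0 (kplus F); case: (kminus F) => [k'|] m1 m2.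
  have := onelt_mu_ge k'; have := m0 k' => m3 m4.
  apply: ler_wpM2r; first exact: ltW.
  apply: ler_wpM2l; first exact: ltW.
  rewrite -/(m k') ler_pdivlMr ?addr_gt0 //.
  by have := ler_pM (ltW mu_m0) (ltW mu_m0) m2 m4; nra.
apply: ler_wpM2r; first exact: ltW.
by apply: ler_wpM2l; [exact: ltW|lra].
Qed.

Let q v k (z : 'I_n.+1 * 'I_n.+1) : mpoly n.+1 R :=
  (Num.sqrt (2 * m k) / 2) *: (mderiv z.2 (v z.1 k) + mderiv z.1 (v z.2 k)).

Lemma epsE v k x i j :
  eps v k x i j = 2^-1 * (peval (mderiv j (v i k)) x + peval (mderiv i (v j k)) x).
Proof. by rewrite !mxE. Qed.

Let qS v k x : \sum_z peval (q v k z) x ^+ 2 = 2 * m k * mxdot (eps v k x) (eps v k x).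
Proof.
rewrite mxdotE mulr_sumr; apply: eq_bigr => z _.
rewrite pevalZ pevalD epsE -[X in X ^+ 2]mulrA exprMn sqr_sqrtr ?expr2 //.
by rewrite mulr_ge0 // ltW.
Qed.

Lemma cont_eps v k i j : continuous (fun x => eps v k x i j).
Proof. by under eq_fun do rewrite epsE; cont. Qed.

Lemma form_Ae_coercive (al : penalties R) v : in_Pv l v -> Kt *+ 16 <= al3 al ->
  2^-1 * sq_dGe l cs al v <= form_Ae l cs al v v.
Proof.
move=> vl hal; have al0 : 0 < al3 al by apply: lt_le_trans hal; rewrite pmulrn_lgt0.
pose pen : face M -> R := pen_s (al3 al) l (mu cs).
pose flux k x := (2 * m k) *: eps v k x.
pose W F x := wavg (omega_s (mu cs)) flux F x.
pose J F x := vjump (bvval v) F x.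
have cflux k i j : continuous (fun x => flux k x i j).
  by under eq_fun do rewrite mxE; apply: contM; [exact: contC|exact: cont_eps].
have cW F i j : continuous (fun x => W F x i j) by apply: cont_wavg => k.
have cJ F i j : continuous (fun x => J F x i j) by exact: cont_vjump.
have := @penalty_coercive _ _ _ M bOm l l1 _ Kt (q v) pen
  (fun F x => mxdot (W F x) (J F x) + mxdot (J F x) (W F x))
  (fun F x => mxdot (J F x) (J F x)) Kt0 trace_ineq.
have -> : form_Ae l cs al v v = intE (fun k x => \sum_z peval (q v k z) x ^+ 2) -
    \sum_F intF F (fun x => mxdot (W F x) (J F x) + mxdot (J F x) (W F x) - pen F * mxdot (J F x) (J F x)).
  congr (_ - _); apply: eq_bigr => k _; apply: eq_Rintegral => x /set_mem kx.
  by rewrite qS (onelt_const cmu kx) mxdotZl.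
have -> : sq_dGe l cs al v = intE (fun k x => \sum_z peval (q v k z) x ^+ 2) +
    \sum_F intF F (fun x => pen F * mxdot (J F x) (J F x)).
  congr (_ + _).
    apply: eq_bigr => k _; apply: eq_Rintegral => x /set_mem kx.
    rewrite qS (onelt_const cmu kx); cbv zeta; rewrite mxdot_scale_sqrt //.
    by rewrite mulr_ge0 // ltW.
  apply: eq_bigr => F _; apply: eq_intF => x.
  by cbv zeta; rewrite mxdot_scale_sqrt // ltW ?pen_s_gt0.
apply.
- move=> k z; rewrite (leq_trans (msizeZ_le _ _)) // (leq_trans (msizeD_le _ _)) //.
  by rewrite geq_max !msize_mderiv // vl.
- by move=> F; apply: contD; apply: cont_mxdot.
- by move=> F; apply: cont_mxdot.
move=> F x; rewrite [X in _ + X <= _]mxdotC -[X in X <= _]mulr2n -[X in X <= _]mulr_natl.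
rewrite sum_sides /W /wavg /pen /pen_s.
set t := mxdot (J F x) (J F x).
have t2 : 0 <= t by exact: mxdot_ge0.
have c0 : 0 < Kt *+ 2 * l2h l F by rewrite mulr_gt0 ?pmulrn_lgt0.
have b0 k : 0 <= \sum_j peval (q v k j) x ^+ 2 by apply: sumr_ge0 => j _; exact: sqr_ge0.
rewrite -[X in _ <= _ + X * _]invfM.
have side (w P : R) k : 0 <= P -> w ^+ 2 * m k <= P ->
    2 * (w * mxdot (flux k x) (J F x)) <=
    Kt *+ 2 * l2h l F * (2 * P * t) + (Kt *+ 2 * l2h l F)^-1 * \sum_j peval (q v k j) x ^+ 2.
  move=> P0 hw; apply: young => //; first by apply: mulr_ge0 => //; exact: mulr_ge0.
  rewrite qS /flux mxdotZl.
  have -> : (w * (2 * m k * mxdot (eps v k x) (J F x))) ^+ 2 =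
    (w ^+ 2 * m k) * (4 * m k * mxdot (eps v k x) (J F x) ^+ 2) by ring.
  have -> : 2 * P * t * (2 * m k * mxdot (eps v k x) (eps v k x)) =
    P * (4 * m k * (mxdot (eps v k x) (eps v k x) * t)) by ring.
  have h : 0 <= 4 * m k by rewrite mulr_ge0 // ltW.
  apply: ler_pM => //.
  - by rewrite mulr_ge0 ?sqr_ge0 // ltW.
  - by apply: mulr_ge0 => //; exact: sqr_ge0.
  - by apply: ler_wpM2l => //; exact: mxdot_CS.
case hF: (kminus F) => [k'|].
- set k := kplus F; set g := gamma_s (mu cs) k k'.
  have g0 : 0 <= g by rewrite /g /gamma_s -!/(m _) !mulr_ge0 ?invr_ge0 ?addr_ge0 ?(ltW (m0 _)).
  have h1 := side (omega_s (mu cs) F k k') g k g0 (harmonic_weight (m0 k) (m0 k')).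
  have gC : g = m k' * m k / (m k' + m k).
    by rewrite /g /gamma_s mulrC [_ + onelt (mu cs) k']addrC [_ * onelt (mu cs) k']mulrC mulrC.
  have := side (omega_s (mu cs) F k' k) g k' g0.
  rewrite {1}gC => /(_ (harmonic_weight (m0 k') (m0 k))).
  have gLt : 0 <= g * l2h l F * t.
    by apply: mulr_ge0 => //; apply: mulr_ge0 => //; exact: ltW.
  have hl : Kt *+ 16 * (g * l2h l F * t) <= al3 al * (g * l2h l F * t) by apply: ler_wpM2r.
  rewrite mxdotDl (mxdotZl _ (flux k x)) (mxdotZl _ (flux k' x)).
  move: h1 hl; lra.
- have := side 1 (m (kplus F)) (kplus F) (ltW (m0 _)).
  rewrite expr1n mul1r => /(_ (lexx _)); set k := kplus F.
  have mLt : 0 <= m k * l2h l F * t.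
    by apply: mulr_ge0 => //; apply: mulr_ge0; exact: ltW.
  have hl : Kt *+ 16 * (m k * l2h l F * t) <= al3 al * (m k * l2h l F * t) by apply: ler_wpM2r.
  have gLt := mulr_ge0 (ltW Kt0) mLt.
  move: hl gLt; rewrite -/(m k); lra.
Qed.

End elasticity.

Section convection.
Context {R : realType} {n : nat} {Om : set 'rV[R]_n.+1} (M : polymesh Om).
Hypothesis bOm : boxed Om.
Variables (l : nat) (Kt : R).
Hypotheses (l1 : (1 <= l)%N) (Kt0 : 0 < Kt).
Hypothesis trace_ineq : forall (k : elt M) (p : mpoly n.+1 R), (msize p <= l.+1)%N ->
  hdiam k * (\sum_(F | adj F k) intF F (fun x => peval p x ^+ 2))
  <= Kt * \int[leb n.+1]_(x in dom k) peval p x ^+ 2.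
Local Notation E := 'rV[R]_n.+1.
Implicit Types (k : elt M) (F : face M) (v : bpoly M) (eta : bvpoly M).

Lemma Linfty_ge0 q (D : set 'rV[R]_q) f : (0 <= Linfty D f)%E.
Proof. exact: Lnorm_ge0. Qed.

Lemma Linfty_ae q (D : set 'rV[R]_q) (f : 'rV[R]_q -> R) (c : R) :
  (Linfty D f <= c%:E)%E -> {ae leb q, forall x, D x -> `|f x| <= c}.
Proof.
rewrite /Linfty unlock; case: ifPn => [_ /ess_supP|].
  by apply: filterS => x /= + Dx; rewrite indicE mem_set // mulr1 lee_fin.
rewrite -leNgt => h _; exists setT; split => //.
by apply/eqP; rewrite eq_le h measure_ge0.
Qed.

Lemma dG_infty_ae eta (B : R) : (dG_infty l eta <= B%:E)%E ->
  (forall k, {ae leb n.+1, forall x, dom k x -> `|divg eta k x| <= B}) /\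
  (forall F, {ae leb n, forall t, @refsimplex R n t ->
     `|njump (bvval eta) F (simplex_param (fvert F) t)| <= (l2h l F)^-1 * B}).
Proof.
rewrite /dG_infty; set a := (\big[maxe/0]_(k : elt M) _)%E; set b := (\big[maxe/0]_(F : face M) _)%E => hab.
have a0 : (0 <= a)%E by exact: bigmax_ge_id.
have b0 : (0 <= b)%E by exact: bigmax_ge_id.
split => [k|F].
  apply: Linfty_ae; apply: (@le_trans _ _ a); last by rewrite (le_trans _ hab) // leeDl.
  exact: (le_bigmax _ (fun k => Linfty (dom k) (divg eta k)) k).
apply: (@Linfty_ae n (@refsimplex R n)).
rewrite EFinM -lee_pdivrMl ?invr_gt0 ?l2h_gt0 // invrK.
apply: (@le_trans _ _ b); last by rewrite (le_trans _ hab) // leeDr.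
exact: (le_bigmax _ (fun F => ((l2h l F)%:E * simplex_Linfty (fvert F) (njump (bvval eta) F))%E) F).
Qed.

Lemma cont_bvval eta k (y : E) : continuous (fun x => mxdot (bvval eta k x) y).
Proof. by under eq_fun => x do rewrite mxdot_row; apply: cont_sum => i; under eq_fun do rewrite mxE; cont. Qed.

(** The element-wise divergence theorem for [eta T^2]. *)
Lemma convection_by_parts eta v k :
  \int[leb n.+1]_(x in dom k) (mxdot (bvval eta k x) (grad v k x) * bval v k x) =
  2^-1 * (\sum_(F | adj F k) sgnF F k *
             intF F (fun x => mxdot (bvval eta k x) (normal F) * bval v k x ^+ 2)
          - \int[leb n.+1]_(x in dom k) (divg eta k x * bval v k x ^+ 2)).
Proof.
pose p i : mpoly n.+1 R := eta i k * (v k * v k).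
have cd : continuous (fun x : E => divg eta k x * bval v k x ^+ 2) by rewrite /divg /bval; cont.
have cg : continuous (fun x : E => mxdot (bvval eta k x) (grad v k x) * bval v k x).
  apply: contM; last exact: continuous_peval.
  by apply: cont_mxdot => i j; under eq_fun do rewrite mxE; cont.
have -> : \sum_(F | adj F k) sgnF F k *
     intF F (fun x => mxdot (bvval eta k x) (normal F) * bval v k x ^+ 2) =
   \sum_i \int[leb n.+1]_(x in dom k) peval (mderiv i (p i)) x.
  under [RHS]eq_bigr do rewrite (divergence_dom bOm).
  rewrite exchange_big /=; apply: eq_bigr => F _.
  rewrite -mulr_sumr; congr (_ * _); rewrite -intF_sum; last by move=> i; cont.
  apply: eq_intF => x; rewrite mxdot_row mulr_suml; apply: eq_bigr => i _.
  by rewrite !pevalM mxE /bval; ring.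
rewrite -(intK_sum bOm); last by move=> i; cont.
have -> : \int[leb n.+1]_(x in dom k) (\sum_i peval (mderiv i (p i)) x) =
  \int[leb n.+1]_(x in dom k) (divg eta k x * bval v k x ^+ 2 +
      2 * (mxdot (bvval eta k x) (grad v k x) * bval v k x)).
  apply: eq_Rintegral => x _; rewrite mxdot_row /divg !mulr_suml mulr_sumr -big_split.
  apply: eq_bigr => i _; rewrite !mderivM !(pevalD, pevalM) !mxE /bval /=; ring.
have cg2 : continuous (fun x : E => 2 * (mxdot (bvval eta k x) (grad v k x) * bval v k x)).
  by apply: contM => //; exact: contC.
rewrite (intK_D bOm k cd cg2) (intK_Z bOm k 2 cg); lra.
Qed.

Lemma form_C_ge eta v (B : R) : in_P l v -> (dG_infty l eta <= B%:E)%E ->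
  - ((1 + Kt) * B * sqL2 v) <= form_C eta v v.
Proof.
move=> vl hB; have [hdiv hjump] := dG_infty_ae hB.
pose en k F (x : E) := mxdot (bvval eta k x) (normal F).
have cen k F : continuous (en k F) by exact: cont_bvval.
have cbv k i j : continuous (fun x => bvval eta k x i j).
  by under eq_fun do rewrite mxE; cont.
have cv k : continuous (bval v k) by exact: continuous_peval.
have B0 : 0 <= B by rewrite -lee_fin; apply: le_trans hB; rewrite adde_ge0 // bigmax_ge_id.
have tr := @weighted_trace _ _ _ M bOm l l1 'I_1 Kt (fun k _ => v k) (ltW Kt0) trace_ineq
  (fun k _ => vl k).
have trE : intE (fun k x => \sum_(j < 1) peval (v k) x ^+ 2) = sqL2 v.
  by apply: eq_bigr => k _; apply: eq_Rintegral => x _; rewrite big_ord1.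
rewrite trE in tr.
pose ef F := \sum_(k | adj F k) sgnF F k * intF F (fun x => en k F x * bval v k x ^+ 2).
pose g1 F := intF F (fun x => mxdot (avg (bvval eta) F x) (jump (bval v) F x) * savg (bval v) F x).
pose g2 F := intF F (fun x => `|mxdot (avg (bvval eta) F x) (normal F)| / 2
      * mxdot (jump (bval v) F x) (jump (bval v) F x)).
pose g3 F := intF F (fun x => let e := en (kplus F) F x in
      2^-1 * (`|e| - e) * bval v (kplus F) x * bval v (kplus F) x).
have hface F : - (2^-1 * B * ((l2h l F)^-1 * \sum_(k | adj F k)
      intF F (fun x => \sum_(j < 1) peval (v k) x ^+ 2))) <=
    2^-1 * ef F + (if kminus F then g2 F - g1 F else g3 F).
  have cs2 k : continuous (fun x => bval v k x ^+ 2) by apply: contX.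
  have ces k : continuous (fun x => en k F x * bval v k x ^+ 2) by apply: contM.
  have s0 k : 0 <= intF F (fun x => \sum_(j < 1) peval (v k) x ^+ 2).
    by apply: intF_ge0 => x; rewrite big_ord1 sqr_ge0.
  have L0 : 0 <= (l2h l F)^-1 by rewrite invr_ge0 ltW // l2h_gt0.
  have := hjump F; rewrite /ef /g1 /g2 /g3 !sum_sides.
  have sE k : intF F (fun x => \sum_(j < 1) peval (v k) x ^+ 2) = intF F (fun x => bval v k x ^+ 2).
    by apply: eq_intF => x; rewrite big_ord1.
  set k := kplus F; case hF: (kminus F) => [k'|] hj; last first.
    have ce : continuous (fun x => 2^-1 * (`|en k F x| - en k F x) * bval v k x * bval v k x).
      by cont; first [exact: cen | exact: cv | exact: cbv].
    have ch : continuous (fun x => 2^-1 * (en k F x * bval v k x ^+ 2)).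
      by apply: contM => //; exact: contC.
    rewrite sE /sgnF eqxx mul1r -(intF_Z F 2^-1 (ces k)) -(intF_D F ch ce).
    apply: (@le_trans _ _ 0).
      rewrite oppr_le0; apply: mulr_ge0; first exact: mulr_ge0.
      by apply: mulr_ge0 => //; rewrite -sE.
    apply: intF_ge0 => x.
    have := normr_ge0 (en k F x); have := sqr_ge0 (bval v k x).
    rewrite expr2; set a := `|_|; move=> h1 h2; have := mulr_ge0 h2 h1; lra.
  have kk' : k' != k.
    by apply/eqP => e; have := face_two_elements F; rewrite hF e eqxx.
  rewrite !sE /sgnF eqxx (negPf kk') mul1r mulN1r.
  have EV x : mxdot (avg (bvval eta) F x) (normal F) = 2^-1 * en k F x + 2^-1 * en k' F x.
    by rewrite /avg /wavg hF mxdotDl !mxdotZl.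
  have JV x : peval (trj v F) x = bval v k x - bval v k' x by rewrite /trj hF pevalB.
  have SV x : savg (bval v) F x = 2^-1 * bval v k x + 2^-1 * bval v k' x.
    by rewrite /savg /avg /wavg hF.
  have NV x : njump (bvval eta) F x = en k F x - en k' F x.
    by rewrite /njump hF mxdotNr.
  have -> : intF F (fun x => mxdot (avg (bvval eta) F x) (jump (bval v) F x) * savg (bval v) F x)
    = intF F (fun x => 4^-1 * (en k F x + en k' F x) * (bval v k x ^+ 2 - bval v k' x ^+ 2)).
    by apply: eq_intF => x; rewrite jumpE mxdotZr EV JV SV; lra.
  have hg2 : 0 <= intF F (fun x => `|mxdot (avg (bvval eta) F x) (normal F)| / 2 *
      mxdot (jump (bval v) F x) (jump (bval v) F x)).
    by apply: intF_ge0 => x; rewrite jump_sqr; apply: mulr_ge0; [rewrite divr_ge0|exact: sqr_ge0].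
  have c1 : continuous (fun x => 4^-1 * (en k F x + en k' F x) * (bval v k x ^+ 2 - bval v k' x ^+ 2)).
    by cont; first [exact: cen | exact: cv | exact: cbv].
  have c2 : continuous (fun x => en k F x * bval v k x ^+ 2 - en k' F x * bval v k' x ^+ 2).
    exact: contB.
  have c3 : continuous (fun x => 2^-1 * (en k F x * bval v k x ^+ 2 - en k' F x * bval v k' x ^+ 2)).
    by apply: contM => //; exact: contC.
  have c4 : continuous (fun x => - (2^-1 * B * (l2h l F)^-1) * (bval v k x ^+ 2 + bval v k' x ^+ 2)).
    by apply: contM; [exact: contC|exact: contD].
  suff : intF F (fun x => - (2^-1 * B * (l2h l F)^-1) * (bval v k x ^+ 2 + bval v k' x ^+ 2)) <=
     intF F (fun x => 2^-1 * (en k F x * bval v k x ^+ 2 - en k' F x * bval v k' x ^+ 2)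
       - 4^-1 * (en k F x + en k' F x) * (bval v k x ^+ 2 - bval v k' x ^+ 2)).
    rewrite intF_Z; last exact: contD.
    by rewrite (intF_B F c3 c1) (intF_Z F _ c2) intF_B // intF_D //; cbv [isSome]; move: hg2; lra.
  apply: intF_le_ae => //; first exact: contB.
  apply: filterS hj => t /= + ht => /(_ ht); rewrite NV.
  set y := simplex_param _ t; set LB := _ * B => hLB.
  have := ler_normlP _ _ hLB => -[h1 h2].
  have := sqr_ge0 (bval v k y); have := sqr_ge0 (bval v k' y).
  set a := bval v k y ^+ 2; set b := bval v k' y ^+ 2 => b0 a0.
  have := ler_wpM2r a0 h1; have := ler_wpM2r b0 h1.
  have LB0 : 0 <= LB by apply: mulr_ge0.
  have := mulr_ge0 LB0 a0; have := mulr_ge0 LB0 b0.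
  by rewrite -[2^-1 * B * _]mulrA [B * _]mulrC -/LB; lra.
have -> : form_C eta v v = 2^-1 * (\sum_F ef F - intE (fun k x => divg eta k x * bval v k x ^+ 2))
    + \sum_F (if kminus F then g2 F - g1 F else g3 F).
  rewrite /form_C /sumFI /sumFB.
  have -> : intE (fun k x => mxdot (bvval eta k x) (grad v k x) * bval v k x) =
     2^-1 * (\sum_F ef F - intE (fun k x => divg eta k x * bval v k x ^+ 2)).
    rewrite /ef exchange_sides /intE -sumrB mulr_sumr; apply: eq_bigr => k _.
    exact: convection_by_parts.
  rewrite -!addrA; congr (_ + _).
  rewrite [RHS](bigID (fun F => isSome (kminus F))) /= addrA; congr (_ + _).
    rewrite -sumrN -big_split /=; apply: eq_bigr => F.
    by case: (kminus F) => // k' _; rewrite addrC.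
  by apply: eq_bigr => F; case: (kminus F).
have hd : intE (fun k x => divg eta k x * bval v k x ^+ 2) <= B * sqL2 v.
  rewrite /sqL2 mulr_sumr; apply: ler_sum => k _.
  rewrite -intK_Z //; last exact: contX.
  apply: intK_le_ae => //; [by rewrite /divg; apply: contM; cont; exact: cv|by cont; exact: cv|].
  apply: filterS (hdiv k) => x /= h kx; apply: ler_wpM2r; first exact: sqr_ge0.
  exact: le_trans (ler_norm _) (h kx).
have : \sum_F - (2^-1 * B * ((l2h l F)^-1 * \sum_(k | adj F k)
      intF F (fun x => \sum_(j < 1) peval (v k) x ^+ 2))) <=
    \sum_F (2^-1 * ef F + (if kminus F then g2 F - g1 F else g3 F)) by apply: ler_sum => F _; exact: hface.
rewrite sumrN -mulr_sumr big_split /= -mulr_sumr.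
have := ler_wpM2l B0 tr.
have : 0 <= B * sqL2 v.
  apply: mulr_ge0 => //; apply: sumr_ge0 => k _; apply: Rintegral_ge0 => x _; exact: sqr_ge0.
have : 0 <= Kt * (B * sqL2 v).
  apply: mulr_ge0; [exact: ltW|apply: mulr_ge0 => //].
  by apply: sumr_ge0 => k _; apply: Rintegral_ge0 => x _; exact: sqr_ge0.
lra.
Qed.

End convection.

Section korn_poincare.
Context {R : realType} {n : nat} {Om : set 'rV[R]_n.+1} (M : polymesh Om).
Hypothesis bOm : boxed Om.
Variables (l : nat) (Kt : R).
Hypotheses (l1 : (1 <= l)%N) (Kt0 : 0 < Kt).
Hypothesis trace_ineq : forall (k : elt M) (p : mpoly n.+1 R), (msize p <= l.+1)%N ->
  hdiam k * (\sum_(F | adj F k) intF F (fun x => peval p x ^+ 2))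
  <= Kt * \int[leb n.+1]_(x in dom k) peval p x ^+ 2.
Local Notation E := 'rV[R]_n.+1.
Implicit Types (k : elt M) (F : face M) (v : bvpoly M).
Variables (cs : coefficients R n) (mu_m r : R).
Hypotheses (mu_m0 : 0 < mu_m) (cmu : elementwise_constant M (mu cs)).
Hypothesis mu_ge : ae_on Om (fun x => mu_m <= mu cs x).
Hypothesis Om_r : forall x, Om x -> forall i, `|x ord0 i| <= r.

Lemma face_coor_le F t i : @refsimplex R n t ->
  `|simplex_param (fvert F) t ord0 i| <= r.
Proof.
move=> ht; set y := simplex_param _ t.
have : closure (dom (kplus F)) y.
  have := dom_frontier (kplus F) => /seteqP[_ /(_ y)] [] //.
  exists F; first by rewrite /= /adj eqxx.
  by apply/simplexP; exists t.
have /closure_id cl : closed [set x : E | `|x ord0 i| <= r] by apply: closed_le_cont; cont.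
suff : closure (dom (kplus F)) `<=` [set x : E | `|x ord0 i| <= r] by apply.
by rewrite [X in _ `<=` X]cl; apply: closureS => x kx; apply: Om_r; exact: dom_sub kx.
Qed.

Lemma diag_sqr_le (A : 'M[R]_n.+1) i : A i i ^+ 2 <= mxdot A A.
Proof.
rewrite mxdotE (bigD1 (i, i)) //= expr2 lerDl; apply: sumr_ge0 => z _.
by rewrite -expr2 sqr_ge0.
Qed.

Lemma poincare_by_parts v i k :
  \int[leb n.+1]_(x in dom k) (bval (v i) k x ^+ 2) =
  \sum_(F | adj F k) sgnF F k *
    intF F (fun x => x ord0 i * bval (v i) k x ^+ 2 * normal F ord0 i)
  - 2 * \int[leb n.+1]_(x in dom k) (x ord0 i * bval (v i) k x * eps v k x i i).
Proof.
have c1 : continuous (fun x : E => bval (v i) k x ^+ 2) by apply: contX; exact: continuous_peval.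
have c2 : continuous (fun x : E => x ord0 i * bval (v i) k x * eps v k x i i).
  by apply: contM; [cont|exact: cont_eps].
have c3 : continuous (fun x : E => 2 * (x ord0 i * bval (v i) k x * eps v k x i i)).
  by apply: contM => //; exact: contC.
have e : \sum_(F | adj F k) sgnF F k *
    intF F (fun x => x ord0 i * bval (v i) k x ^+ 2 * normal F ord0 i) =
  \int[leb n.+1]_(x in dom k) peval (mderiv i (coorX i * (v i k * v i k))) x.
  rewrite (divergence_dom bOm); apply: eq_bigr => F _; congr (_ * _).
  by apply: eq_intF => x; rewrite !pevalM pevalX /bval; ring.
have e' := intK_D bOm k c1 c3; rewrite (intK_Z bOm k 2 c2) in e'.
apply/esym/eqP; rewrite subr_eq e; apply/eqP; apply: etrans e'.
apply: eq_Rintegral => x _.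
rewrite !mderivM mderivXE eqxx !(pevalD, pevalM) pevalC pevalX epsE /bval mul1r; by field.
Qed.

(** A Poincare inequality controlled by the symmetric gradient alone: the
    integration by parts of [x_i v_i^2] only meets the diagonal entries of the
    strain, and the diagonal entries of the jump on the faces. *)
Lemma korn_poincare (al : penalties R) v i : in_Pv l v -> 0 < al3 al ->
  sqL2 (v i) <= (4 * r ^+ 2 / mu_m + 8 * Kt * r ^+ 2 / (al3 al * mu_m)) * sq_dGe l cs al v.
Proof.
move=> vl al0.
pose w := v i.
have cw k : continuous (bval w k) by exact: continuous_peval.
have cw2 k : continuous (fun x => bval w k x ^+ 2) by exact: contX.
have ce2 k : continuous (fun x => mxdot (eps v k x) (eps v k x)).
  by apply: cont_mxdot => a b; exact: cont_eps.
have cJ2 F : continuous (fun x => mxdot (vjump (bvval v) F x) (vjump (bvval v) F x)).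
  by apply: cont_mxdot => a b; exact: cont_vjump.
have r2 : 0 <= r ^+ 2 by exact: sqr_ge0.
have L0 F : 0 < l2h l F by exact: l2h_gt0.
have tr := @weighted_trace _ _ _ M bOm l l1 'I_1 Kt (fun k _ => w k) (ltW Kt0) trace_ineq
  (fun k _ => vl i k).
have trE : intE (fun k x => \sum_(j < 1) peval (w k) x ^+ 2) = sqL2 w.
  by apply: eq_bigr => k _; apply: eq_Rintegral => x _; rewrite big_ord1.
rewrite trE in tr.
have sE F k : intF F (fun x => \sum_(j < 1) peval (w k) x ^+ 2) = intF F (fun x => bval w k x ^+ 2).
  by apply: eq_intF => x; rewrite big_ord1.
pose ef F := \sum_(k | adj F k) sgnF F k * intF F (fun x => x ord0 i * bval w k x ^+ 2 * normal F ord0 i).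
pose B := intE (fun k x => mxdot (eps v k x) (eps v k x)).
pose J := \sum_F l2h l F * intF F (fun x => mxdot (vjump (bvval v) F x) (vjump (bvval v) F x)).
have hvol : - (2 * intE (fun k x => x ord0 i * bval w k x * eps v k x i i)) <=
    4^-1 * sqL2 w + 4 * r ^+ 2 * B.
  rewrite /sqL2 /B /intE !mulr_sumr -sumrN -big_split; apply: ler_sum => k _.
  have c2 : continuous (fun x : E => x ord0 i * bval w k x * eps v k x i i).
    by apply: contM; [apply: contM => //; exact: continuous_coor|exact: cont_eps].
  rewrite /= -mulNr -(intK_Z bOm k (- 2) c2) -(intK_Z bOm k _ (cw2 k)) -(intK_Z bOm k _ (ce2 k)).
  rewrite -intK_D //; [|by apply: contM => //; exact: contC..].
  apply: intK_le => //; [by apply: contM => //; exact: contC| |].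
    by apply: contD; apply: contM => //; exact: contC.
  move=> x kx; have hx := Om_r (dom_sub kx) i.
  have h1 := diag_sqr_le (eps v k x) i.
  have h2 : x ord0 i ^+ 2 <= r ^+ 2.
    by rewrite -real_normK ?num_real // lerXn2r ?nnegrE // (le_trans _ hx).
  have h3 := ler_pM (sqr_ge0 _) (sqr_ge0 _) h2 h1.
  have := sqr_ge0 (2^-1 * bval w k x + 2 * (x ord0 i * eps v k x i i)).
  by move: h3; nra.
have hface F : ef F <= (Kt *+ 4)^-1 * ((l2h l F)^-1 * \sum_(k | adj F k)
      intF F (fun x => \sum_(j < 1) peval (w k) x ^+ 2))
    + 2 * Kt * r ^+ 2 * (l2h l F * intF F (fun x => mxdot (vjump (bvval v) F x) (vjump (bvval v) F x))).
  have hpt (x : E) (s t nu J2 : R) : `|x ord0 i| <= r -> ((s - t) * nu) ^+ 2 <= J2 ->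
      x ord0 i * s ^+ 2 * nu - x ord0 i * t ^+ 2 * nu <=
      (Kt *+ 4)^-1 * (l2h l F)^-1 * (s ^+ 2 + t ^+ 2) + 2 * Kt * r ^+ 2 * l2h l F * J2.
    move=> hx hJ.
    have x2 : x ord0 i ^+ 2 <= r ^+ 2.
      by rewrite -real_normK ?num_real // lerXn2r ?nnegrE // (le_trans _ hx).
    have c0 : 0 < Kt *+ 4 * l2h l F by rewrite mulr_gt0 ?pmulrn_lgt0.
    have J20 : 0 <= J2 by apply: le_trans hJ; exact: sqr_ge0.
    have st0 : 0 <= s ^+ 2 + t ^+ 2 by rewrite addr_ge0 ?sqr_ge0.
    have hm : (2^-1 * (x ord0 i * ((s - t) * nu) * (s + t))) ^+ 2
        <= (2^-1 * r ^+ 2 * J2) * (s ^+ 2 + t ^+ 2).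
      have h1 := ler_pM (sqr_ge0 _) (sqr_ge0 _) x2 hJ.
      have h2 : (s + t) ^+ 2 <= 2 * (s ^+ 2 + t ^+ 2) by have := sqr_ge0 (s - t); nra.
      have := ler_pM (mulr_ge0 (sqr_ge0 _) (sqr_ge0 _)) (sqr_ge0 _) h1 h2.
      rewrite -!exprMn; set a := x ord0 i * _; rewrite [(_ * (a * _)) ^+ 2]exprMn; lra.
    have := young c0 (mulr_ge0 (mulr_ge0 _ r2) J20) st0 hm.
    by rewrite invr_ge0 => /(_ (ltW _)); rewrite ltr0n => /(_ erefl); rewrite invfM; lra.
  have cc k : continuous (fun x : E => x ord0 i * bval w k x ^+ 2 * normal F ord0 i).
    by apply: contM; [apply: contM => //; exact: continuous_coor|exact: contC].
  have jE x : (peval (trj w F) x * normal F ord0 i) ^+ 2 <=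
      mxdot (vjump (bvval v) F x) (vjump (bvval v) F x).
    by rewrite -vjumpE; exact: diag_sqr_le.
  rewrite /ef !sum_sides mulrA [X in _ <= _ + X]mulrA; move: jE; rewrite /trj.
  set k := kplus F; case hF: (kminus F) => [k'|] jE.
    have kk' : k' != k.
      by apply/eqP => e; have := face_two_elements F; rewrite hF e eqxx.
    rewrite !sE /sgnF eqxx (negPf kk') mul1r mulN1r.
    rewrite -(intF_D F (cw2 k) (cw2 k')) -!intF_Z //; last exact: contD.
    rewrite -intF_D; [|by apply: contM; [exact: contC|]; rewrite //; exact: contD..].
    rewrite -(intF_B F (cc k) (cc k')).
    apply: intF_le; [exact: contB| |].
      apply: contD; apply: contM => //; try exact: contC.
      exact: contD.
    move=> t ht; apply: hpt; first exact: face_coor_le.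
    by have := jE (simplex_param (fvert F) t); rewrite pevalB.
  rewrite sE /sgnF eqxx mul1r -!intF_Z // -intF_D; [|by apply: contM => //; exact: contC..].
  apply: intF_le => //; first by apply: contD; apply: contM => //; exact: contC.
  move=> t ht.
  have := hpt (simplex_param (fvert F) t) (bval w k (simplex_param (fvert F) t)) 0
    (normal F ord0 i) _ (face_coor_le F i ht).
  rewrite subr0 expr0n mulr0 mul0r subr0 addr0; apply.
  by have := jE (simplex_param (fvert F) t); rewrite subr0.
have hsum : sqL2 w <= \sum_F ef F - 2 * intE (fun k x => x ord0 i * bval w k x * eps v k x i i).
  rewrite /ef exchange_sides /sqL2 /intE mulr_sumr -sumrB; apply: ler_sum => k _.
  have e := poincare_by_parts v i k; rewrite -/w in e; rewrite e.
  exact: lexx.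
have hf : \sum_F ef F <= 4^-1 * sqL2 w + 2 * Kt * r ^+ 2 * J.
  apply: (@le_trans _ _ (\sum_F ((Kt *+ 4)^-1 * ((l2h l F)^-1 * \sum_(k | adj F k)
      intF F (fun x => \sum_(j < 1) peval (w k) x ^+ 2))
    + 2 * Kt * r ^+ 2 * (l2h l F * intF F (fun x => mxdot (vjump (bvval v) F x) (vjump (bvval v) F x)))))).
    by apply: ler_sum => F _; exact: hface.
  rewrite big_split /= -!mulr_sumr lerD2r.
  rewrite -(ler_pM2l (_ : 0 < Kt *+ 4)) ?pmulrn_lgt0 // mulrA divff ?mul1r ?gt_eqF ?pmulrn_lgt0 //.
  by apply: le_trans tr _; lra.
have hw : sqL2 w <= 8 * r ^+ 2 * B + 4 * Kt * r ^+ 2 * J by move: hvol hf hsum; lra.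
have hB : mu_m * 2 * B <= intE (fun k x => let t := Num.sqrt (2 * mu cs x) *: eps v k x in mxdot t t).
  rewrite /B /intE mulr_sumr; apply: ler_sum => k _.
  have -> : \int[leb n.+1]_(x in dom k) (let t := Num.sqrt (2 * mu cs x) *: eps v k x in mxdot t t)
     = \int[leb n.+1]_(x in dom k) (2 * onelt (mu cs) k * mxdot (eps v k x) (eps v k x)).
    apply: eq_Rintegral => x /set_mem kx; cbv zeta.
    rewrite (onelt_const cmu kx) mxdot_scale_sqrt // mulr_ge0 //.
    by apply: ltW; apply: lt_le_trans (onelt_mu_ge cmu mu_ge k).
  rewrite -!intK_Z //; apply: intK_le => //; [by apply: contM => //; exact: contC..|].
  move=> x _; apply: ler_wpM2r; first exact: mxdot_ge0.
  by have := onelt_mu_ge cmu mu_ge k; lra.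
have hJ : al3 al * (mu_m / 2) * J <=
   \sum_F intF F (fun x => let t := Num.sqrt (zeta l cs al F) *: vjump (bvval v) F x in mxdot t t).
  rewrite /J mulr_sumr; apply: ler_sum => F _; rewrite mulrA.
  have -> : intF F (fun x => let t := Num.sqrt (zeta l cs al F) *: vjump (bvval v) F x in mxdot t t)
     = pen_s (al3 al) l (mu cs) F * intF F (fun x => mxdot (vjump (bvval v) F x) (vjump (bvval v) F x)).
    rewrite -intF_Z //; apply: eq_intF => x; cbv zeta; rewrite mxdot_scale_sqrt //.
    by apply: ltW; apply: pen_s_gt0 mu_m0 _ _ _ _ _.
  apply: ler_wpM2r; first by apply: intF_ge0 => x; exact: mxdot_ge0.
  exact: pen_s_ge.
set D1 := intE _ in hB; set D2 := \sum_F _ in hJ.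
have -> : sq_dGe l cs al v = D1 + D2 by [].
have B0 : 0 <= B by apply: sumr_ge0 => k _; apply: Rintegral_ge0 => x _; exact: mxdot_ge0.
have J0 : 0 <= J.
  apply: sumr_ge0 => F _; apply: mulr_ge0; first exact: ltW.
  by apply: intF_ge0 => x; exact: mxdot_ge0.
have D10 : 0 <= D1 by apply: le_trans hB; rewrite !mulr_ge0 // ltW.
have D20 : 0 <= D2 by apply: le_trans hJ; rewrite !mulr_ge0 ?divr_ge0 // ltW.
have e1 : 8 * r ^+ 2 * B <= 4 * r ^+ 2 / mu_m * D1.
  rewrite [leRHS]mulrAC ler_pdivlMr //.
  have := ler_wpM2l r2 hB; lra.
have am0 : 0 < al3 al * mu_m by exact: mulr_gt0.
have e2 : 4 * Kt * r ^+ 2 * J <= 8 * Kt * r ^+ 2 / (al3 al * mu_m) * D2.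
  rewrite [leRHS]mulrAC ler_pdivlMr //.
  have := ler_wpM2l r2 hJ => h; have := ler_wpM2l (ltW Kt0) h; lra.
have f1 : 0 <= 4 * r ^+ 2 / mu_m * D2.
  by apply: mulr_ge0 => //; apply: divr_ge0; [exact: mulr_ge0|exact: ltW].
have f2 : 0 <= 8 * Kt * r ^+ 2 / (al3 al * mu_m) * D1.
  by apply: mulr_ge0 => //; apply: divr_ge0; [apply: mulr_ge0 => //; apply: mulr_ge0 => //|]; exact: ltW.
move: hw e1 e2 f1 f2; rewrite -/w; lra.
Qed.

End korn_poincare.

Lemma Rintegral_sum d (T : measurableType d) (R : realType)
    (mu : {measure set T -> \bar R}) (D : set T) (J : Type) (r : seq J)
    (f : J -> T -> R) : measurable D ->
  (forall j, mu.-integrable D (EFin \o f j)) ->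
  \int[mu]_(x in D) (\sum_(j <- r) f j x) = \sum_(j <- r) \int[mu]_(x in D) f j x.
Proof.
move=> mD fi; rewrite /Rintegral sum_fine; last first.
  by move=> j _; apply: integrable_fin_num => //; exact: fi.
congr fine; rewrite -integral_sum //; apply: eq_integral => x _.
by rewrite sumEFin.
Qed.

Section data.
Context {R : realType} {n : nat} {Om : set 'rV[R]_n.+1} (M : polymesh Om).
Hypotheses (bOm : boxed Om) (mOm : measurable Om).
Local Notation E := 'rV[R]_n.+1.
Implicit Types (k : elt M) (F : face M) (v : bpoly M).

Lemma intE_sub (G : E -> R) : (forall x, 0 <= G x) -> L1_field Om G ->
  intE (fun k : elt M => G) <= \int[leb n.+1]_(x in Om) G x.
Proof.
move=> G0 iG; have mG : measurable_fun Om (EFin \o G) := measurable_int _ iG.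
pose U := \big[setU/set0]_(k <- index_enum (elt M)) dom k.
have UOm : U `<=` Om.
  by rewrite /U -bigcup_seq => x [k _]; exact: dom_sub.
have mU : measurable U by apply: bigsetU_measurable => k _; exact: measurable_dom.
have mGU : measurable_fun U (EFin \o G) by exact: measurable_funS mG.
have Gk0 k : (0 <= \int[leb n.+1]_(x in dom k) (G x)%:E)%E.
  by apply: integral_ge0 => x _; rewrite lee_fin.
have hle : (\sum_(k : elt M) \int[leb n.+1]_(x in dom k) (G x)%:E <=
    \int[leb n.+1]_(x in Om) (G x)%:E)%E.
  rewrite -(@ge0_integral_bigsetU _ _ _ (leb n.+1) _ (@dom _ _ _ M) (EFin \o G)) //.
  - apply: ge0_subset_integral => //; by move=> x _; rewrite lee_fin.
  - by move=> k; exact: measurable_dom.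
  - exact: index_enum_uniq.
  - by move=> k k' _ _ [x [kx k'x]]; exact: dom_unique kx k'x.
  - by move=> x _; rewrite lee_fin.
have fG : (\int[leb n.+1]_(x in Om) (G x)%:E)%E \is a fin_num by exact: integrable_fin_num.
rewrite /intE /Rintegral sum_fine; last first.
  move=> k _; apply: integrable_fin_num => //; first exact: measurable_dom.
  by apply: integrableS iG => //; [exact: measurable_dom|exact: dom_sub].
apply: fine_le => //.
by rewrite ge0_fin_numE ?sume_ge0 //; apply: le_lt_trans hle _; rewrite -ge0_fin_numE // integral_ge0 // => x _; rewrite lee_fin.
Qed.

Lemma measurable_peval (A : set E) (p : mpoly n.+1 R) : measurable A ->
  measurable_fun A (peval p : E -> measurableTypeR R).
Proof.
by move=> mA; apply: measurable_funTS; exact: continuous_measurable_row (@continuous_peval R n p).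
Qed.

Lemma L2_mul_integrable (H : E -> R) v k : L2_field Om H ->
  (leb n.+1).-integrable (dom k) (EFin \o (fun x => H x * bval v k x)).
Proof.
move=> [mH iH]; have mk := @measurable_dom _ _ _ M k.
have mHk : measurable_fun (dom k) (H : E -> measurableTypeR R).
  by apply: measurable_funS mH => //; exact: dom_sub.
have iH2 : (leb n.+1).-integrable (dom k) (EFin \o (fun x => H x ^+ 2)).
  by apply: integrableS iH => //; exact: dom_sub.
have iv2 : (leb n.+1).-integrable (dom k) (EFin \o (fun x => bval v k x ^+ 2)).
  by apply: integrable_dom => //; apply: contX; exact: continuous_peval.
apply: le_integrable (integrableD mk iH2 iv2) => //.
  by apply/measurable_EFinP; apply: measurable_funM => //; exact: measurable_peval.
move=> x _; rewrite /= lee_fin [X in _ <= X]ger0_norm ?addr_ge0 ?sqr_ge0 //.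
rewrite ler_norml; have := sqr_ge0 (H x + bval v k x); have := sqr_ge0 (H x - bval v k x).
by move: (sqr_ge0 (H x)) (sqr_ge0 (bval v k x)) => *; apply/andP; split; nra.
Qed.

Lemma data_le (H : E -> R) v (c : R) : 0 < c -> L2_field Om H ->
  intE (fun k x => H x * bval v k x) <= c * sqL2 v + (4 * c)^-1 * sqnormL2 Om H.
Proof.
move=> c0 LH; have [mH iH] := LH.
have c4 : 0 < 4 * c by rewrite mulr_gt0.
have hsub := intE_sub (fun x => sqr_ge0 (H x)) iH.
apply: (@le_trans _ _ (c * sqL2 v + (4 * c)^-1 * intE (fun k : elt M => fun x => H x ^+ 2))); last first.
  by rewrite lerD2l; apply: ler_wpM2l => //; rewrite invr_ge0 ltW.
rewrite /intE /sqL2 !mulr_sumr -big_split; apply: ler_sum => k _ /=.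
have mk := @measurable_dom _ _ _ M k.
have iH2 : (leb n.+1).-integrable (dom k) (EFin \o (fun x => H x ^+ 2)).
  by apply: integrableS iH => //; exact: dom_sub.
have iv2 : (leb n.+1).-integrable (dom k) (EFin \o (fun x => bval v k x ^+ 2)).
  by apply: integrable_dom => //; apply: contX; exact: continuous_peval.
have i1 := integrableZl mk c iv2; have i2 := integrableZl mk (4 * c)^-1 iH2.
rewrite -(RintegralZl c mk iv2) -(RintegralZl (4 * c)^-1 mk iH2) -(RintegralD mk i1 i2).
have i3 : (leb n.+1).-integrable (dom k)
    (EFin \o (fun x => c * bval v k x ^+ 2 + (4 * c)^-1 * H x ^+ 2)).
  by apply: (eq_integrable mk _ _ _ (integrableD mk i1 i2)).
apply: le_Rintegral => //; first exact: L2_mul_integrable.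
move=> x _; rewrite -(ler_pM2l c4) mulrDr [X in _ <= _ + X]mulrA divff ?gt_eqF // mul1r.
by have := sqr_ge0 (2 * c * bval v k x - H x); nra.
Qed.

Lemma vdata_le (f : E -> E) (u : bvpoly M) (c : R) : 0 < c -> L2_vfield Om f ->
  intE (fun k x => mxdot (f x) (bvval u k x)) <=
  c * (\sum_i sqL2 (u i)) + (4 * c)^-1 * vsqnormL2 Om f.
Proof.
move=> c0 Lf.
have -> : intE (fun k x => mxdot (f x) (bvval u k x)) =
    \sum_i intE (fun k x => f x ord0 i * bval (u i) k x).
  rewrite /intE exchange_big; apply: eq_bigr => k _ /=.
  rewrite -(Rintegral_sum _ (@measurable_dom _ _ _ M k)
    (fun i => L2_mul_integrable (u i) k (Lf i))).
  by apply: eq_Rintegral => x _; rewrite mxdot_row; apply: eq_bigr => i _; rewrite mxE.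
have -> : vsqnormL2 Om f = \sum_i sqnormL2 Om (fun x => f x ord0 i).
  rewrite -(Rintegral_sum _ mOm (fun i => (Lf i).2)).
  by apply: eq_Rintegral => x _; rewrite mxdot_row; apply: eq_bigr => i _; rewrite expr2.
rewrite !mulr_sumr -big_split; apply: ler_sum => i _ /=.
exact: data_le (Lf i).
Qed.

End data.

Section positivity.
Context {R : realType} {n : nat} {Om : set 'rV[R]_n.+1} (M : polymesh Om).
Hypotheses (bOm : boxed Om) (mOm : measurable Om).
Local Notation E := 'rV[R]_n.+1.
Variables (cs : coefficients R n) (mu_m mu_M cf_M beta_M : R).
Hypothesis hcs : admissible_coefficients Om cs mu_m mu_M cf_M beta_M.

Lemma L1_measurable (f : E -> R) : L1_field Om f ->
  measurable_fun Om (f : E -> measurableTypeR R).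
Proof. by move=> /measurable_int ?; apply/measurable_EFinP. Qed.

Lemma form_M_ge0 (w : dstate M) : 0 <= form_M cs w w.
Proof.
apply: sumr_ge0 => k _; have mk := @measurable_dom _ _ _ M k.
have [i1 i2 i3 i4] := adm_int hcs; have [m1 m2 m3] := adm_meas hcs.
have mS (f : E -> R) : measurable_fun Om (f : E -> measurableTypeR R) ->
    measurable_fun (dom k) (f : E -> measurableTypeR R).
  by apply: measurable_funS => //; exact: dom_sub.
have ma := mS _ (L1_measurable i1); have mb := mS _ (L1_measurable i2).
have mc := mS _ (L1_measurable i3); have ml := mS _ (L1_measurable i4).
have mal := mS _ m1; have mbe := mS _ m2.
have mp v : measurable_fun (dom k) (bval v k : E -> measurableTypeR R) by exact: measurable_peval.
apply: Rintegral_ae_ge0 => //.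
  cbv zeta; repeat first [apply: measurable_funB|apply: measurable_funD|apply: measurable_funM];
  first [exact: ma | exact: mb | exact: mc | exact: ml | exact: mal | exact: mbe | exact: mp].
move: (adm_b0 hcs) (adm_a0 hcs) (adm_c0 hcs) (adm_lam hcs); rewrite /ae_on => hb ha hc hlam.
have h : {ae leb n.+1, forall x, Om x -> 0 <= b0 cs x <= a0 cs x}.
  by apply: filterS2 hb ha => x h1 h2 Ox; rewrite h1 ?h2.
apply: filterS3 h hc hlam => x h1 h2 h3 kx.
have Ox := dom_sub kx; have /andP[b00 a00] := h1 Ox; cbv zeta.
rewrite -![_ * _ * _]mulrA -!expr2.
by rewrite !addr_ge0 // mulr_ge0 ?sqr_ge0 ?subr_ge0 ?invr_ge0 ?h2 // ltW ?h3.
Qed.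

Lemma form_D_ge0 (al : penalties R) m (phi : bpoly M) : 0 <= al4 al ->
  0 <= form_D m al phi phi.
Proof.
move=> al0; apply: sumr_ge0 => F _; apply: intF_ge0 => x.
apply: mulr_ge0; last exact: mxdot_ge0.
have h0 (k : elt M) : 0 <= hdiam k / m%:R by rewrite divr_ge0 // ltW // hdiam_gt0.
by rewrite /pen_D; case: (kminus F) => [k'|]; rewrite mulr_ge0 // le_min !h0.
Qed.

End positivity.


Theorem theorem4p1 (R : realType) (n : nat) (hd : n.+1 = 2%N \/ n.+1 = 3%N)
  (Om : set 'rV[R]_n.+1) (hOm : polyhedral_domain Om)
  (I : Type) (M : I -> polymesh Om) (hM : regular_family M)
  (l m : nat) (hl : (1 <= l)%N) (hm : (1 <= m)%N) (hlm : (m <= l + 1)%N)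
  (cs : coefficients R n) (mu_m mu_M cf_M beta_M : R)
  (hcs : admissible_coefficients Om cs mu_m mu_M cf_M beta_M)
  (hmu : forall i, elementwise_constant (M i) (mu cs))
  (hcf : forall i, elementwise_constant (M i) (c_f cs))
  (h24 : two_of_four Om cs) :
  exists2 abar : R, 0 < abar &
  forall al : penalties R,
    abar <= al1 al -> abar <= al2 al -> abar <= al3 al -> abar <= al4 al ->
  forall a1 b1 c1 : R, 0 < a1 -> 0 < b1 -> 0 < c1 ->
    stability_constants M l m cs al a1 b1 c1 ->
  exists del C : R, 0 < del /\ 0 < C /\
  forall (i : I) (K Theta : 'rV[R]_n.+1 -> 'M[R]_n.+1),
    admissible_tensor (M i) K -> admissible_tensor (M i) Theta ->
  forall (eta : bvpoly (M i)) (H g : 'rV[R]_n.+1 -> R)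
    (f : 'rV[R]_n.+1 -> 'rV[R]_n.+1),
    in_Pv l eta -> L2_field Om H -> L2_field Om g -> L2_vfield Om f ->
    (dG_infty l eta <= (del * a1)%:E)%E ->
  forall w : dstate (M i), is_solution l m cs al K Theta eta H g f w ->
    a1 * sqL2 (dT w) + b1 * sqL2 (dphi w) + c1 * sqL2 (dp w)
    + sq_dGe l cs al (du w) + sq_dGT l al Theta (dT w) + sq_dGp l al K (dp w)
    <= C * (sqnormL2 Om H + sqnormL2 Om g + vsqnormL2 Om f).
Proof.
have [C0 C00 hreg] := hM; have [Kt Kt0 htrace] := @element_trace R n l C0 C00.
have bOm : boxed Om := bounded_set_boxed (pd_bounded hOm).
have mOm : measurable Om := open_measurable_row (pd_open hOm).
have [r hr] := bOm.
have hr' x : Om x -> forall i, `|x ord0 i| <= r by move=> Ox i; apply: ltW; exact: hr.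
have [mu_m0 _ _] := adm_const hcs.
have mu_ge : ae_on Om (fun x => mu_m <= mu cs x).
  have := adm_mu hcs; rewrite /ae_on => h.
  by apply: filterS h => x h Ox; have /andP[] := h Ox.
exists (Kt *+ 16); first by rewrite pmulrn_lgt0.
move=> al hal1 hal2 hal3 hal4 a1 b1 c1 a10 b10 c10 [Cs Cs0 hstab].
have Kt16 : 0 < Kt *+ 16 by rewrite pmulrn_lgt0.
have al30 : 0 < al3 al := lt_le_trans Kt16 hal3.
have al40 : 0 < al4 al := lt_le_trans Kt16 hal4.
pose CK := 4 * r ^+ 2 / mu_m + 8 * Kt * r ^+ 2 / (al3 al * mu_m) + 1.
have CK0 : 0 < CK.
  have r2 := sqr_ge0 r; rewrite ltr_wpDl // addr_ge0 //.
    by apply: divr_ge0; [exact: mulr_ge0|exact: ltW].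
  apply: divr_ge0; first by apply: mulr_ge0 => //; apply: mulr_ge0 => //; exact: ltW.
  by apply: mulr_ge0; exact: ltW.
pose cT := a1 / (16 * Cs); pose cp := c1 / (16 * Cs); pose cu := (8 * (n.+1%:R * CK))^-1.
have cT0 : 0 < cT by rewrite divr_gt0 ?mulr_gt0.
have cp0 : 0 < cp by rewrite divr_gt0 ?mulr_gt0.
have cu0 : 0 < cu by rewrite invr_gt0 !mulr_gt0.
pose Q := (4 * cT)^-1 + (4 * cp)^-1 + (4 * cu)^-1 + 1.
have [qT qp qu] : [/\ 0 < (4 * cT)^-1, 0 < (4 * cp)^-1 & 0 < (4 * cu)^-1].
  by split; rewrite invr_gt0 mulr_gt0.
have Q0 : 0 < Q by rewrite !addr_gt0.
exists ((1 + Kt) * (16 * Cs))^-1, ((2 * Cs + 2) * (2 * Q) + Cs); split.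
  by rewrite invr_gt0 !mulr_gt0 // addr_gt0.
split; first by rewrite addr_gt0 // !mulr_gt0 // addr_gt0 // mulr_gt0.
move=> i K Theta hK hT eta H g f heta LH Lg Lf hinf w hsol.
have [[uP pP TP phiP] heq] := hsol.
have tr k (p : mpoly n.+1 R) (hp : (msize p <= l.+1)%N) :=
  htrace Om (M i) bOm (hreg i).1 k p hp.
have eM := form_M_ge0 mOm hcs w.
have eD := form_D_ge0 bOm m (dphi w) (ltW al40).
have eT := form_diff_coercive bOm hl Kt0 tr hT TP hal1.
have ep := form_diff_coercive bOm hl Kt0 tr hK pP hal2.
have ee := form_Ae_coercive bOm hl Kt0 tr mu_m0 (hmu i) mu_ge uP hal3.
have eC := form_C_ge bOm hl Kt0 tr TP hinf.
have dH := data_le bOm mOm (dT w) cT0 LH.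
have dg := data_le bOm mOm (dp w) cp0 Lg.
have df := vdata_le bOm mOm (du w) cu0 Lf.
have kp j := korn_poincare bOm hl Kt0 tr mu_m0 (hmu i) mu_ge hr' j uP al30.
have hst := hstab i K Theta hK hT eta H g f heta LH Lg Lf w hsol.
have := heq w (And4 uP pP TP phiP).
have sq0 (v : bpoly (M i)) : 0 <= sqL2 v.
  by apply: sumr_ge0 => k _; apply: Rintegral_ge0 => x _; exact: sqr_ge0.
have H0 : 0 <= sqnormL2 Om H by apply: Rintegral_ge0 => x _; exact: sqr_ge0.
have g0 : 0 <= sqnormL2 Om g by apply: Rintegral_ge0 => x _; exact: sqr_ge0.
have f0 : 0 <= vsqnormL2 Om f by apply: Rintegral_ge0 => x _; exact: mxdot_ge0.
have e0 : 0 <= sq_dGe l cs al (du w).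
  apply: addr_ge0; apply: sumr_ge0 => k _.
    by apply: Rintegral_ge0 => x _; exact: mxdot_ge0.
  by apply: intF_ge0 => x; exact: mxdot_ge0.
have hu : cu * (\sum_j sqL2 (du w j)) <= 8^-1 * sq_dGe l cs al (du w).
  have : \sum_j sqL2 (du w j) <= n.+1%:R * CK * sq_dGe l cs al (du w).
    apply: (@le_trans _ _ (\sum_(j < n.+1) CK * sq_dGe l cs al (du w))).
      apply: ler_sum => j _; apply: le_trans (kp j) _; apply: ler_wpM2r => //.
      by rewrite lerDl.
    by rewrite sumr_const card_ord -mulrA [leRHS]mulr_natl.
  move=> /(ler_wpM2l (ltW cu0)) /le_trans; apply.
  rewrite mulrA; have -> // : cu * (n.+1%:R * CK) = 8^-1.
  by rewrite /cu invfM -mulrA mulVf ?mulr1 // gt_eqF // mulr_gt0.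
have hC : (1 + Kt) * (((1 + Kt) * (16 * Cs))^-1 * a1) * sqL2 (dT w) = cT * sqL2 (dT w).
  by rewrite /cT; field; rewrite !gt_eqF ?addr_gt0.
rewrite hC in eC.
rewrite /form_rhs /form_AT /form_Ap; rewrite /sq_dGT /sq_dGp in eT ep *.
move: eM eD eT ep ee eC dH dg df hst hu.
set Mw := form_M _ _ _; set AT := form_diff Theta _ _ _; set Ap := form_diff K _ _ _.
set Ae := form_Ae _ _ _ _ _; set Cw := form_C _ _ _; set Dw := form_D _ _ _ _.
set rH := intE _; set rg := intE _; set rf := intE _; set dGT := sq_dG_diff Theta _ _.
set dGp := sq_dG_diff K _ _.
set dGe := sq_dGe _ _ _ _ in e0 *; set sT := sqL2 _; set sp := sqL2 (dp w); set sphi := sqL2 (dphi w).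
set su := \sum_j _; set nH := sqnormL2 _ H in H0 *; set ng := sqnormL2 _ g in g0 *; set nf := vsqnormL2 _ f in f0 *.
move=> eM eD eT ep ee eC dH dg df hst hu heqn.
have hT' : cT * sT * (16 * Cs) = a1 * sT by rewrite /cT; field; rewrite gt_eqF.
have hp' : cp * sp * (16 * Cs) = c1 * sp by rewrite /cp; field; rewrite gt_eqF.
have b1phi : 0 <= b1 * sphi by apply: mulr_ge0; [exact: ltW|exact: sq0].
have c1p : 0 <= c1 * sp by apply: mulr_ge0; [exact: ltW|exact: sq0].
have a1T : 0 <= a1 * sT by apply: mulr_ge0; [exact: ltW|exact: sq0].
have h8 : 2 * (cT * sT) + cp * sp <= 8^-1 * (Mw + Dw + dGe + nf).
  have Cs16 : 0 < 16 * Cs by rewrite mulr_gt0.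
  by rewrite -(ler_pM2r Cs16) mulrDl -[2 * _ * _]mulrA hT' hp'; lra.
(* the data, with one constant *)
have hS : (4 * cT)^-1 * nH + (4 * cp)^-1 * ng + ((4 * cu)^-1 + 1) * nf <= Q * (nH + ng + nf).
  have s1 := mulr_ge0 (ltW qT) g0; have s2 := mulr_ge0 (ltW qT) f0.
  have s3 := mulr_ge0 (ltW qp) H0; have s4 := mulr_ge0 (ltW qp) f0.
  have s5 := mulr_ge0 (ltW qu) H0; have s6 := mulr_ge0 (ltW qu) g0.
  by move: s1 s2 s3 s4 s5 s6; rewrite /Q; lra.
have dT0 : 0 <= dGT.
  apply: addr_ge0; apply: sumr_ge0 => z _; first by apply: Rintegral_ge0 => x _; exact: sqr_ge0.
  by apply: intF_ge0 => x; exact: sqr_ge0.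
have dp0 : 0 <= dGp.
  apply: addr_ge0; apply: sumr_ge0 => z _; first by apply: Rintegral_ge0 => x _; exact: sqr_ge0.
  by apply: intF_ge0 => x; exact: sqr_ge0.
set S := nH + ng + nf in hS *.
have hX : Mw + Dw + 2^-1 * (dGT + dGp + dGe) <= 2 * Q * S by lra.
have nfS : nf <= S by rewrite /S; lra.
have hCs : Cs * (Mw + Dw + dGe + nf) <= Cs * (2 * (2 * Q * S) + S).
  by rewrite ler_pM2l //; lra.
have QS0 : 0 <= Q * S by apply: mulr_ge0; [exact: ltW|rewrite /S; lra].
rewrite -/dGT -/dGp.
lra.
Qed.
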